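(* Let $0<\beta<1$, $v\ge 0$, and let $\{\mathcal{M}(t)\}_{t\ge0}$ be a non-homogeneous generalized counting process with intensity functions $\lambda_1(\cdot),\dots,\lambda_k(\cdot)$, independent of the inverse stable subordinator $\{Y_\beta(t)\}_{t\ge 0}$. The pmf $q_n^\beta(t,v)=\Pr\{I_\beta(t,v)=n\}$ of the increment process $I_\beta(t,v)=\mathcal{M}(Y_\beta(t)+v)-\mathcal{M}(v)$ satisfies the system of fractional differential-integral equations $$\frac{\mathrm{d}^{\beta}}{\mathrm{d}t^{\beta}}q^{\beta}_{n}(t,v)=\int_{0}^{\infty}\bigg(-\sum_{j=1}^{k}\lambda_{j}(u+v)q_{n}(u,v)+\sum_{j=1}^{n\wedge k}\lambda_{j}(u+v)q_{n-j}(u,v)\bigg)h_{\beta}(t,u)\,\mathrm{d}u,\quad n\ge 0,$$ with the initial condition $q^{\beta}_{n}(0,v)=\delta_{n,0}$, where $q_n(u,v)=\Pr\{\mathcal{M}(u+v)-\mathcal{M}(v)=n\}$ and $h_\beta(t,\cdot)$ is the density of $Y_\beta(t)$.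
   Context: Non-homogeneous generalized counting process (NGCP): given deterministic intensity functions $\lambda_j:[0,\infty)\to[0,\infty)$, $1\le j\le k$, with $\Lambda_j(t)=\int_0^t\lambda_j(u)\,\mathrm{d}u<\infty$ for all $t$, it is the counting process $\{\mathcal{M}(t)\}_{t\ge0}$ with $\mathcal{M}(0)=0$, independent increments, and $\Pr\{\mathcal{M}(t+h)=n\mid\mathcal{M}(t)=m\}$ equal to $1-\sum_{j=1}^k\lambda_j(t)h+o(h)$ if $n=m$, $\lambda_j(t)h+o(h)$ if $n=m+j$, $1\le j\le k$, and $o(h)$ if $n>m+k$. With $\Lambda_j(s,t)=\Lambda_j(t)-\Lambda_j(s)$, its increments have pmf $$q_n(t,v)=\Pr\{\mathcal{M}(t+v)-\mathcal{M}(v)=n\}=\sum_{\Omega(k,n)}\prod_{j=1}^{k}\frac{(\Lambda_j(v,t+v))^{x_j}}{x_j!}e^{-\sum_{j=1}^k\Lambda_j(v,t+v)},$$ where $\Omega(k,n)=\{(x_1,\dots,x_k): x_j\in\{0,1,2,\dots\},\ \sum_{j=1}^k jx_j=n\}$. Inverse stable subordinator: $Y_\beta(t)=\inf\{x\ge0:D_\beta(x)>t\}$, $D_\beta$ the stable subordinator with $\mathbb{E}(e^{-sD_\beta(t)})=e^{-ts^\beta}$. Its density $h_\beta(t,x)$ satisfies $\int_0^\infty e^{-st}h_\beta(t,x)\,\mathrm{d}t=s^{\beta-1}e^{-xs^\beta}$. $\frac{\mathrm{d}^\beta}{\mathrm{d}t^\beta}u(t)=\frac{1}{\Gamma(1-\beta)}\int_0^t(t-s)^{-\beta}u'(s)\,\mathrm{d}s$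 is the Caputo fractional derivative, $n\wedge k=\min\{n,k\}$, and $\delta_{n,0}$ is the Kronecker delta. *)

(* Defs.v *)
From HB Require Import structures.
From mathcomp Require Import all_boot all_order all_algebra.
From mathcomp Require Import all_classical all_reals all_analysis.
Set Implicit Arguments.
Unset Strict Implicit.
Unset Printing Implicit Defensive.
Import Order.TTheory GRing.Theory Num.Theory.
Import numFieldNormedType.Exports.
Local Open Scope classical_set_scope.
Local Open Scope ring_scope.

(* A process indexed by [0, +oo) is a function [R -> T -> _]; its values at
   negative times are never used. *)

Section Calculus.
Context {R : realType}.
Local Notation mu := (@lebesgue_measure R).

Definition Gamma (a : R) : R :=
  \int[mu]_(x in `]0, +oo[) (x `^ (a - 1) * expR (- x)).

Definition caputo_integrand (beta : R) (u : R -> R) (t : R) : R -> R :=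
  fun s => (t - s) `^ (- beta) * derive1 u s.

Definition caputo (beta : R) (u : R -> R) (t : R) : R :=
  (Gamma (1 - beta))^-1 * \int[mu]_(s in `]0, t[) caputo_integrand beta u t s.

(* [caputo] is total; this says that it is a genuine derivative and a genuine
   (absolutely convergent) integral rather than default values. *)
Definition caputo_derivable (beta : R) (u : R -> R) (t : R) : Prop :=
  (forall s, 0 < s -> s <= t -> derivable u s 1) /\
  mu.-integrable `]0, t[ (EFin \o caputo_integrand beta u t).

End Calculus.

Section Processes.
Context {R : realType} {d : measure_display} {T : measurableType d}.
Variable P : probability T R.
Local Notation mu := (@lebesgue_measure R).

(* [P (A | B)], with value 0 when [P B = 0] *)
Definition cond_prob (A B : set T) : R := fine (P (A `&` B)) / fine (P B).

(* Allowing [A i = setT] gives the product rule for every subfamily. *)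
Definition mutually_independent (n : nat) (X : 'I_n -> T -> R) : Prop :=
  forall A : 'I_n -> set R, (forall i, measurable (A i)) ->
    P (\bigcap_(i in [set: 'I_n]) (X i @^-1` A i)) =
    (\prod_(i < n) P (X i @^-1` A i))%E.

Definition independent_increments (X : R -> T -> R) : Prop :=
  forall (n : nat) (t : nat -> R),
    0 <= t 0%N -> (forall i, t i <= t i.+1) ->
    mutually_independent (fun (i : 'I_n) w => X (t i.+1) w - X (t i) w).

Definition stationary_increments (X : R -> T -> R) : Prop :=
  forall s t (A : set R), 0 <= s -> 0 <= t -> measurable A ->
    P [set w | A (X (s + t) w - X s w)] = P [set w | A (X t w - X 0 w)].

Definition process_sigma d' (U : measurableType d') (X : R -> T -> U) :
    set (set T) :=
  <<s [set E | exists t (A : set U),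
         [/\ 0 <= t, measurable A & E = X t @^-1` A]] >>.

Definition independent_processes d1 d2 (U1 : measurableType d1)
    (U2 : measurableType d2) (X1 : R -> T -> U1) (X2 : R -> T -> U2) : Prop :=
  forall E1 E2, process_sigma X1 E1 -> process_sigma X2 E2 ->
    P (E1 `&` E2) = (P E1 * P E2)%E.

Record counting_process (M : R -> T -> nat) : Prop := {
  counting_measurable : forall t, 0 <= t -> measurable_fun setT (M t) ;
  counting_nondecreasing :
    forall w s t, 0 <= s -> s <= t -> (M s w <= M t w)%N ;
  counting_right_continuous :
    forall w t, 0 <= t -> \forall s \near t^'+, (M s w = M t w) }.

Record intensities (k : nat) (lambda : nat -> R -> R) : Prop := {
  intensity_ge0 : forall j t, (1 <= j <= k)%N -> 0 <= t -> 0 <= lambda j t ;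
  intensity_integrable : forall j t, (1 <= j <= k)%N -> 0 <= t ->
    mu.-integrable `[0, t] (EFin \o lambda j) }.

(* The transition probabilities only constrain the process to the right of each
   time. They are thus insensitive to an additional independent jump at a
   deterministic time, which would destroy the Poisson-type law of the
   increments; [ngcp_no_fixed_jump] excludes such jumps. It is a consequence of
   that law, since the integrals of the intensities are continuous. *)
Record is_ngcp (k : nat) (lambda : nat -> R -> R) (M : R -> T -> nat) : Prop := {
  ngcp_intensities : intensities k lambda ;
  ngcp_counting : counting_process M ;
  ngcp_start : forall w, M 0 w = 0%N ;
  ngcp_independent_increments :
    independent_increments (fun t w => (M t w)%:R) ;
  ngcp_no_fixed_jump : forall t, 0 < t ->
    P [set w | M s w <> M t w] @[s --> t^'-] --> 0%E ;
  ngcp_trans0 : forall t m, 0 <= t -> P [set w | M t w = m] != 0%E ->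
    (fun h => cond_prob [set w | M (t + h) w = m] [set w | M t w = m]
              - (1 - (\sum_(1 <= j < k.+1) lambda j t) * h))
      =o_ (0^'+) (fun h : R => h) ;
  ngcp_trans_jump : forall t m j, 0 <= t -> P [set w | M t w = m] != 0%E ->
    (1 <= j <= k)%N ->
    (fun h => cond_prob [set w | M (t + h) w = (m + j)%N] [set w | M t w = m]
              - lambda j t * h)
      =o_ (0^'+) (fun h : R => h) ;
  ngcp_trans_big : forall t m n, 0 <= t -> P [set w | M t w = m] != 0%E ->
    (m + k < n)%N ->
    (fun h => cond_prob [set w | M (t + h) w = n] [set w | M t w = m])
      =o_ (0^'+) (fun h : R => h) }.

Record is_stable_subordinator (beta : R) (D : R -> T -> R) : Prop := {
  stable_measurable : forall t, 0 <= t -> measurable_fun setT (D t) ;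
  stable_start : forall w, D 0 w = 0 ;
  stable_nondecreasing : forall w s t, 0 <= s -> s <= t -> D s w <= D t w ;
  stable_right_continuous :
    forall w t, 0 <= t -> D s w @[s --> t^'+] --> D t w ;
  stable_independent_increments : independent_increments D ;
  stable_stationary_increments : stationary_increments D ;
  stable_laplace : forall s t, 0 <= s -> 0 <= t ->
    ('E_P[fun w => expR (- s * D t w)%R] = (expR (- t * s `^ beta)%R)%:E)%E }.

(* The set is almost surely nonempty, since D tends to +oo almost surely. *)
Definition inverse_subordinator (D : R -> T -> R) (t : R) (w : T) : R :=
  inf [set x | 0 <= x /\ t < D x w].

(* [f], considered on [0, +oo) only, is a density of the nonnegative [X]. *)
Record is_density (X : T -> R) (f : R -> R) : Prop := {
  density_measurable : measurable_fun (`[0, +oo[ : set R) f ;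
  density_ge0 : forall x, 0 <= x -> 0 <= f x ;
  density_prob : forall A : set R, measurable A ->
    P (X @^-1` A) = (\int[mu]_(x in A `&` `[0%R, +oo[) (f x)%:E)%E }.

(* Truncated subtraction is harmless: the paths of [M] are nondecreasing. *)
Definition ngcp_pmf (M : R -> T -> nat) (n : nat) (t v : R) : R :=
  fine (P [set w | (M (t + v)%R w - M v w)%N = n]).

Definition time_changed_pmf (M : R -> T -> nat) (Y : R -> T -> R)
    (n : nat) (t v : R) : R :=
  fine (P [set w | (M (Y t w + v)%R w - M v w)%N = n]).

End Processes.

(* Main.v *)
Require Import Defs.
From HB Require Import structures.
From mathcomp Require Import all_boot all_order all_algebra.
From mathcomp Require Import all_classical all_reals all_analysis.
Import Order.TTheory GRing.Theory Num.Theory.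
Import numFieldNormedType.Exports.
Local Open Scope classical_set_scope.
Local Open Scope ring_scope.
From mathcomp Require Import ring lra measurable_realfun.

(**
  Write [X] for [D 1], [F] for its distribution function and [b] for [beta].

  The argument rests on an explicit description of the law of the inverse
  subordinator [Y]. By self-similarity [D u] has the law of [u^(1/b) X], so that
  [P(Y t >= u) = P(D u <= t) = F (t u^(-1/b))] for [t, u > 0]
  ([inverse_subordinator_tail]). Hence, if [q u = q0 + \int_0^u g] with [g]
  integrable on the half-line and [q] is evaluated at the independent time [Y t],
  then Fubini's theorem gives

    E q (Y t) = q0 + \int_0^oo g u * F (t u^(-1/b)) du,

  the function called [mixture] below. Time enters only through [F], and the
  theorem is reduced to one identity for the stable law: for each fixed [u], the
  Caputo derivative of [t |-> F (t u^(-1/b))] is the density of [Y t] at [u].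
  Integrating it against [g] gives [caputo_mixture].

  This identity needs a bounded continuous density [p] of [X], while only the
  Laplace transform [e^(-s^b)] is known. Successive derivatives of the transform
  show that [E (X^N e^(-sX))] is a combination of terms [s^(-a) e^(-s^b)] with
  nonnegative coefficients, and [a > 1] once [N] is large ([stable_moments]).
  Such a term is the transform of the continuous function
  [r |-> E (r - X)_+^(a-1) / Gamma a], so by uniqueness of Laplace transforms
  ([ge0_laplace_unique]) the measure [x^N dF x] has a continuous density; dividing
  by [x^N] gives [p], together with its decay at zero and at infinity
  ([stable_density]). Uniqueness applied once more, to
  [E (X e^(-sX)) = b s^(b-1) e^(-s^b)], yields

    x p x = b / Gamma (1 - b) * \int_0^x z^(-b) p (x - z) dz

  ([frac_conv_density]). Up to rescaling, the right-hand side is the fractional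
  integral occurring in the Caputo derivative and the left-hand side is the
  density of [Y]. Any density of [Y t] agrees with this one almost everywhere, by
  Lebesgue's differentiation theorem ([inverse_density_ae]).

  It remains to write the law [q n] of the increments of the counting process in
  the form [q n u = (n == 0) + \int_0^u g n], where [g n] is the right-hand side
  of the forward equations. Independence of the increments and the transition
  probabilities give [g n] as the right derivative of [q n] at every point
  ([ngcp_pmf_right_derivative]). The intensities being merely integrable,
  ordinary differentiability is not available; but a left-continuous function with
  an integrable right derivative at every point is its integral
  ([integral_right_derivative]). Finally [g n] is integrable on the whole
  half-line, even when the intensities are not, because the expected number of
  departures from state [n] is at most one more than the expected number of
  arrivals from lower states ([integrable_intensity_sum_pmf]).
*)

Set Implicit Arguments.
Unset Strict Implicit.
Unset Printing Implicit Defensive.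

(** * Affine substitution and uniqueness of Laplace transforms *)

(** The image of Lebesgue measure under an affine map, rescaled, has the right
    value on intervals, and these determine the measure. *)
Lemma ge0_integral_affine (R : realType) (a b : R) (f : R -> \bar R) :
  a != 0 -> measurable_fun [set: R] f -> (forall x, (0 <= f x)%E) ->
  (\int[@lebesgue_measure R]_x f x =
   `|a|%:E * \int[@lebesgue_measure R]_x f (a * x + b)%R)%E.
Proof.
move=> a0 mf f0.
pose phi := (fun x : R => a * x + b) : R -> measurableTypeR R.
have mphi : measurable_fun setT phi.
  apply: measurable_funD => //; exact: measurable_funM.
pose c : {nonneg R} := NngNum (normr_ge0 a).
pose nu0 : {measure set (measurableTypeR R) -> \bar R} :=
  mscale c (pushforward (@lebesgue_measure R) phi).
pose nu := nu0 mphi.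
have E : forall A, measurable A -> @lebesgue_measure R A = nu A.
  apply: lebesgue_measure_unique => _ [[x y]] _ <-.
  transitivity (`|a|%:E * @lebesgue_measure R (phi @^-1` `]x, y]))%E; last by [].
  have yx : (y - b) / a - (x - b) / a = (y - x) / a by rewrite -mulrBl; congr (_ / _); ring.
  have [an|ap|/eqP] := ltgtP a 0; last by rewrite (negbTE a0).
    rewrite (_ : phi @^-1` _ = `[(y - b) / a, (x - b) / a[%classic); last first.
      apply/seteqP; split => z /=;
        by rewrite /phi !in_itv/= ltr_ndivlMr// ler_ndivrMr// ltrBlDr lerBrDr mulrC andbC.
    rewrite !lebesgue_measure_itv/= !lte_fin ltr_nM2r ?invr_lt0// ltrD2r.
    case: ifPn => _; last by rewrite mule0.
    rewrite -!EFinB -EFinM; congr EFin.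
    by rewrite -[X in _ * X]opprB yx (ltr0_norm an) mulrNN mulrC divfK.
  rewrite (_ : phi @^-1` _ = `](x - b) / a, (y - b) / a]%classic); last first.
    apply/seteqP; split => z /=;
      by rewrite /phi !in_itv/= ltr_pdivrMr// ler_pdivlMr// ltrBlDr lerBrDr mulrC.
  rewrite !lebesgue_measure_itv/= !lte_fin ltr_pM2r ?invr_gt0// ltrD2r.
  case: ifPn => _; last by rewrite mule0.
  rewrite -!EFinB -EFinM; congr EFin.
  by rewrite yx (gtr0_norm ap) mulrC divfK.
rewrite (eq_measure_integral nu); last by move=> A mA _; exact: E.
rewrite ge0_integral_mscale//; congr (_ * _)%E.
by rewrite ge0_integral_pushforward.
Qed.

(** With [N = n + 1], the probability that at least one of about [N e^(N a)]
    independent trials of success probability [e^(-N x)] succeeds. The expected number of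
    successes [N e^(N (a - x))] tends to infinity or to zero according as
    [x <= a] or [x > a], so this approximates the indicator of [x <= a]. It is
    moreover a polynomial in [e^(-N x)] without constant term. *)
Definition step_approx (R : realType) (a : R) (n : nat) (x : R) : R :=
  1 - (1 - expR (- (n.+1%:R * x))) ^+ (Num.truncn (n.+1%:R * expR (n.+1%:R * a))).

Lemma expr_ge1Bn (R : realFieldType) (y : R) (m : nat) :
  0 <= y <= 1 -> 1 - m%:R * y <= (1 - y) ^+ m.
Proof.
move=> /andP[y0 y1]; elim: m => [|m IH]; first by rewrite mul0r subr0 expr0.
rewrite exprS; apply: (@le_trans _ _ ((1 - y) * (1 - m%:R * y))); last first.
  by rewrite ler_wpM2l// subr_ge0.
rewrite -natr1 mulrDl mul1r; have : 0 <= m%:R * y * y by rewrite !mulr_ge0.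
by move: (m%:R * y) => z; nra.
Qed.

Lemma step_approx_itv (R : realType) (a : R) n (x : R) : 0 <= x ->
  0 <= step_approx a n x <= 1.
Proof.
move=> x0; have e : 0 <= 1 - expR (- (n.+1%:R * x)) <= 1.
  by rewrite subr_ge0 expR_le1 oppr_le0 mulr_ge0//= gerBl expR_ge0.
case/andP: e => e0 e1.
by rewrite /step_approx subr_ge0 exprn_ile1//= gerBl exprn_ge0.
Qed.

(** A dominating function independent of [n], integrable as soon as the Laplace
    transform is finite at one: the total mass need not be finite. *)
Lemma step_approx_dom (R : realType) (a : R) n (x : R) : 0 <= x ->
  step_approx a n x <= expR (a + 1) * expR (- x).
Proof.
move=> x0; have /andP[_ s1] := step_approx_itv a n x0.
rewrite -expRD; have [xa|xa] := leP x (a + 1).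
  by apply: (le_trans s1); rewrite -[leLHS]expR0 ler_expR subr_ge0.
rewrite /step_approx lerBlDl.
set y := expR _.
have y01 : 0 <= y <= 1.
  by rewrite expR_ge0/= expR_le1 oppr_le0 mulr_ge0.
set m := Num.truncn _.
apply: (@le_trans _ _ ((1 - y) ^+ m + m%:R * y)).
  by rewrite -lerBlDr; exact: expr_ge1Bn.
rewrite lerD2l.
have mle : m%:R <= n.+1%:R * expR (n.+1%:R * a).
  by rewrite /m truncn_le ?mulr_ge0 ?expR_ge0.
apply: (@le_trans _ _ (n.+1%:R * expR (n.+1%:R * a) * y)).
  by rewrite ler_wpM2r// expR_ge0.
rewrite /y -mulrA -expRD.
have -> : n.+1%:R * a + - (n.+1%:R * x) = - (x - a) + - (n%:R * (x - a)).
  by rewrite -natr1; ring.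
have -> : a + 1 - x = - (x - a) + 1 by ring.
rewrite !expRD mulrCA ler_wpM2l ?expR_ge0//.
apply: (@le_trans _ _ (n.+1%:R * expR (- n%:R))).
  rewrite ler_wpM2l// ler_expR lerN2 ler_peMr//; lra.
rewrite expRN ler_pdivrMr ?expR_gt0//.
rewrite -[leLHS]mul1r ler_pM//.
  by rewrite -[leLHS]expR0 ler_expR.
by rewrite -natr1 addrC expR_ge1Dx.
Qed.

Lemma cvg_step_approx (R : realType) (a x : R) : 0 <= x ->
  step_approx a n x @[n --> \oo] --> (\1_[set y | y <= a] x : R).
Proof.
move=> x0; rewrite indicE; have [xa|ax] := leP x a.
- rewrite mem_set//=.
  have B n : 1 - expR (- (n%:R)) <= step_approx a n x.
    rewrite /step_approx lerD2l lerN2.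
    set y := expR (- (_ * x)); set m := Num.truncn _.
    have y1 : y <= 1 by rewrite expR_le1 oppr_le0 mulr_ge0.
    apply: (@le_trans _ _ (expR (- y) ^+ m)).
      by rewrite lerXn2r ?nnegrE ?subr_ge0 ?expR_ge0// expR_ge1Dx.
    rewrite -expRM_natl ler_expR mulrN lerN2.
    have h : n.+1%:R * expR (n.+1%:R * a) <= m%:R + 1.
      by rewrite natr1 ltW// truncnS_gt.
    apply: (@le_trans _ _ ((n.+1%:R * expR (n.+1%:R * a) - 1) * y)); last first.
      by rewrite ler_wpM2r ?expR_ge0// lerBlDr.
    rewrite mulrBl mul1r -mulrA -expRD.
    have e1 : 1 <= expR (n.+1%:R * a + - (n.+1%:R * x)).
      by rewrite -[leLHS]expR0 ler_expR -mulrBr mulr_ge0// subr_ge0.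
    have : n.+1%:R <= n.+1%:R * expR (n.+1%:R * a + - (n.+1%:R * x)) by rewrite ler_peMr.
    by rewrite -[X in X <= _]natr1; lra.
  apply: (@squeeze_cvgr _ _ _ _ (fun n => 1 - expR (- n%:R)) (cst 1)).
  + by apply: nearW => n; rewrite B; have /andP[] := step_approx_itv a n x0.
  + rewrite -[X in _ --> X]subr0; apply: cvgB; first exact: cvg_cst.
    exact: cvgn_expR.
  + exact: cvg_cst.
- rewrite memNset/=; last by rewrite /= leNgt ax.
  pose e := x - a; have e0 : 0 < e by rewrite subr_gt0.
  have B n : step_approx a n x <= 2 / e ^+ 2 * n.+1%:R^-1.
    rewrite /step_approx lerBlDl.
    set y := expR (- (_ * x)); set m := Num.truncn _.
    have y01 : 0 <= y <= 1.
      by rewrite expR_ge0/= expR_le1 oppr_le0 mulr_ge0.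
    apply: (@le_trans _ _ ((1 - y) ^+ m + m%:R * y)).
      by rewrite -lerBlDr; exact: expr_ge1Bn.
    rewrite lerD2l.
    have mle : m%:R <= n.+1%:R * expR (n.+1%:R * a).
      by rewrite /m truncn_le ?mulr_ge0 ?expR_ge0.
    apply: (@le_trans _ _ (n.+1%:R * expR (n.+1%:R * a) * y)).
      by rewrite ler_wpM2r// expR_ge0.
    rewrite /y -mulrA -expRD.
    have -> : n.+1%:R * a + - (n.+1%:R * x) = - (n.+1%:R * e) by rewrite /e; ring.
    rewrite expRN ler_pdivrMr ?expR_gt0//.
    have ne0 : 0 <= n.+1%:R * e by rewrite mulr_ge0// ltW.
    have E : 1 + (n.+1%:R * e) ^+ 2 / 2 <= expR (n.+1%:R * e) by exact: (expR_ge1Dxn 1 ne0).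
    have E' : (n.+1%:R * e) ^+ 2 / 2 <= expR (n.+1%:R * e) by apply: le_trans E; rewrite lerDr.
    apply: (@le_trans _ _ (2 / e ^+ 2 / n.+1%:R * ((n.+1%:R * e) ^+ 2 / 2))).
      have : 0 < n.+1%:R :> R by [].
      move: (n.+1%:R) => N N0; rewrite le_eqVlt; apply/orP; left; apply/eqP.
      by field; rewrite !gt_eqF.
    by rewrite ler_wpM2l// !mulr_ge0// ?invr_ge0 ?exprn_ge0// ltW.
  apply: (@squeeze_cvgr _ _ _ _ (cst 0) (fun n => 2 / e ^+ 2 * n.+1%:R^-1)).
  + by apply: nearW => n; rewrite B/=; have /andP[->] := step_approx_itv a n x0.
  + exact: cvg_cst.
  + rewrite -[X in _ --> X](mulr0 (2 / e ^+ 2)); apply: cvgM; first exact: cvg_cst.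
    exact: (@cvg_harmonic R).
Qed.

Lemma step_approx_expand (R : realType) (a x : R) (n : nat) :
  step_approx a n x = \sum_(i < Num.truncn (n.+1%:R * expR (n.+1%:R * a)))
    ((-1) ^+ i * 'C(Num.truncn (n.+1%:R * expR (n.+1%:R * a)), i.+1)%:R) *
    expR (- ((n.+1 * i.+1)%:R * x)).
Proof.
rewrite /step_approx; set m := Num.truncn _.
rewrite exprBn big_ord_recl /= bin0 expr1n !expr0 !mulr1 mulr1n.
rewrite opprD addrA subrr sub0r -sumrN.
apply: eq_bigr => i _; rewrite expr1n mulr1 -mulNrn -mulNr /bump /= add1n.
rewrite exprS mulN1r opprK -expRM_natl -[LHS]mulr_natr mulrAC natrM.
by congr (_ * expR _); ring.
Qed.

(** The functions [step_approx a n] are combinations of exponentials [e^(-m x)]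
    with [m] a positive integer, so their integrals agree on both sides, and they
    converge to the indicator. The two weighted variables live on different
    measure spaces in order to compare an expectation with a Lebesgue integral. *)
Lemma ge0_laplace_unique (R : realType) d1 d2 (T1 : measurableType d1)
    (T2 : measurableType d2) (m1 : {measure set T1 -> \bar R})
    (m2 : {measure set T2 -> \bar R}) (D1 : set T1) (D2 : set T2)
    (W1 X1 : T1 -> R) (W2 X2 : T2 -> R) :
  measurable D1 -> measurable D2 ->
  measurable_fun D1 W1 -> measurable_fun D1 X1 ->
  measurable_fun D2 W2 -> measurable_fun D2 X2 ->
  (forall x, D1 x -> 0 <= W1 x /\ 0 <= X1 x) ->
  (forall x, D2 x -> 0 <= W2 x /\ 0 <= X2 x) ->
  (forall n, (\int[m1]_(x in D1) (W1 x * expR (- (n.+1%:R * X1 x)))%:E < +oo)%E) ->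
  (forall n, \int[m1]_(x in D1) (W1 x * expR (- (n.+1%:R * X1 x)))%:E =
             \int[m2]_(x in D2) (W2 x * expR (- (n.+1%:R * X2 x)))%:E)%E ->
  forall a, (\int[m1]_(x in D1) (W1 x * \1_[set y | y <= a] (X1 x))%:E =
             \int[m2]_(x in D2) (W2 x * \1_[set y | y <= a] (X2 x))%:E)%E.
Proof.
move=> mD1 mD2 mW1 mX1 mW2 mX2 p1 p2 fin1 eq12 a.
have fin2 n : (\int[m2]_(x in D2) (W2 x * expR (- (n.+1%:R * X2 x)))%:E < +oo)%E.
  by rewrite -eq12.
have gen d (T : measurableType d) (m : {measure set T -> \bar R}) (D : set T)
    (W X : T -> R) : measurable D -> measurable_fun D W -> measurable_fun D X ->
    (forall x, D x -> 0 <= W x /\ 0 <= X x) ->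
    (forall n, (\int[m]_(x in D) (W x * expR (- (n.+1%:R * X x)))%:E < +oo)%E) ->
  (\int[m]_(x in D) (W x * step_approx a n (X x))%:E)%E @[n --> \oo] -->
     (\int[m]_(x in D) (W x * \1_[set y | y <= a] (X x))%:E)%E /\
  forall n, (\int[m]_(x in D) (W x * step_approx a n (X x))%:E =
    \sum_(i < Num.truncn (n.+1%:R * expR (n.+1%:R * a)))
    ((-1) ^+ i * 'C(Num.truncn (n.+1%:R * expR (n.+1%:R * a)), i.+1)%:R)%:E *
    \int[m]_(x in D) (W x * expR (- ((n.+1 * i.+1).-1.+1%:R * X x)))%:E)%E.
  move=> mD mW mX p fin.
  have me (c : R) : measurable_fun D (fun x => W x * expR (- (c * X x))).
    apply: measurable_funM => //; apply: measurableT_comp => //.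
    by apply: measurableT_comp => //; exact: measurable_funM.
  have int n : m.-integrable D (EFin \o (fun x => W x * expR (- (n.+1%:R * X x)))).
    apply/integrableP; split; first exact/measurable_EFinP.
    rewrite (eq_integral (fun x => (W x * expR (- (n.+1%:R * X x)))%:E))//.
    move=> x /set_mem /p[w0 _]; rewrite gee0_abs// lee_fin mulr_ge0// expR_ge0.
  split.
    have intW : m.-integrable D (fun x => (expR (a + 1))%:E * (W x * expR (- (1%:R * X x)))%:E)%E.
      exact: integrableZl (int 0%N).
    have mS n : measurable_fun setT (step_approx a n).
      apply: measurable_funB => //; apply: measurable_funX.
      apply: measurable_funB => //; apply: measurableT_comp => //.
      by apply: measurableT_comp => //; exact: measurable_funM.
    have mI : measurable_fun setT (\1_[set y : R | y <= a] : R -> R).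
      by apply: measurable_indic; rewrite -[X in measurable X](set_itvNyc a).
    apply: (dominated_cvg mD (f_ := fun n x => (W x * step_approx a n (X x))%:E) _ _ _ intW).
    - by move=> n; apply/measurable_EFinP/measurable_funM => //; exact: measurableT_comp.
    - move=> x Dx; apply: cvg_EFin; first exact: nearW.
      by apply: cvgMr; apply: cvg_step_approx; case: (p x Dx).
    - by move=> x Dx; rewrite -EFinM.
    - move=> n x Dx; have [w0 x0] := p x Dx.
      rewrite gee0_abs ?lee_fin ?mulr_ge0//; last first.
        by have /andP[] := step_approx_itv a n x0.
      by rewrite mul1r mulrCA ler_wpM2l// step_approx_dom.
  move=> n.
  rewrite (eq_integral (fun x => \sum_(i < Num.truncn (n.+1%:R * expR (n.+1%:R * a)))
    ((-1) ^+ i * 'C(Num.truncn (n.+1%:R * expR (n.+1%:R * a)), i.+1)%:R)%:E *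
     (W x * expR (- ((n.+1 * i.+1).-1.+1%:R * X x)))%:E)%E); last first.
    move=> x _; rewrite step_approx_expand mulr_sumr -sumEFin; apply: eq_bigr => i _.
    by rewrite -EFinM mulrCA.
  rewrite integral_sum//.
    by apply: eq_bigr => i _; rewrite integralZl//; exact: int.
  by move=> i; apply: integrableZl => //; exact: int.
have [c1 e1] := gen _ _ m1 D1 W1 X1 mD1 mW1 mX1 p1 fin1.
have [c2 e2] := gen _ _ m2 D2 W2 X2 mD2 mW2 mX2 p2 fin2.
apply: (cvg_unique _ c1).
  exact: ereal_hausdorff.
move: c2; apply: cvg_trans; apply: near_eq_cvg; apply: nearW => n.
rewrite e1 e2; apply: eq_bigr => i _; by rewrite eq12.
Qed.

(** * Gamma integrals and truncated powers *)

Lemma tonelli_on (R : realType) d1 d2 (T1 : measurableType d1) (T2 : measurableType d2)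
   (m1 : {sigma_finite_measure set T1 -> \bar R})
   (m2 : {sigma_finite_measure set T2 -> \bar R}) (A : set T1) (B : set T2)
   (f : T1 -> T2 -> \bar R) :
  measurable A -> measurable B ->
  measurable_fun (A `*` B) (fun z => f z.1 z.2) ->
  (forall x y, A x -> B y -> (0 <= f x y)%E) ->
  (\int[m1]_(x in A) \int[m2]_(y in B) f x y =
   \int[m2]_(y in B) \int[m1]_(x in A) f x y)%E.
Proof.
move=> mA mB mf f0.
pose F : T1 * T2 -> \bar R := (fun z => f z.1 z.2) \_ (A `*` B).
have mF : measurable_fun setT F.
  by apply/(measurable_restrictT _ _).1 => //; exact: measurableX.
have F0 z : (0 <= F z)%E by apply: erestrict_ge0 => -[x y] [/= Ax By]; exact: f0.
have := @fubini_tonelli _ _ _ _ _ m1 m2 F mF F0.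
rewrite /fubini_F /fubini_G.
have FE x y : F (x, y) = (((f x) \_ B) y * (\1_A x)%:E)%E.
  rewrite /F !patchE in_setX/= indicE; case: (x \in A) => /=; last by rewrite mule0.
  by rewrite mule1.
have -> : (\int[m1]_x \int[m2]_y F (x, y) = \int[m1]_(x in A) \int[m2]_(y in B) f x y)%E.
  rewrite [RHS]integral_mkcond; apply: eq_integral => x _.
  rewrite patchE; case: ifPn => xA.
    by rewrite [RHS]integral_mkcond; apply: eq_integral => y _; rewrite FE indicE xA mule1.
  by apply: integral0_eq => y _; rewrite FE indicE (negbTE xA) mule0.
move=> ->.
rewrite [RHS]integral_mkcond; apply: eq_integral => y _.
rewrite patchE; case: ifPn => yB.
  rewrite [RHS]integral_mkcond; apply: eq_integral => x _.
  by rewrite /F !patchE in_setX/= yB andbT.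
by apply: integral0_eq => x _; rewrite FE patchE (negbTE yB) mul0e.
Qed.

(** The truncated power [z_+^g]: once it is extended by zero, convolutions with it
    can be taken over the whole line. *)
Definition ppow (R : realType) (g z : R) : R := z `^ g * (0 < z)%R%:R.

Lemma ppow_ge0 (R : realType) (g z : R) : 0 <= ppow g z.
Proof. by rewrite mulr_ge0 ?powR_ge0. Qed.

Lemma ppow_gt (R : realType) (g z : R) : 0 < z -> ppow g z = z `^ g.
Proof. by rewrite /ppow => ->; rewrite mulr1. Qed.

Lemma ppow_le (R : realType) (g z : R) : z <= 0 -> ppow g z = 0.
Proof. by rewrite /ppow leNgt => /negbTE ->; rewrite mulr0. Qed.

Lemma measurable_ppow (R : realType) (g : R) : measurable_fun setT (ppow g).
Proof.
apply: measurable_funM; first exact: measurable_powR.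
have -> : (fun z : R => (0 < z)%R%:R) = \1_`]0, +oo[%classic :> (R -> R); last first.
  exact: measurable_indic.
apply/funext => z; rewrite indicE; case: ltP => z0.
  by rewrite mem_set//= in_itv/= z0.
by rewrite memNset//= in_itv/= ltNge z0.
Qed.

Lemma derivable_cvg (R : realType) (f : R -> R) (x : R) :
  derivable f x 1 -> f y @[y --> x] --> f x.
Proof. by move/derivable1_diffP => /differentiable_continuous. Qed.

Lemma integral_ppow01 (R : realType) (a : R) : 0 < a ->
  (\int[@lebesgue_measure R]_(x in `]0%R, 1%R]) (x `^ (a - 1))%:E <= (a^-1)%:E)%E.
Proof.
move=> a0.
pose F (n : nat) : set R := `[n.+2%:R^-1, 1%R]%classic.
have FU : `]0%R, 1%R]%classic = \bigcup_n F n.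
  apply/seteqP; split => x /=.
    rewrite in_itv/= => /andP[x0 x1].
    have [n] := ltr_add_invr x0; rewrite add0r => nx.
    exists n => //=; rewrite /F/= in_itv/= x1 andbT.
    apply: ltW; apply: le_lt_trans nx.
    by rewrite lef_pV2 ?posrE// ler_nat.
  move=> [n _]; rewrite /F/= !in_itv/= => /andP[nx ->].
  by rewrite andbT; apply: lt_le_trans nx.
rewrite FU.
have mpow D : measurable_fun D (fun x : R => (x `^ (a - 1))%:E).
  by apply: measurable_funTS; apply/measurable_EFinP; exact: measurable_powR.
have ndF : nondecreasing_seq F.
  move=> m n mn; rewrite subsetEset => x /=; rewrite /F/= !in_itv/= => /andP[mx ->].
  rewrite andbT; apply: le_trans mx.
  by rewrite lef_pV2 ?posrE// ler_nat.
have c : (\int[@lebesgue_measure R]_(x in F n) (x `^ (a - 1))%:E)%E @[n --> \oo] -->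
    (\int[@lebesgue_measure R]_(x in \bigcup_n F n) (x `^ (a - 1))%:E)%E.
  apply: ge0_nondecreasing_set_cvg_integral.
  - exact: ndF.
  - by move=> n; exact: measurable_itv.
  - by move=> n; exact: mpow.
  - by move=> n x _; rewrite lee_fin powR_ge0.
move/cvg_lim : (c) => <- //.
apply: lime_le; first by apply: (cvgP _ c).
apply: nearW => n; rewrite /F.
have n1 : n.+2%:R^-1 < 1 :> R by rewrite invf_lt1// ltr1n.
have n0 : 0 < n.+2%:R^-1 :> R by rewrite invr_gt0.
rewrite (@continuous_FTC2 _ _ (fun x => a^-1 * x `^ a))//.
- rewrite -EFinB lee_fin powR1 mulr1 gerBl mulr_ge0 ?powR_ge0// invr_ge0 ltW//.
- apply: derivable_within_continuous => x; rewrite in_itv/= => /andP[x0 _].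
  by apply: derivable_powR; rewrite in_itv/= andbT; apply: lt_le_trans x0.
- have dd (x : R) : 0 < x -> derivable (fun x => a^-1 * x `^ a) x 1.
    by move=> x0; apply: derivableM => //; apply: derivable_powR; rewrite in_itv/= andbT.
  split.
  + by move=> x; rewrite in_itv/= => /andP[x0 _]; apply: dd; apply: lt_trans x0.
  + apply: cvg_at_right_filter; apply: derivable_cvg; exact: dd.
  + apply: cvg_at_left_filter; apply: derivable_cvg; exact: dd.
- move=> x; rewrite in_itv/= => /andP[x0 _].
  have {}x0 : 0 < x by apply: lt_trans x0.
  rewrite derive1E deriveM//; last by apply: derivable_powR; rewrite in_itv/= andbT.
  rewrite derive_cst scaler0 addr0 -derive1E powR_derive1 ?in_itv/= ?andbT//.
  by rewrite /GRing.scale/= mulKf// gt_eqF.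
Qed.

(** From [e^(z/m) >= 1 + z/m]. *)
Lemma expR_lower_pow (R : realType) (z : R) (m : nat) : 0 <= z ->
  (z / m.+1%:R) ^+ m.+1 <= expR z.
Proof.
move=> z0; rewrite [X in _ <= expR X](_ : z = m.+1%:R * (z / m.+1%:R)); last first.
  by rewrite mulrC divfK.
rewrite expRM_natl lerXn2r ?nnegrE ?divr_ge0 ?expR_ge0//.
by apply: le_trans (expR_ge1Dx _); rewrite lerDr.
Qed.

Lemma measurable_expRN (R : realType) (D : set R) (c : R) :
  measurable_fun D (fun x : R => expR (- (c * x))).
Proof.
apply: measurable_funTS; apply: measurableT_comp => //.
by apply: measurableT_comp => //; exact: measurable_funM.
Qed.

Lemma integral_expRN (R : realType) (s : R) : 0 < s ->
  (\int[@lebesgue_measure R]_(x in `[0%R, +oo[) (expR (- (s * x)))%:E = (s^-1)%:E)%E.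
Proof.
move=> s0; have := integral_exponential_pdf s0.
rewrite (_ : (fun x => (exponential_pdf s x)%:E) =
  (fun x => s%:E * (((fun x => (expR (- (s * x)))%:E) \_ `[0%R, +oo[) x))%E); last first.
  apply/funext => x; rewrite /exponential_pdf !patchE; case: ifPn => _.
    by rewrite EFinM mulNr.
  by rewrite mule0.
have me : measurable_fun [set: R] (fun x : R => (expR (- (s * x)))%:E).
  apply/measurable_EFinP; apply: measurableT_comp => //.
  by apply: measurableT_comp => //; exact: measurable_funM.
rewrite ge0_integralZl//; last 3 first.
- by apply/(measurable_restrictT _ _).1 => //; exact: measurable_funTS.
- by move=> x _; apply: erestrict_ge0 => y _; rewrite lee_fin expR_ge0.
- by rewrite lee_fin ltW.
rewrite -integral_mkcond => h.
have := congr1 (fun z => (s^-1)%:E * z)%E h.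
by rewrite muleA -EFinM mulVf ?gt_eqF// mul1e mule1.
Qed.

(** The integrand is at most [x^(a-1)] near zero and a multiple of [e^(-x/2)]
    elsewhere. *)
Lemma Gamma_lty (R : realType) (a : R) : 0 < a ->
  (\int[@lebesgue_measure R]_(x in `]0%R, +oo[) (x `^ (a - 1) * expR (- x))%:E < +oo)%E.
Proof.
move=> a0.
have mf D : measurable_fun D (fun x : R => (x `^ (a - 1) * expR (- x))%:E).
  apply: measurable_funTS; apply/measurable_EFinP/measurable_funM.
    exact: measurable_powR.
  by apply: measurableT_comp.
have -> : `]0%R, +oo[%classic = `]0%R, 1%R] `|` `]1%R, +oo[ :> set R.
  by rewrite -itv_bndbnd_setU//= bnd_simp.
rewrite ge0_integral_setU//=; last 3 first.
- exact: mf.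
- by move=> x _; rewrite lee_fin mulr_ge0 ?powR_ge0 ?expR_ge0.
- by apply/disj_setPLR => x /=; rewrite !in_itv/= => /andP[_ x1]; rewrite andbT; apply/negP; rewrite -leNgt.
apply: lte_add_pinfty.
  apply: (@le_lt_trans _ _ (a^-1)%:E); last exact: ltry.
  apply: le_trans (integral_ppow01 a0).
  apply: ge0_le_integral => //.
  - by move=> x _; rewrite lee_fin mulr_ge0 ?powR_ge0 ?expR_ge0.
  - exact: mf.
  - by apply: measurable_funTS; apply/measurable_EFinP; exact: measurable_powR.
  - move=> x /=; rewrite in_itv/= => /andP[x0 _].
    by rewrite lee_fin ler_piMr ?powR_ge0// expR_le1 oppr_le0 ltW.
pose m := Num.truncn a.
pose C : R := (2 * m.+1%:R) ^+ m.+1.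
have C0 : 0 <= C by rewrite exprn_ge0.
apply: (@le_lt_trans _ _ (\int[@lebesgue_measure R]_(x in `]1%R, +oo[) (C%:E * (expR (- (2^-1 * x)))%:E))%E).
  have me D : measurable_fun D (fun x : R => C%:E * (expR (- (2^-1 * x)))%:E)%E.
    apply: measurable_funTS; apply: measurable_funeM; apply/measurable_EFinP; apply: measurableT_comp => //.
    by apply: measurableT_comp => //; exact: measurable_funM.
  apply: ge0_le_integral => //.
  - by move=> x _; rewrite lee_fin mulr_ge0 ?powR_ge0 ?expR_ge0.
  - exact: mf.
  - exact: me.
  - move=> x /=; rewrite in_itv/= andbT => x1.
    have x0 : 0 <= x by rewrite ltW// (lt_trans _ x1).
    rewrite -EFinM lee_fin.
    have -> : - x = - (2^-1 * x) + - (2^-1 * x) by field.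
    rewrite expRD mulrA ler_wpM2r ?expR_ge0//.
    rewrite expRN ler_pdivrMr ?expR_gt0//.
    apply: (@le_trans _ _ (x ^+ m.+1)).
      rewrite -powR_mulrn//; apply: ler_powR; first exact: ltW.
      rewrite lerBlDr; apply: ltW; apply: lt_trans (truncnS_gt a) _.
      by rewrite ltrDl.
    have x20 : 0 <= 2^-1 * x by rewrite mulr_ge0.
    apply: le_trans (ler_wpM2l C0 (expR_lower_pow m x20)).
    rewrite /C -exprMn le_eqVlt; apply/orP; left; apply/eqP; congr (_ ^+ _).
    have : 0 < m.+1%:R :> R by []. move: (m.+1%:R) => N N0.
    by field; rewrite gt_eqF.
have me D : measurable_fun D (fun x : R => (expR (- (2^-1 * x)))%:E)%E.
  apply: measurable_funTS; apply/measurable_EFinP; apply: measurableT_comp => //.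
  by apply: measurableT_comp => //; exact: measurable_funM.
apply: (@le_lt_trans _ _ (\int[@lebesgue_measure R]_(x in `[0%R, +oo[) (C%:E * (expR (- (2^-1 * x)))%:E))%E).
  apply: ge0_subset_integral => //.
  - by apply: measurable_funeM; exact: me.
  - by move=> x _; rewrite -EFinM lee_fin mulr_ge0 ?expR_ge0.
  - by move=> x /=; rewrite !in_itv/= !andbT => /ltW; apply: le_trans.
rewrite ge0_integralZl//.
- by rewrite integral_expRN// -EFinM ltry.
exact: me.
Qed.

Lemma EFin_Gamma (R : realType) (a : R) : 0 < a ->
  (\int[@lebesgue_measure R]_(x in `]0%R, +oo[) (x `^ (a - 1) * expR (- x))%:E = (Gamma a)%:E)%E.
Proof.
move=> a0; rewrite /Gamma /Rintegral fineK// ge0_fin_numE; first exact: Gamma_lty.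
by apply: integral_ge0 => x _; rewrite lee_fin mulr_ge0 ?powR_ge0 ?expR_ge0.
Qed.

Lemma Gamma_gt0 (R : realType) (a : R) : 0 < a -> 0 < Gamma a.
Proof.
move=> a0; rewrite -lte_fin -EFin_Gamma//.
have mf D : measurable_fun D (fun x : R => (x `^ (a - 1) * expR (- x))%:E).
  apply: measurable_funTS; apply/measurable_EFinP/measurable_funM.
    exact: measurable_powR.
  by apply: measurableT_comp.
pose c : R := Num.min 1 (2 `^ (a - 1)) * expR (- 2).
have c0 : 0 < c by rewrite mulr_gt0 ?expR_gt0// lt_min ltr01 powR_gt0.
apply: (@lt_le_trans _ _ (\int[@lebesgue_measure R]_(x in `[1%R, 2%R]) (cst c%:E x))%E).
  rewrite integral_cst//= lebesgue_measure_itv/= lte_fin ltr1n/= -EFinB -EFinM lte_fin.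
  by rewrite mulr_gt0// subr_gt0 ltr1n.
apply: (@le_trans _ _ (\int[@lebesgue_measure R]_(x in `[1%R, 2%R]) (x `^ (a - 1) * expR (- x))%:E)%E).
  apply: ge0_le_integral => //.
  - by move=> x _; rewrite lee_fin ltW.
  - exact: mf.
  - move=> x /=; rewrite in_itv/= => /andP[x1 x2]; rewrite lee_fin ler_pM//.
    + have [a1|a1] := leP 1 a.
        rewrite ge_min; apply/orP; left; rewrite -[leLHS](powRr0 x).
        by apply: ler_powR => //; rewrite subr_ge0.
      rewrite ge_min; apply/orP; right.
      rewrite -(opprB 1 a) !powRN lef_pV2 ?posrE ?powR_gt0//; last by rewrite (lt_le_trans _ x1).
      have x0 : 0 <= x by apply: le_trans x1.
      by apply: ge0_ler_powR; rewrite ?nnegrE ?subr_ge0// ltW.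
    + by rewrite ler_expR lerN2.
apply: ge0_subset_integral => //.
- exact: mf.
- by move=> x _; rewrite lee_fin mulr_ge0 ?powR_ge0 ?expR_ge0.
- by move=> x /=; rewrite !in_itv/= => /andP[x1 _]; rewrite andbT (lt_le_trans _ x1).
Qed.

Lemma integral_ppow_expR (R : realType) (a s y : R) : 0 < a -> 0 < s ->
  (\int[@lebesgue_measure R]_r (ppow (a - 1) (r - y) * expR (- (s * r)))%:E =
   (expR (- (s * y)) * (Gamma a * s `^ (- a)))%:E)%E.
Proof.
move=> a0 s0.
have s1 : 0 < s^-1 by rewrite invr_gt0.
have mf : measurable_fun [set: R] (fun r => (ppow (a - 1) (r - y) * expR (- (s * r)))%:E).
  apply/measurable_EFinP/measurable_funM.
    by apply: measurableT_comp; [exact: measurable_ppow|exact: measurable_funB].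
  apply: measurableT_comp => //.
  by apply: measurableT_comp => //; exact: measurable_funM.
rewrite (@ge0_integral_affine R s^-1 y)//; last 2 first.
- by rewrite gt_eqF.
- by move=> x; rewrite lee_fin mulr_ge0 ?ppow_ge0 ?expR_ge0.
rewrite (gtr0_norm s1).
rewrite (_ : (fun x => _%:E) = (fun x => (expR (- (s * y)) * s `^ (1 - a))%:E *
    ((fun x => (x `^ (a - 1) * expR (- x))%:E) \_ `]0%R, +oo[) x)%E); last first.
  apply/funext => x; rewrite patchE; case: ifPn => x0.
    have {}x0 : 0 < x by move: x0; rewrite inE/= in_itv/= andbT.
    rewrite addrK ppow_gt ?mulr_gt0// powRM ?ltW// -EFinM; congr EFin.
    have -> : s^-1 `^ (a - 1) = s `^ (1 - a).
      by rewrite -[in LHS](powR_inv1 (ltW s0)) -powRrM mulN1r opprB.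
    rewrite mulrDr mulVKf ?gt_eqF// opprD expRD; ring.
  rewrite mule0 addrK ppow_le ?mul0r//.
  rewrite pmulr_rle0// leNgt; apply: contra x0 => x0.
  by rewrite inE/= in_itv/= x0.
have mg : measurable_fun [set: R] (fun x : R => (x `^ (a - 1) * expR (- x))%:E).
  apply/measurable_EFinP/measurable_funM.
    exact: measurable_powR.
  by apply: measurableT_comp.
rewrite ge0_integralZl//; last 3 first.
- by apply/(measurable_restrictT _ _).1 => //; exact: measurable_funTS.
- by move=> x _; apply: erestrict_ge0 => z _; rewrite lee_fin mulr_ge0 ?powR_ge0 ?expR_ge0.
- by rewrite lee_fin mulr_ge0 ?powR_ge0 ?expR_ge0.
rewrite -integral_mkcond EFin_Gamma// -!EFinM; congr EFin.
have -> : s `^ (1 - a) = s * s `^ (- a).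
  by rewrite powRD ?powRr1 ?(ltW s0) ?(gt_eqF s0) ?implybT.
by field; rewrite gt_eqF.
Qed.

(** * Exponentially weighted moments of a positive stable variable *)

Lemma pow_expRN_bound (R : realType) (s x : R) (m : nat) : 0 < s -> 0 <= x ->
  x ^+ m * expR (- (s * x)) <= (m.+1%:R / s) ^+ m.+1 + 1.
Proof.
move=> s0 x0.
have C0 : 0 <= (m.+1%:R / s) ^+ m.+1 by rewrite exprn_ge0// divr_ge0// ltW.
have [x1|x1] := leP x 1.
  rewrite -[leLHS]add0r lerD// -[leRHS]mulr1 ler_pM ?exprn_ge0 ?expR_ge0//.
    exact: exprn_ile1.
  by rewrite expR_le1 oppr_le0 mulr_ge0// ltW.
rewrite -[leLHS]addr0 lerD//.
apply: (@le_trans _ _ (x ^+ m.+1 * expR (- (s * x)))).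
  by rewrite ler_wpM2r ?expR_ge0// exprS ler_peMl ?exprn_ge0// ltW.
rewrite expRN ler_pdivrMr ?expR_gt0//.
have sx0 : 0 <= s * x by rewrite mulr_ge0// ltW.
apply: le_trans (ler_wpM2l C0 (expR_lower_pow m sx0)).
rewrite -exprMn le_eqVlt; apply/orP; left; apply/eqP; congr (_ ^+ _).
have : 0 < m.+1%:R :> R by []. move: (m.+1%:R) => N N0.
by field; rewrite !gt_eqF.
Qed.

Lemma integrable_pow_expRN (R : realType) d (T : measurableType d) (P : probability T R)
  (X : T -> R) (m : nat) (s : R) : measurable_fun setT X -> (forall w, 0 <= X w) -> 0 < s ->
  P.-integrable setT (EFin \o (fun w => X w ^+ m * expR (- (s * X w)))).
Proof.
move=> mX X0 s0; apply: measurable_bounded_integrable => //.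
- by rewrite (le_lt_trans (probability_le1 P measurableT))// ltry.
- apply: measurable_funM; first exact: measurable_funX.
  apply: measurableT_comp => //.
  by apply: measurableT_comp => //; exact: measurable_funM.
- exists ((m.+1%:R / s) ^+ m.+1 + 1); split; first exact: num_real.
  move=> C hC w _; rewrite /= ger0_norm ?mulr_ge0 ?exprn_ge0 ?expR_ge0//.
  by apply: le_trans (ltW hC); exact: pow_expRN_bound.
Qed.

(** Differentiation under the expectation: near [s] the derivative is dominated by
    its value at [s / 2]. *)
Lemma is_derive_laplace_moment (R : realType) d (T : measurableType d) (P : probability T R)
  (X : T -> R) (m : nat) (s : R) : measurable_fun setT X -> (forall w, 0 <= X w) -> 0 < s ->
  is_derive s 1 (fun s => \int[P]_w (X w ^+ m * expR (- (s * X w))))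
    (- \int[P]_w (X w ^+ m.+1 * expR (- (s * X w)))).
Proof.
move=> mX X0 s0.
pose f (s : R) (w : T) := X w ^+ m * expR (- (s * X w)).
have df (t : R) w : is_derive t 1 (f ^~ w) (- (X w ^+ m.+1 * expR (- (t * X w)))).
  apply: is_derive_eq; rewrite /GRing.scale/= exprS; ring.
have s20 : 0 < s / 2 by rewrite divr_gt0.
have Is : (`]s / 2, s * 2[%classic : set R) s.
  by rewrite /= in_itv/=; apply/andP; split; lra.
have I0 x : (`]s / 2, s * 2[%classic : set R) x -> 0 < x.
  by rewrite /= in_itv/= => /andP[+ _]; apply: lt_trans.
have intf x : (`]s / 2, s * 2[%classic : set R) x -> P.-integrable setT (EFin \o f x).
  by move=> /I0 x0; exact: integrable_pow_expRN.
have derf1 x w : (`]s / 2, s * 2[%classic : set R) x -> setT w -> derivable (f ^~ w) x 1.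
  by move=> _ _; exact: ex_derive.
pose G w := X w ^+ m.+1 * expR (- (s / 2 * X w)).
have G0 w : 0 <= G w by rewrite mulr_ge0 ?exprn_ge0 ?expR_ge0.
have intG : P.-integrable setT (EFin \o G) by exact: integrable_pow_expRN.
have Gub x w : (`]s / 2, s * 2[%classic : set R) x -> setT w -> `|partial1of2 f x w| <= G w.
  move=> Ix _; rewrite partial1of2E derive_val normrN ger0_norm ?mulr_ge0 ?exprn_ge0 ?expR_ge0//.
  rewrite ler_wpM2l ?exprn_ge0// ler_expR lerN2 ler_wpM2r//.
  by move: Ix; rewrite /= in_itv/= => /andP[/ltW].
have D := derivable_under_integral measurableT Is intf derf1 G0 intG Gub.
have E := differentiation_under_integral measurableT Is intf derf1 G0 intG Gub.
apply: DeriveDef; first exact: D.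
rewrite -derive1E E.
rewrite (_ : (fun w => partial1of2 f ^~ w s) = (fun w => -1 * (X w ^+ m.+1 * expR (- (s * X w))))).
  rewrite RintegralZl ?mulN1r//; exact: integrable_pow_expRN.
by apply/funext => w; rewrite partial1of2E derive_val mulN1r.
Qed.

Lemma is_derive_powR_expRN (R : realType) (a b s : R) : 0 < s ->
  is_derive s 1 (fun s => s `^ (- a) * expR (- s `^ b))
   (- ((a * s `^ (- (a + 1)) + b * s `^ (- (a + 1 - b))) * expR (- s `^ b))).
Proof.
move=> s0.
have d1 : is_derive s 1 (fun x => x `^ (- a)) (- a * s `^ (- a - 1)).
  exact: is_derive1_powR.
have d2 : is_derive s 1 (fun x => x `^ b) (b * s `^ (b - 1)).
  exact: is_derive1_powR.
have d3 : is_derive s 1 (fun s => expR (- s `^ b)) (- (b * s `^ (b - 1)) * expR (- s `^ b)).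
  have d4 : is_derive s 1 (fun s => - s `^ b) (- (b * s `^ (b - 1))) by exact: is_deriveN.
  have := @is_derive1_comp R expR (fun s => - s `^ b) s _ _ (is_derive_expR _) d4.
  by rewrite mulrC.
apply: (is_derive_eq (is_deriveM d1 d3)); rewrite /GRing.scale/=.
have -> : - (a + 1) = - a - 1 by ring.
have -> : s `^ (- (a + 1 - b)) = s `^ (- a) * s `^ (b - 1).
  rewrite -powRD ?(gt_eqF s0) ?implybT//; congr (_ `^ _); ring.
ring.
Qed.

(** Each differentiation of [s^(-a) e^(-s^b)] produces, up to sign, the two terms
    with exponents [a + 1] and [a + 1 - b] and nonnegative coefficients. The lower
    bound on the exponents makes them exceed one for large [n], hence the terms
    are transforms of continuous functions; the upper bound controls the growth of
    these functions at infinity. *)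
Lemma stable_moments (R : realType) d (T : measurableType d) (P : probability T R)
  (X : T -> R) (b : R) : measurable_fun setT X -> (forall w, 0 <= X w) ->
  0 < b -> b < 1 ->
  (forall s, 0 < s -> \int[P]_w (expR (- (s * X w))) = expR (- s `^ b)) ->
  (forall s, 0 < s -> \int[P]_w (X w ^+ 1 * expR (- (s * X w))) =
     b * s `^ (- (1 - b)) * expR (- s `^ b)) /\
  forall n, exists2 l : seq (R * R),
   all (fun ca => [&& 0 <= ca.1, n.+1%:R * (1 - b) <= ca.2 & ca.2 <= n.+1%:R - b]) l &
   forall s, 0 < s -> \int[P]_w (X w ^+ n.+1 * expR (- (s * X w))) =
     \sum_(ca <- l) (ca.1 * (s `^ (- ca.2) * expR (- s `^ b))).
Proof.
move=> mX X0 b0 b1 HX.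
have step m (F : R -> R) (s F' : R) : 0 < s ->
   (forall s, 0 < s -> \int[P]_w (X w ^+ m * expR (- (s * X w))) = F s) ->
   is_derive s 1 F (- F') ->
   \int[P]_w (X w ^+ m.+1 * expR (- (s * X w))) = F'.
  move=> s0 HF dF; apply: oppr_inj.
  have d1 := is_derive_laplace_moment P m mX X0 s0.
  rewrite -(@derive_val _ _ _ _ _ _ _ d1) -(@derive_val _ _ _ _ _ _ _ dF).
  apply: near_eq_derive => //.
  near=> t; apply: HF.
  near: t; exact: lt_nbhsr.
have S1 s : 0 < s -> \int[P]_w (X w ^+ 1 * expR (- (s * X w))) =
     b * s `^ (- (1 - b)) * expR (- s `^ b).
  move=> s0.
  apply: (step 0%N (fun s => s `^ (- 0) * expR (- s `^ b))) => //.
    move=> t t0; rewrite oppr0 powRr0 mul1r -HX//.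
    by congr Rintegral; apply/funext => w; rewrite expr0 mul1r.
  apply: is_derive_eq; first exact: is_derive_powR_expRN.
  by rewrite mul0r !add0r.
split => //; elim => [|n [l /allP Hl Hs]].
  exists [:: (b, 1 - b)].
    by rewrite /= mul1r !lexx (ltW b0).
  by move=> s s0; rewrite S1// big_seq1/= mulrA.
exists (flatten [seq [:: (ca.1 * ca.2, ca.2 + 1); (ca.1 * b, ca.2 + 1 - b)] | ca <- l]).
  apply/allP => ca /flatten_mapP[[c a] /Hl/= /and3P[c0 a1 a2]].
  have n0 : 0 <= n.+1%:R * (1 - b) by rewrite mulr_ge0// subr_ge0 ltW.
  have a0 : 0 <= a by apply: le_trans a1.
  rewrite -[n.+2%:R]natr1 mulrDl mul1r.
  rewrite !inE => /orP[] /eqP-> /=; rewrite mulr_ge0 ?(ltW b0)//=; apply/andP; split; lra.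
move=> s s0.
apply: (step n.+1 (fun s => \sum_(ca <- l) (ca.1 * (s `^ (- ca.2) * expR (- s `^ b))))) => //.
rewrite big_flatten/= big_map.
elim: (l) => [|[c a] l' IH].
  rewrite big_nil oppr0 [X in is_derive _ _ X _](_ : _ = cst 0).
    exact: is_derive_cst.
  by apply/funext => t; rewrite big_nil.
rewrite [X in is_derive _ _ X _](_ : _ =
  (fun t => c * (t `^ (- a) * expR (- t `^ b))) +
  (fun t => \sum_(ca <- l') (ca.1 * (t `^ (- ca.2) * expR (- t `^ b))))); last first.
  by apply/funext => t; rewrite big_cons.
have dc : is_derive s 1 (fun t => c * (t `^ (- a) * expR (- t `^ b)))
   (c * - ((a * s `^ (- (a + 1)) + b * s `^ (- (a + 1 - b))) * expR (- s `^ b))).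
  by apply: is_deriveZ; exact: is_derive_powR_expRN.
apply: (is_derive_eq (is_deriveD dc IH)).
rewrite /= !big_cons big_nil/= addr0.
ring.
Unshelve. all: by end_near.
Qed.

(** * The density of the positive stable law *)

Lemma ppow_continuous (R : realType) (g : R) : 0 < g -> continuous (ppow g).
Proof.
move=> g0 x; have [x0|x0|->] := ltgtP x 0.
- rewrite /continuous_at ppow_le ?(ltW x0)//.
  apply: cvg_near_cst; near=> y.
  by rewrite ppow_le//; apply: ltW; near: y; exact: lt_nbhsl.
- rewrite /continuous_at ppow_gt//.
  have c : powR y g @[y --> x] --> x `^ g.
    by apply: derivable_cvg; apply: derivable_powR; rewrite in_itv/= x0.
  apply: cvg_trans c; apply: near_eq_cvg; near=> y.
  by rewrite ppow_gt//; near: y; exact: lt_nbhsr.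
- rewrite /continuous_at ppow_le//; apply/cvgrPdist_le => e e0.
  have eg : 0 < e `^ g^-1 by exact: powR_gt0.
  near=> y; rewrite sub0r normrN ger0_norm ?ppow_ge0//.
  have [y0|y0] := leP y 0; first by rewrite ppow_le// ltW.
  rewrite ppow_gt//.
  have : y <= e `^ g^-1.
    apply: le_trans (ler_norm y) _.
    by near: y; exact: (@nbhs0_le R R^o _ eg).
  move=> ye; apply: (@le_trans _ _ ((e `^ g^-1) `^ g)).
    by apply: ge0_ler_powR; rewrite ?nnegrE ?powR_ge0 ?(ltW g0) ?(ltW y0).
  by rewrite -powRrM mulVf ?gt_eqF// powRr1// ltW.
Unshelve. all: by end_near. Qed.

Section stable_law.
Context (R : realType) d (T : measurableType d) (P : probability T R)
  (X : T -> R) (b : R).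
Context (mX : measurable_fun setT X) (X0 : forall w, 0 <= X w)
  (b0 : 0 < b) (b1 : b < 1)
  (HX : forall s, 0 < s -> \int[P]_w (expR (- (s * X w))) = expR (- s `^ b)).

Definition rvcdf (x : R) : R := \int[P]_w (\1_[set y | y <= x] (X w)).

(** Its Laplace transform in [r] is [Gamma a * s^(-a) * e^(-s^b)]. *)
Let U (a r : R) : R := \int[P]_w (ppow (a - 1) (r - X w)).

Let m_indle x : measurable_fun setT (\1_[set y : R | y <= x] : R -> R).
Proof. by apply: measurable_indic; rewrite -set_itvNyc. Qed.

Lemma integrable_rvcdf x : P.-integrable setT (EFin \o (fun w => \1_[set y : R | y <= x] (X w))).
Proof.
apply: measurable_bounded_integrable => //.
- by rewrite (le_lt_trans (probability_le1 P measurableT))// ltry.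
- by apply: measurableT_comp.
- exists 1; split; first exact: num_real.
  move=> C hC w _; rewrite /= indicE ger0_norm//; apply: le_trans (ltW hC).
  by case: (_ \in _).
Qed.

Lemma rvcdf_ge0 x : 0 <= rvcdf x.
Proof. by apply: Rintegral_ge0 => w _; rewrite indicE. Qed.

Lemma rvcdf_nd x y : x <= y -> rvcdf x <= rvcdf y.
Proof.
move=> xy; apply: le_Rintegral => //; try exact: integrable_rvcdf.
move=> w _; rewrite !indicE; case: (boolP (_ \in _)) => // /set_mem/= Xx.
by rewrite mem_set//= (le_trans Xx).
Qed.

Lemma rvcdf_le1 x : rvcdf x <= 1.
Proof.
apply: (@le_trans _ _ (\int[P]_w 1)).
  apply: le_Rintegral => //; first exact: integrable_rvcdf.
  exact: finite_measure_integrable_cst.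
have := @Rintegral_cst _ _ _ P setT measurableT 1.
move=> ->.
by rewrite [X in fine X](probability_setT P) mulr1.
Qed.

Let m_ppow a r : measurable_fun setT (fun w => ppow (a - 1) (r - X w)).
Proof.
apply: measurableT_comp; first exact: measurable_ppow.
exact: measurable_funB.
Qed.

Let ppow_dom a r u w : 1 <= a -> 0 < u -> r <= u ->
  ppow (a - 1) (r - X w) <= u `^ (a - 1) * \1_[set y | y <= r] (X w).
Proof.
move=> a1 u0 ru; rewrite indicE; have [rX|rX] := leP (r - X w) 0.
  by rewrite ppow_le// mulr_ge0 ?powR_ge0.
rewrite ppow_gt// mem_set/= ?mulr1; last by rewrite -subr_ge0 ltW.
apply: ge0_ler_powR; rewrite ?nnegrE ?subr_ge0// ?(ltW u0)//.
  by rewrite -subr_ge0 ltW.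
by apply: le_trans ru; rewrite gerBl.
Qed.

Let intU a r : 1 <= a -> P.-integrable setT (EFin \o (fun w => ppow (a - 1) (r - X w))).
Proof.
move=> a1; apply: measurable_bounded_integrable => //.
  by rewrite (le_lt_trans (probability_le1 P measurableT))// ltry.
exists ((Num.max 1 r) `^ (a - 1)); split; first exact: num_real.
move=> C hC w _; rewrite /= ger0_norm ?ppow_ge0//; apply: le_trans (ltW hC).
apply: le_trans (@ppow_dom a r (Num.max 1 r) w a1 _ _) _; rewrite ?lt_max ?ltr01// ?le_max ?lexx ?orbT//.
by rewrite indicE; case: (_ \in _); rewrite ?mulr1 ?mulr0 ?powR_ge0.
Qed.

Let U_ge0 a r : 0 <= U a r.
Proof. by apply: Rintegral_ge0 => w _; exact: ppow_ge0. Qed.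

Let U_le a r : 1 <= a -> 0 < r -> U a r <= r `^ (a - 1) * rvcdf r.
Proof.
move=> a1 r0; rewrite /U /rvcdf -RintegralZl//; last exact: integrable_rvcdf.
apply: le_Rintegral => //; first exact: intU.
  have := @integrableZl _ _ _ P setT measurableT (r `^ (a - 1)) _ (integrable_rvcdf r).
  by apply: eq_integrable.
by move=> w _; exact: ppow_dom.
Qed.

Let U_cont a : 1 < a -> continuous (U a).
Proof.
move=> a1 r.
have ri : r \in (`]r - 1, r + 1[%classic : set R).
  by rewrite inE/= in_itv/=; apply/andP; split; lra.
(* The maximum keeps the base of the power positive for negative [r]. *)
pose u := Num.max 1 (r + 1).
apply: (@continuity_under_integral _ _ _ P (fun r w => ppow (a - 1) (r - X w)) setT measurableT
  (r - 1) (r + 1) _ _ (fun=> u `^ (a - 1))) => //.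
- by move=> x _; apply: intU; exact: ltW.
- apply: aeW => w _ x _.
  apply: (@continuous_comp _ _ _ (fun x => x - X w) (ppow (a - 1))).
    by apply: cvgB; [exact: cvg_id|exact: cvg_cst].
  by apply: ppow_continuous; rewrite subr_gt0.
- exact: finite_measure_integrable_cst.
- move=> x; rewrite /= in_itv/= => /andP[_ x1]; apply: aeW => w _.
  rewrite ger0_norm ?ppow_ge0//.
  apply: le_trans (@ppow_dom a x u w (ltW a1) _ _) _; rewrite ?lt_max ?ltr01// ?le_max ?(ltW x1) ?orbT//.
  by rewrite indicE; case: (_ \in _); rewrite ?mulr1 ?mulr0 ?powR_ge0.
Qed.

Let U_laplace a s : 1 < a -> 0 < s ->
  (\int[@lebesgue_measure R]_(r in `]0%R, +oo[) (U a r * expR (- (s * r)))%:E =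
   (expR (- s `^ b) * (Gamma a * s `^ (- a)))%:E)%E.
Proof.
move=> a1 s0.
have a0 : 0 < a by apply: lt_trans a1.
pose f (r : R) w := (ppow (a - 1) (r - X w) * expR (- (s * r)))%:E.
have E r : (U a r * expR (- (s * r)))%:E = (\int[P]_w f r w)%E.
  rewrite /f; under eq_integral do rewrite EFinM.
  rewrite integralZr//; last by apply: intU; exact: ltW.
  rewrite /U /Rintegral EFinM fineK//.
  by apply: integrable_fin_num => //; apply: intU; exact: ltW.
have U00 r : r <= 0 -> U a r = 0.
  move=> r0; rewrite /U /Rintegral integral0_eq// => w _.
  by rewrite ppow_le//; rewrite subr_le0 (le_trans r0).
transitivity (\int[@lebesgue_measure R]_r (\int[P]_w f r w))%E.
  rewrite integral_mkcond; apply: eq_integral => r _; rewrite -E patchE.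
  case: ifPn => // r0; rewrite U00 ?mul0r//.
  by rewrite leNgt; apply: contra r0 => r0; rewrite inE/= in_itv/= r0.
rewrite tonelli_on//=.
- transitivity (\int[P]_w ((expR (- (s * X w)))%:E * (Gamma a * s `^ (- a))%:E))%E.
    by apply: eq_integral => w _; rewrite /f integral_ppow_expR// EFinM.
  have i1 : P.-integrable setT (EFin \o (fun w => expR (- (s * X w)))).
    have := integrable_pow_expRN P 0 mX X0 s0.
    by apply: eq_integrable => // w _; rewrite /= mul1r.
  rewrite integralZr//.
  rewrite [RHS]EFinM; congr (_ * _)%E.
  by rewrite -HX// /Rintegral fineK//; exact: integrable_fin_num.
- apply: measurable_funTS; apply/measurable_EFinP; apply: measurable_funM.
    apply: measurableT_comp; first exact: measurable_ppow.
    by apply: measurable_funB => //; exact: measurableT_comp.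
  apply: measurableT_comp => //; apply: measurableT_comp => //.
  exact: measurable_funM.
- by move=> r w _ _; rewrite lee_fin mulr_ge0 ?ppow_ge0 ?expR_ge0.
Qed.

(** The Laplace transform of [X^(n+1) dP] is a combination of terms
    [s^(-a) e^(-s^b)] with [a > 1] and nonnegative coefficients, and such a term is
    the Laplace transform of the continuous function
    [r |-> E (r - X)_+^(a-1) / Gamma a]. The bounds come from
    [(r - X)_+^(a-1) <= r^(a-1)] on the event [X <= r]. *)
Lemma moment_density n : 1 < n.+1%:R * (1 - b) ->
  exists V : R -> R, [/\ continuous V, forall r, 0 <= V r,
   exists2 C, 0 <= C & (forall r, 0 < r -> r <= 1 -> V r <= C * rvcdf r) /\
                       (forall r, 1 <= r -> V r <= C * r `^ (n%:R - b)) &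
   forall x, (\int[P]_w (X w ^+ n.+1 * \1_[set y | y <= x] (X w))%:E =
     \int[@lebesgue_measure R]_(r in `]0%R, +oo[) (V r * \1_[set y | y <= x] r)%:E)%E].
Proof.
move=> n1; have [_ /(_ n)[l /allP Hl Hs]] := stable_moments mX X0 b0 b1 HX.
pose N := size l.
pose ca (i : 'I_N) := nth (0, 0) l i.
pose V r := \sum_(i < N) ((ca i).1 / Gamma (ca i).2 * U (ca i).2 r).
have la i : [/\ 0 <= (ca i).1 / Gamma (ca i).2, 1 < (ca i).2 & (ca i).2 - 1 <= n%:R - b].
  have /Hl /and3P[c0 a1 a2] : ca i \in l by apply: mem_nth.
  have a1' : 1 < (ca i).2 by apply: lt_le_trans a1.
  split => //; first by rewrite divr_ge0// ltW// Gamma_gt0// (lt_trans _ a1').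
  by move: a2; rewrite -natr1; lra.
have V0 r : 0 <= V r.
  by apply: sumr_ge0 => i _; have [c0 _ _] := la i; rewrite mulr_ge0// U_ge0.
have cV : continuous V.
  move=> r; rewrite /V; apply: cvg_big => [|i _]; first exact: add_continuous.
  apply: cvgMr.
  by apply: U_cont; have [] := la i.
exists V; split => //.
- exists (\sum_(i < N) ((ca i).1 / Gamma (ca i).2)).
    by apply: sumr_ge0 => i _; have [] := la i.
  split.
  + move=> r r0 r1; rewrite /V mulr_suml; apply: ler_sum => i _; have [c0 a1 _] := la i.
    rewrite ler_wpM2l//; apply: le_trans (U_le (ltW a1) r0) _.
    rewrite ler_piMl ?rvcdf_ge0// -[leRHS](powRr0 r); apply: ger_powR; first by rewrite r0.
    by rewrite subr_ge0 ltW.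
  + move=> r r1; rewrite /V mulr_suml; apply: ler_sum => i _; have [c0 a1 a2] := la i.
    have r0 : 0 < r by apply: lt_le_trans r1.
    rewrite ler_wpM2l//; apply: le_trans (U_le (ltW a1) r0) _.
    apply: (@le_trans _ _ (r `^ ((ca i).2 - 1))); last exact: ler_powR.
    by rewrite ler_piMr ?powR_ge0// rvcdf_le1.
- apply: ge0_laplace_unique => //.
  + exact: measurable_funX.
  + by apply: measurable_funTS; exact: continuous_measurable_fun.
  + by move=> w _; rewrite exprn_ge0.
  + by move=> r /=; rewrite in_itv/= andbT => /ltW.
  + move=> m; have := integrable_pow_expRN P n.+1 mX X0 (ltr0Sn R m).
    exact: integrable_lty.
  + move=> m; have m0 := ltr0Sn R m.
    transitivity (\int[P]_w (X w ^+ n.+1 * expR (- (m.+1%:R * X w))))%:E.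
      rewrite /Rintegral fineK//; apply: integrable_fin_num => //.
      exact: integrable_pow_expRN.
    rewrite Hs// (big_nth (0, 0)) big_mkord -sumEFin.
    rewrite (_ : (fun r => _) = (fun r => \sum_(i < N) ((ca i).1 / Gamma (ca i).2)%:E *
       (U (ca i).2 r * expR (- (m.+1%:R * r)))%:E)%E); last first.
      apply/funext => r; rewrite /V mulr_suml -sumEFin; apply: eq_bigr => i _.
      by rewrite -EFinM mulrA.
    have iU i : (@lebesgue_measure R).-integrable `]0%R, +oo[
        (fun r => (U (ca i).2 r * expR (- (m.+1%:R * r)))%:E).
      have [_ a1 _] := la i.
      have mUe : measurable_fun [set: R] (fun r => U (ca i).2 r * expR (- (m.+1%:R * r))).
        apply: measurable_funM.
          by apply: continuous_measurable_fun; exact: U_cont.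
        exact: measurable_expRN.
      apply/integrableP; split.
        by apply: measurable_funTS; exact/measurable_EFinP.
      rewrite (_ : (fun r => _) = (fun r => (U (ca i).2 r * expR (- (m.+1%:R * r)))%:E)).
        by rewrite U_laplace// ltry.
      by apply/funext => r /=; rewrite ger0_norm// mulr_ge0 ?U_ge0 ?expR_ge0.
    rewrite integral_sum//; last first.
      by move=> i; apply: integrableZl => //; exact: iU.
    apply: eq_bigr => i _; have [_ a1 _] := la i.
    rewrite (integralZl _ (iU i))//.
    rewrite U_laplace// -EFinM; congr EFin.
    have : Gamma (ca i).2 != 0 by rewrite gt_eqF// Gamma_gt0// (lt_trans _ a1).
    by rewrite -/(ca i) => h; field.
Qed.
End stable_law.

Section stable_density.
Context (R : realType) d (T : measurableType d) (P : probability T R)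
  (X : T -> R) (b : R).
Context (mX : measurable_fun setT X) (X0 : forall w, 0 <= X w)
  (b0 : 0 < b) (b1 : b < 1)
  (HX : forall s, 0 < s -> \int[P]_w (expR (- (s * X w))) = expR (- s `^ b)).

Let F := rvcdf P X.

(** Markov's inequality for [e^(-sX)] at [s = 1/x]. *)
Lemma rvcdf_le_expR x : 0 < x -> F x <= expR 1 * expR (- (x `^ (- b))).
Proof.
move=> x0.
have i1 : P.-integrable setT (EFin \o (fun w => expR (- (x^-1 * X w)))).
  have xi : 0 < x^-1 by rewrite invr_gt0.
  have := integrable_pow_expRN P 0 mX X0 xi.
  by apply: eq_integrable => // w _; rewrite /= mul1r.
have -> : x `^ (- b) = x^-1 `^ b by rewrite -(powR_inv1 (ltW x0)) -powRrM mulN1r.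
rewrite -HX ?invr_gt0// -RintegralZl//.
apply: le_Rintegral => //.
- exact: integrable_rvcdf.
- have := @integrableZl _ _ _ P setT measurableT (expR 1) _ i1.
  by apply: eq_integrable.
- move=> w _; rewrite indicE; case: (boolP (_ \in _)) => [|_]; last first.
    by rewrite mulr_ge0 ?expR_ge0.
  rewrite inE/= => Xx; rewrite -expRD -[leLHS]expR0 ler_expR subr_ge0.
  by rewrite ler_pdivrMl// mulr1.
Qed.

(** Flatness at zero compensates the division by a power of [x] in the definition
    of the density. *)
Lemma rvcdf_le_pow (m : nat) : exists2 C, 0 <= C & forall x, 0 < x -> x <= 1 -> F x <= C * x ^+ m.
Proof.
(* The exponential beats the power [k + 1] of [x^(-b)], and [b (k + 1) >= m]. *)
pose k := Num.truncn (m%:R / b).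
exists (expR 1 * k.+1%:R ^+ k.+1); first by rewrite mulr_ge0 ?expR_ge0 ?exprn_ge0.
move=> x x0 x1; apply: le_trans (rvcdf_le_expR x0) _.
rewrite -mulrA ler_wpM2l ?expR_ge0//.
have z0 : 0 < x `^ (- b) by rewrite powR_gt0.
rewrite expRN.
have := expR_lower_pow k (ltW z0).
rewrite -lef_pV2 ?posrE ?expR_gt0 ?exprn_gt0 ?divr_gt0//.
move=> /le_trans; apply.
rewrite expr_div_n invf_div ler_wpM2l ?exprn_ge0//.
rewrite -powR_mulrn ?powR_ge0// -powRrM -powRN -powR_mulrn ?(ltW x0)//.
apply: ger_powR; first by rewrite x0.
rewrite mulNr opprK.
have := ltW (truncnS_gt (m%:R / b)); rewrite -/k.
by rewrite ler_pdivrMr// mulrC.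
Qed.

Let K N z := \int[P]_w (X w ^+ N * \1_[set t | t <= z] (X w)).

Let moment_increment N x y : 0 < x -> x <= y ->
  x ^+ N * (F y - F x) <= K N y - K N x <= y ^+ N * (F y - F x).
Proof.
move=> x0 xy.
have iI z : P.-integrable setT (EFin \o (fun w => \1_[set t : R | t <= z] (X w))).
  exact: integrable_rvcdf.
have iK z : 0 < z -> P.-integrable setT (EFin \o (fun w => X w ^+ N * \1_[set t : R | t <= z] (X w))).
  move=> z0; apply: (@le_integrable _ _ _ P _ measurableT _ (EFin \o (fun w => z ^+ N * \1_[set t : R | t <= z] (X w)))).
  - apply/measurable_EFinP; apply: measurable_funM; first exact: measurable_funX.
    by apply/measurable_EFinP; have /integrableP[] := iI z.
  - move=> w _ /=; rewrite lee_fin indicE; case: (boolP (_ \in _)) => [|_]; last by rewrite !mulr0.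
    rewrite inE/= !mulr1 => Xz; rewrite !ger0_norm ?exprn_ge0 ?(ltW z0)//.
    by rewrite lerXn2r ?nnegrE ?(ltW z0).
  - have := @integrableZl _ _ _ P setT measurableT (z ^+ N) _ (iI z).
    by apply: eq_integrable.
have y0 : 0 < y by apply: lt_le_trans xy.
have iD : P.-integrable setT (EFin \o (fun w => \1_[set t : R | t <= y] (X w) - \1_[set t : R | t <= x] (X w))).
  have := integrableB measurableT (iI y) (iI x).
  by apply: eq_integrable.
have iKD : P.-integrable setT (EFin \o (fun w => X w ^+ N * \1_[set t : R | t <= y] (X w) - X w ^+ N * \1_[set t : R | t <= x] (X w))).
  have := integrableB measurableT (iK y y0) (iK x x0).
  by apply: eq_integrable.
have iDc c : P.-integrable setT (EFin \o (fun w => c * (\1_[set t : R | t <= y] (X w) - \1_[set t : R | t <= x] (X w)))).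
  have := @integrableZl _ _ _ P setT measurableT c _ iD.
  by apply: eq_integrable.
rewrite /F /rvcdf -RintegralB// /K -RintegralB//; [|exact: iK|exact: iK].
rewrite -!RintegralZl//.
have E w : [\/ \1_[set t : R | t <= y] (X w) - \1_[set t : R | t <= x] (X w) = 0 :> R /\
    X w ^+ N * \1_[set t : R | t <= y] (X w) - X w ^+ N * \1_[set t : R | t <= x] (X w) = 0 |
    [/\ x <= X w, X w <= y,
  \1_[set t : R | t <= y] (X w) - \1_[set t : R | t <= x] (X w) = 1 :> R &
    X w ^+ N * \1_[set t : R | t <= y] (X w) - X w ^+ N * \1_[set t : R | t <= x] (X w) = X w ^+ N]].
  rewrite !indicE; have [Xx|xX] := leP (X w) x.
    have Xy := le_trans Xx xy.
    by left; rewrite !mem_set//= !subrr.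
  rewrite [X w \in [set _ | _ <= x]]memNset/=; last by rewrite leNgt xX.
  have [Xy|yX] := leP (X w) y.
    by right; rewrite mem_set//= mulr1 mulr0 !subr0; split => //; exact: ltW.
  by left; rewrite memNset/= ?leNgt ?yX// mulr0 !subr0.
apply/andP; split; apply: le_Rintegral => // w _.
- have [[-> ->]|[xX Xy -> ->]] := E w; first by rewrite mulr0.
  by rewrite mulr1 lerXn2r ?nnegrE ?(ltW x0).
- have [[-> ->]|[xX Xy -> ->]] := E w; first by rewrite mulr0.
  by rewrite mulr1 lerXn2r ?nnegrE ?(ltW y0).
Qed.

(** Let [K z = E (X^N; X <= z)]. The increment of [K] between [x] and [y] lies
    between [x^N] and [y^N] times that of [F], so the difference quotients of [F]
    are squeezed between those of [K], which converge to [V x]. *)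
Lemma is_derive_rvcdf N (V : R -> R) :
  (forall x : R, 0 < x -> {for x, continuous V}) ->
  (forall u, (@lebesgue_measure R).-integrable `]0%R, u] (EFin \o V)) ->
  (forall x : R, 0 < x -> (\int[P]_w (X w ^+ N * \1_[set y | y <= x] (X w))%:E =
     \int[@lebesgue_measure R]_(r in `]0%R, x]) (V r)%:E)%E) ->
  forall x : R, 0 < x -> is_derive x 1 F (V x / x ^+ N).
Proof.
move=> cV iV HK x x0.
pose G z := \int[@lebesgue_measure R]_(r in `]0%R, z]) (V r).
have x1 : x < x + 1 by rewrite ltrDl.
have [dG G'] : derivable G x 1 /\ G^`()%classic x = V x.
  apply: (@continuous_FTC1 _ _ (BRight 0) x (x + 1)) => //.
  exact: cV.
have KG : \forall z \near x, G z = K N z.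
  near=> z; rewrite /G /K /Rintegral HK//; near: z; exact: lt_nbhsr.
have cK : h^-1 * (K N (h + x) - K N x) @[h --> 0^'] --> V x.
  have dK : derivable (K N) x 1 by exact: near_eq_derivable KG dG.
  have E : 'D_1 (K N) x = V x by rewrite -(near_eq_derive _ KG)// -derive1E.
  move: dK => /cvg_ex[l]; rewrite /= => cl.
  have <- : l = V x by rewrite -E; apply/esym/cvg_lim.
  apply: cvg_trans cl; apply: near_eq_cvg; near=> h.
  by rewrite /GRing.scale/= mulr1.
have xN : x ^+ N != 0 by rewrite expf_neq0// gt_eqF.
have cF : h^-1 * (F (h + x) - F x) @[h --> 0^'] --> V x / x ^+ N.
  have h0 : `|h| @[h --> (0 : R)^'] --> (0 : R).
    by apply: cvg_within_filter; have := @norm_continuous R R^o 0; rewrite /continuous_at normr0.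
  apply: (@squeeze_cvgr _ _ _ _ (fun h => h^-1 * (K N (h + x) - K N x) / (x + `|h|) ^+ N)
      (fun h => h^-1 * (K N (h + x) - K N x) / (x - `|h|) ^+ N)).
  - near=> h.
    have hx : `|h| < x by near: h; exact: dnbhs0_lt.
    have xh0 : 0 < x - `|h| by rewrite subr_gt0.
    have hn0 : h != 0 by near: h; exact: nbhs_dnbhs_neq.
    have pN y : 0 < y -> 0 < y ^+ N by move=> ?; exact: exprn_gt0.
    have xph : 0 < x + `|h| by rewrite ltr_wpDr.
    have [q0 /andP[B1 B2]] : 0 <= h^-1 * (F (h + x) - F x) /\
       (x - `|h|) ^+ N * (h^-1 * (F (h + x) - F x)) <= h^-1 * (K N (h + x) - K N x)
       <= (x + `|h|) ^+ N * (h^-1 * (F (h + x) - F x)).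
      have [h0'|h0'] := ltP 0 h.
        rewrite (gtr0_norm h0') in xh0 xph *.
        have xhx : x <= h + x by rewrite lerDr ltW.
        have q0 : 0 <= h^-1 * (F (h + x) - F x).
          by rewrite mulr_ge0 ?invr_ge0 ?(ltW h0')// subr_ge0 rvcdf_nd.
        split => //.
        have /andP[m1 m2] := moment_increment N x0 xhx.
        rewrite (addrC h x) in m1 m2 q0 *; apply/andP; split.
          apply: (@le_trans _ _ (x ^+ N * (h^-1 * (F (x + h) - F x)))).
            by rewrite ler_wpM2r// lerXn2r ?nnegrE ?(ltW xh0) ?(ltW x0)// gerBl ltW.
          by rewrite mulrCA ler_pM2l ?invr_gt0.
        by rewrite [leRHS]mulrCA ler_pM2l ?invr_gt0.
      have hneg : h < 0 by rewrite lt_neqAle hn0.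
      rewrite (ltr0_norm hneg) opprK in xh0 xph *.
      have xhx : x + h <= x by rewrite gerDl.
      rewrite (addrC h x).
      have hN : 0 < - h by rewrite oppr_gt0.
      have EF (f : R -> R) : h^-1 * (f (x + h) - f x) = (- h)^-1 * (f x - f (x + h)).
        by rewrite invrN mulNr -mulrN opprB.
      rewrite !EF.
      have q0 : 0 <= (- h)^-1 * (F x - F (x + h)).
        by rewrite mulr_ge0 ?invr_ge0 ?(ltW hN)// subr_ge0 rvcdf_nd.
      split => //.
      have /andP[m1 m2] := moment_increment N xh0 xhx.
      apply/andP; split; first by rewrite mulrCA ler_pM2l ?invr_gt0.
      apply: (@le_trans _ _ (x ^+ N * ((- h)^-1 * (F x - F (x + h))))).
        by rewrite [leRHS]mulrCA ler_pM2l ?invr_gt0.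
      by rewrite ler_wpM2r// lerXn2r ?nnegrE ?(ltW xph) ?(ltW x0)// lerDl (ltW hN).
    apply/andP; split; first by rewrite ler_pdivrMr ?pN// [leRHS]mulrC.
    by rewrite ler_pdivlMr ?pN// [leLHS]mulrC.
  - apply: cvgM => //; apply: cvgV => //.
    have cx : x + `|h| @[h --> (0 : R)^'] --> x.
      by rewrite -[X in _ --> X]addr0; apply: cvgD => //; exact: cvg_cst.
    apply: (@cvg_comp _ _ _ (fun h => x + `|h|) (fun z => z ^+ N) _ (nbhs x)) => //.
    exact: exprn_continuous.
  - apply: cvgM => //; apply: cvgV => //.
    have cx : x - `|h| @[h --> (0 : R)^'] --> x.
      by rewrite -[X in _ --> X]subr0; apply: cvgB => //; exact: cvg_cst.
    apply: (@cvg_comp _ _ _ (fun h => x - `|h|) (fun z => z ^+ N) _ (nbhs x)) => //.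
    exact: exprn_continuous.
apply: DeriveDef.
- apply/cvg_ex; exists (V x / x ^+ N); apply: cvg_trans cF; apply: near_eq_cvg; near=> h.
  by rewrite /GRing.scale/= mulr1.
- apply/cvg_lim => //; apply: cvg_trans cF; apply: near_eq_cvg; near=> h.
  by rewrite /GRing.scale/= mulr1.
Unshelve. all: by end_near.
Qed.

(** The density is [V x / x^(n+1)], with [V] the density of [X^(n+1) dP] and [n]
    large enough for [V] to be continuous. Near zero, [V] is bounded by a multiple of [F], which
    vanishes faster than every power; at infinity the growth bound on [V] gives
    the decay of order [x^(-1-b)]. *)
Lemma stable_density : exists p : R -> R, [/\ continuous p, forall x, 0 <= p x,
  forall x, x <= 0 -> p x = 0,
  exists2 C, 0 <= C & forall x, 0 < x -> p x <= C /\ x `^ (1 + b) * p x <= C &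
  forall x : R, 0 < x -> is_derive x 1 F (p x)].
Proof.
(* The smallest exponent occurring after [n + 1] steps is [(n + 1) (1 - b) > 1]. *)
pose n := Num.truncn ((1 - b)^-1).
have b1' : 0 < 1 - b by rewrite subr_gt0.
have n1 : 1 < n.+1%:R * (1 - b).
  by rewrite -ltr_pdivrMr// mul1r truncnS_gt.
have [V [cV V0 [C C0 [CV1 CV2]] HV]] := moment_density mX X0 b0 b1 HX n1.
have [C' C'0 F2] := rvcdf_le_pow n.+2.
pose p x := if 0 < x then V x / x ^+ n.+1 else 0.
have pE x : 0 < x -> p x = V x / x ^+ n.+1 by rewrite /p => ->.
have p0 x : x <= 0 -> p x = 0 by rewrite /p leNgt => /negbTE ->.
have pge0 x : 0 <= p x.
  by rewrite /p; case: ifPn => // x0; rewrite divr_ge0// exprn_ge0// ltW.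
have small x : 0 < x -> x <= 1 -> p x <= C * C' * x.
  move=> x0 x1; rewrite pE// ler_pdivrMr ?exprn_gt0//.
  apply: le_trans (CV1 x x0 x1) _; rewrite -!mulrA ler_wpM2l//.
  by apply: le_trans (F2 x x0 x1) _; rewrite -exprS.
have large x : 1 <= x -> x `^ (1 + b) * p x <= C.
  move=> x1; have x0 : 0 < x by apply: lt_le_trans x1.
  rewrite pE// mulrA ler_pdivrMr ?exprn_gt0//.
  apply: (@le_trans _ _ (x `^ (1 + b) * (C * x `^ (n%:R - b)))).
    by rewrite ler_wpM2l ?powR_ge0// CV2.
  rewrite mulrCA -powRD ?(gt_eqF x0) ?implybT//.
  rewrite -powR_mulrn ?(ltW x0)// le_eqVlt; apply/orP; left; apply/eqP; congr (_ * _ `^ _).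
  by rewrite -natr1; ring.
have cp : continuous p.
  move=> x; have [x0|x0|->] := ltgtP x 0.
  - rewrite /continuous_at p0 ?(ltW x0)//; apply: cvg_near_cst; near=> y.
    by rewrite p0//; apply: ltW; near: y; exact: lt_nbhsl.
  - rewrite /continuous_at pE//.
    have c : V y / y ^+ n.+1 @[y --> x] --> V x / x ^+ n.+1.
      apply: cvgM; first exact: cV.
      apply: cvgV; first by rewrite expf_neq0// gt_eqF.
      exact: exprn_continuous.
    apply: cvg_trans c; apply: near_eq_cvg; near=> y.
    by rewrite pE//; near: y; exact: lt_nbhsr.
  - rewrite /continuous_at p0//.
    apply: (@squeeze_cvgr _ _ _ _ (cst 0) (fun y => C * C' * `|y|)).
    + near=> y; rewrite /= pge0/=.
      have [y0|y0] := leP y 0; first by rewrite p0// !mulr_ge0.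
      rewrite gtr0_norm// small//.
      by apply: ltW; near: y; exact: lt_nbhsl.
    + exact: cvg_cst.
    + rewrite -[X in _ --> X](mulr0 (C * C')); apply: cvgMr.
      by have := @norm_continuous R R^o 0; rewrite /continuous_at normr0.
exists p; split => //.
  exists (C + C * C'); first by rewrite addr_ge0// mulr_ge0.
  have CC : 0 <= C * C' by rewrite mulr_ge0.
  move=> x x0; have [x1|x1] := leP x 1.
    have pC : p x <= C * C'.
      by apply: le_trans (small x x0 x1) _; rewrite ler_piMr.
    split; first by apply: le_trans pC _; rewrite lerDr.
    apply: (@le_trans _ _ (p x)).
      rewrite ler_piMl// -[leRHS](powRr0 x); apply: ger_powR; first by rewrite x0.
      by rewrite addr_ge0// ltW.
    by apply: le_trans pC _; rewrite lerDr.
  have pC := large x (ltW x1).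
  split; last by apply: le_trans pC _; rewrite lerDl.
  apply: (@le_trans _ _ (x `^ (1 + b) * p x)); last by apply: le_trans pC _; rewrite lerDl.
  rewrite ler_peMl// -[leLHS](powRr0 x); apply: ler_powR; first exact: ltW.
  by rewrite addr_ge0// ltW.
move=> x x0; rewrite pE//.
apply: is_derive_rvcdf => //.
- by move=> y _; exact: cV.
- move=> u.
  have iV : (@lebesgue_measure R).-integrable `[0%R, u] (EFin \o V).
    apply: continuous_compact_integrable; first exact: segment_compact.
    exact: continuous_subspaceT.
  apply: integrableS iV => //.
  by move=> y /=; rewrite !in_itv/= => /andP[/ltW ->].
- move=> y y0; rewrite HV [RHS]integral_mkcond [LHS]integral_mkcond.
  apply: eq_integral => r _; rewrite !patchE indicE.
  case: (boolP (r \in `]0%R, +oo[%classic)) => [|rn].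
    rewrite inE/= in_itv/= andbT => r0.
    have [ry|yr] := leP r y.
      by rewrite !mem_set/= ?mulr1// in_itv/= r0.
    by rewrite !memNset/= ?mulr0// ?in_itv/= ?leNgt yr// andbF.
  rewrite memNset//=; move: rn; rewrite notin_setE/= !in_itv/= andbT => /negP rn.
  by rewrite (negbTE rn).
Unshelve. all: by end_near. Qed.
End stable_density.

(** * The fractional integral of the stable density *)

Lemma integral_indic_expR (R : realType) (s y : R) : 0 < s ->
  (\int[@lebesgue_measure R]_r (\1_[set t | t <= r] y * expR (- (s * r)))%:E =
   (s^-1 * expR (- (s * y)))%:E)%E.
Proof.
move=> s0.
have mI : measurable_fun [set: R] (fun r : R => \1_[set t : R | t <= r] y : R).
  rewrite (_ : (fun r => _) = \1_`[y, +oo[%classic); first exact: measurable_indic.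
  apply/funext => r; rewrite !indicE; congr ((nat_of_bool _)%:R).
  by apply/idP/idP; rewrite !inE/= in_itv/= andbT.
have mf : measurable_fun [set: R] (fun r : R => (\1_[set t : R | t <= r] y * expR (- (s * r)))%:E).
  by apply/measurable_EFinP; apply: measurable_funM => //; exact: measurable_expRN.
rewrite (@ge0_integral_affine R 1 y)//.
rewrite normr1 mul1e.
rewrite (_ : (fun x => _%:E) = (fun x => (expR (- (s * y)))%:E * ((fun x => (expR (- (s * x)))%:E) \_ `[0%R, +oo[) x)%E); last first.
  apply/funext => x; rewrite patchE indicE mul1r.
  have [x0|x0] := leP 0 x.
    rewrite !mem_set/= ?in_itv/= ?x0// ?lerDr// mul1r -EFinM -expRD; congr (expR _)%:E; ring.
  by rewrite !memNset/= ?in_itv/= ?andbT ?lerDr ?leNgt ?x0// mul0r mule0.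
have mg : measurable_fun [set: R] ((fun x : R => (expR (- (s * x)))%:E) \_ `[0%R, +oo[).
  apply/(measurable_restrictT _ _).1 => //.
  by apply/measurable_EFinP; exact: measurable_expRN.
rewrite ge0_integralZl//; last first.
  by move=> x _; apply: erestrict_ge0 => z _; rewrite lee_fin expR_ge0.
by rewrite -integral_mkcond integral_expRN// -EFinM mulrC.
Qed.

Lemma measurable_indle (R : realType) d (T : measurableType d) (f g : T -> R) :
  measurable_fun setT f -> measurable_fun setT g ->
  measurable_fun setT (fun z => \1_[set t | t <= f z] (g z) : R).
Proof.
move=> mf mg.
rewrite (_ : (fun z => _) = \1_[set z | g z <= f z]).
  apply: measurable_indic; rewrite -[X in measurable X]setTI.
  exact: measurable_fun_le.
apply/funext => z; rewrite !indicE; case: (boolP (g z <= f z)) => h.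
  by rewrite !mem_set.
by rewrite !memNset//; exact/negP.
Qed.

Section stable_convolution.
Context (R : realType) d (T : measurableType d) (P : probability T R)
  (X : T -> R) (b : R).
Context (mX : measurable_fun setT X) (X0 : forall w, 0 <= X w)
  (b0 : 0 < b) (b1 : b < 1)
  (HX : forall s, 0 < s -> \int[P]_w (expR (- (s * X w))) = expR (- s `^ b)).
Context (p : R -> R) (cp : continuous p) (p0 : forall x, 0 <= p x)
  (pneg : forall x, x <= 0 -> p x = 0)
  (C : R) (C0 : 0 <= C) (pC : forall x, 0 < x -> p x <= C)
  (dF : forall x : R, 0 < x -> is_derive x 1 (rvcdf P X) (p x)).

Let F := rvcdf P X.

(** The law has no atom at zero, by flatness. *)
Lemma rvcdf_0 x : x <= 0 -> F x = 0.
Proof.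
move=> x0; have [C' C'0 H] := rvcdf_le_pow mX X0 b0 HX 1.
apply/eqP; rewrite eq_le rvcdf_ge0 andbT.
apply/ler_addgt0Pl => e e0; rewrite addr0.
pose y := Num.min 1 (e / (C' + 1)).
have C1 : 0 < C' + 1 by rewrite ltr_wpDl.
have y0 : 0 < y by rewrite lt_min ltr01/= divr_gt0.
apply: (@le_trans _ _ (F y)).
  by apply: rvcdf_nd => //; apply: le_trans x0 _; exact: ltW.
apply: le_trans (H y y0 _) _; first by rewrite ge_min lexx.
rewrite expr1; apply: (@le_trans _ _ ((C' + 1) * (e / (C' + 1)))).
  by rewrite ler_pM ?(ltW y0)// ?lerDl// ge_min lexx orbT.
by rewrite mulrCA divff ?mulr1// gt_eqF.
Qed.

Lemma integral_density x : 0 <= x ->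
  (\int[@lebesgue_measure R]_(r in `[0%R, x]) (p r)%:E = (F x)%:E)%E.
Proof.
rewrite le_eqVlt => /predU1P[<-|x0].
  by rewrite set_itv1 integral_set1 rvcdf_0.
have FF0 : F 0 = 0 by exact: rvcdf_0.
have dF' y : 0 < y -> derivable F y 1 by move=> y0; have := dF y0 => h; exact: ex_derive.
rewrite (@continuous_FTC2 _ p F 0 x)//.
- by rewrite FF0 sube0.
- exact: continuous_subspaceT.
- split.
  + by move=> y; rewrite in_itv/= => /andP[y0 _]; exact: dF'.
  + rewrite FF0.
    have [C' C'0 H] := rvcdf_le_pow mX X0 b0 HX 1.
    apply: (@squeeze_cvgr _ _ _ _ (cst 0) (fun y => C' * y)).
    * near=> y; rewrite /= rvcdf_ge0/= -[X in C' * X]expr1; apply: H => //.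
      by near: y; exact: nbhs_right_le.
    * exact: cvg_cst.
    * rewrite -[X in _ --> X](mulr0 C'); apply: cvgMr.
      exact: cvg_at_right_filter.
  + by apply: cvg_at_left_filter; apply: derivable_cvg; exact: dF'.
- move=> y; rewrite in_itv/= => /andP[y0 _].
  by rewrite derive1E; have := dF y0 => h; rewrite derive_val.
Unshelve. all: by end_near. Qed.

(** Integration by parts, in the form of Tonelli's theorem: the Laplace transform
    of [F] is [1/s] times that of the law, since [F] is an expectation, and [1/s]
    times that of [p], since [F] is the integral of [p]. *)
Lemma laplace_density s : 0 < s ->
  (\int[@lebesgue_measure R]_r (p r * expR (- (s * r)))%:E = (expR (- s `^ b))%:E)%E.
Proof.
move=> s0.
have mp : measurable_fun [set: R] p by exact: continuous_measurable_fun.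
have L : (\int[@lebesgue_measure R]_r (F r * expR (- (s * r)))%:E =
    (s^-1)%:E * (expR (- s `^ b))%:E)%E.
  transitivity (\int[@lebesgue_measure R]_r \int[P]_w
      (\1_[set t : R | t <= r] (X w) * expR (- (s * r)))%:E)%E.
    apply: eq_integral => r _.
    under [RHS]eq_integral do rewrite EFinM.
    rewrite integralZr//; last exact: integrable_rvcdf.
    rewrite EFinM; congr (_ * _)%E; rewrite /F /rvcdf /Rintegral fineK//.
    by apply: integrable_fin_num => //; exact: integrable_rvcdf.
  rewrite tonelli_on//=; last first.
    apply: measurable_funTS; apply/measurable_EFinP; apply: measurable_funM.
      exact: (measurable_indle measurable_fst (measurableT_comp mX measurable_snd)).
    apply: (measurableT_comp (@measurable_expRN R setT s)); exact: measurable_fst.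
  under eq_integral do rewrite integral_indic_expR// EFinM.
  have i1 : P.-integrable setT (EFin \o (fun w => expR (- (s * X w)))).
    have := integrable_pow_expRN P 0 mX X0 s0.
    by apply: eq_integrable => // w _; rewrite /= mul1r.
  rewrite integralZl//; congr (_ * _)%E.
  by rewrite -HX// /Rintegral fineK//; exact: integrable_fin_num.
have L2 : (\int[@lebesgue_measure R]_r (F r * expR (- (s * r)))%:E =
    (s^-1)%:E * \int[@lebesgue_measure R]_r (p r * expR (- (s * r)))%:E)%E.
  transitivity (\int[@lebesgue_measure R]_r \int[@lebesgue_measure R]_y
      (p y * (\1_[set t : R | t <= r] y * expR (- (s * r))))%:E)%E.
    apply: eq_integral => r _.
    transitivity ((expR (- (s * r)))%:E * \int[@lebesgue_measure R]_(y in `[0%R, r]) (p y)%:E)%E.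
      have [r0|r0] := leP 0 r; first by rewrite integral_density// -EFinM mulrC.
      by rewrite set_itv_ge ?integral_set0 ?mule0 ?rvcdf_0 ?mul0r ?(ltW r0)// bnd_simp -ltNge.
    have mg : measurable_fun [set: R] ((fun y : R => (p y)%:E) \_ `[0%R, r]).
      apply/(measurable_restrictT _ _).1 => //.
      by apply: measurable_funTS; exact/measurable_EFinP.
    rewrite integral_mkcond -ge0_integralZl//; last first.
      by move=> y _; apply: erestrict_ge0 => z _; rewrite lee_fin.
    apply: eq_integral => y _; rewrite patchE indicE.
    have [yr|yr] := leP y r; last first.
      rewrite !memNset/= ?in_itv/= ?leNgt ?yr// ?andbF//.
      by rewrite mul0r mulr0 mule0.
    have -> : (y \in [set t | t <= r]) = true by rewrite mem_set.
    rewrite mul1r; have [y0|y0] := leP 0 y.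
      by rewrite mem_set/= ?in_itv/= ?y0// -EFinM mulrC.
    by rewrite memNset/= ?in_itv/= ?leNgt ?y0// mule0 pneg ?mul0r// ltW.
  rewrite tonelli_on//=; last 2 first.
  - apply: measurable_funTS; apply/measurable_EFinP; apply: measurable_funM.
      apply: (measurableT_comp mp); exact: measurable_snd.
    apply: measurable_funM.
      exact: (measurable_indle measurable_fst measurable_snd).
    apply: (measurableT_comp (@measurable_expRN R setT s)); exact: measurable_fst.
  - by move=> r w _ _; rewrite lee_fin !mulr_ge0 ?expR_ge0// indicE.
  rewrite -ge0_integralZl//; last 3 first.
  - by apply/measurable_EFinP; apply: measurable_funM => //; exact: measurable_expRN.
  - by move=> r _; rewrite lee_fin mulr_ge0 ?expR_ge0.
  - by rewrite lee_fin invr_ge0 ltW.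
  apply: eq_integral => y _.
  under eq_integral do rewrite EFinM.
  rewrite ge0_integralZl//; last 2 first.
  - apply/measurable_EFinP; apply: measurable_funM; last exact: measurable_expRN.
    exact: (@measurable_indle R _ _ id (cst y)).
  - by rewrite lee_fin.
  by rewrite integral_indic_expR// -!EFinM mulrCA.
have := L2; rewrite L => h.
have ss : (s%:E * (s^-1)%:E = 1)%E by rewrite -EFinM divff// gt_eqF.
by rewrite -[LHS]mul1e -[RHS]mul1e -ss -!muleA h.
Qed.

(** Up to the factor [Gamma (1 - b)], the Riemann-Liouville integral of order
    [1 - b] of [p]. *)
Definition frac_conv (r : R) : R :=
  \int[@lebesgue_measure R]_z (ppow (1 - b - 1) z * p (r - z)).

Let mp : measurable_fun [set: R] p. Proof. exact: continuous_measurable_fun. Qed.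

Let b1' : 0 < 1 - b. Proof. by rewrite subr_gt0. Qed.

(** Dominates [z_+^(-b) p (r - z)] for all [r <= u], because [p (r - z)] vanishes
    unless [z < u], where [e^(u - z) >= 1]. *)
Let g (u z : R) : R := C * expR u * (ppow (1 - b - 1) z * expR (- (1 * z))).

Let g_ge0 u z : 0 <= g u z.
Proof. by rewrite /g mulr_ge0// mulr_ge0 ?ppow_ge0 ?expR_ge0. Qed.

Let int_g u : (@lebesgue_measure R).-integrable setT (EFin \o g u).
Proof.
have i : (@lebesgue_measure R).-integrable setT
    (EFin \o (fun z => ppow (1 - b - 1) z * expR (- (1 * z)))).
  apply/integrableP; split.
    apply/measurable_EFinP; apply: measurable_funM; first exact: measurable_ppow.
    exact: measurable_expRN.
  rewrite (_ : (fun r => _) = (fun r => (ppow (1 - b - 1) (r - 0) * expR (- (1 * r)))%:E)).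
    by rewrite integral_ppow_expR// ltry.
  by apply/funext => r /=; rewrite subr0 ger0_norm// mulr_ge0 ?ppow_ge0 ?expR_ge0.
have := @integrableZl _ _ _ (@lebesgue_measure R) setT measurableT (C * expR u) _ i.
by apply: eq_integrable.
Qed.

Let conv_dom u r z : r <= u -> ppow (1 - b - 1) z * p (r - z) <= g u z.
Proof.
move=> ru; have [z0|z0] := leP z 0; first by rewrite ppow_le// mul0r g_ge0.
have [rz|rz] := leP r z.
  by rewrite pneg ?subr_le0// mulr0 g_ge0.
have -> : g u z = ppow (1 - b - 1) z * (C * expR (u - z)).
  by rewrite /g mul1r expRD; ring.
rewrite ler_wpM2l ?ppow_ge0//.
apply: le_trans (pC _) _; first by rewrite subr_gt0.
rewrite ler_peMr// -[leLHS]expR0 ler_expR subr_ge0.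
by apply: ltW; apply: lt_le_trans ru.
Qed.

Let m_conv r : measurable_fun [set: R] (fun z => ppow (1 - b - 1) z * p (r - z)).
Proof.
apply: measurable_funM; first exact: measurable_ppow.
by apply: measurableT_comp => //; exact: measurable_funB.
Qed.

Let conv_ge0 r z : 0 <= ppow (1 - b - 1) z * p (r - z).
Proof. by rewrite mulr_ge0 ?ppow_ge0. Qed.

Lemma integrable_frac_conv r : (@lebesgue_measure R).-integrable setT
  (EFin \o (fun z => ppow (1 - b - 1) z * p (r - z))).
Proof.
apply: le_integrable (int_g r) => //; first by apply/measurable_EFinP; exact: m_conv.
move=> z _ /=; rewrite lee_fin !ger0_norm ?conv_ge0//.
exact: conv_dom.
Qed.

Lemma frac_conv_ge0 r : 0 <= frac_conv r.
Proof. by apply: Rintegral_ge0 => z _; exact: conv_ge0. Qed.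

Lemma continuous_frac_conv : continuous frac_conv.
Proof.
move=> r.
have ri : r \in (`]r - 1, r + 1[%classic : set R).
  by rewrite inE/= in_itv/=; apply/andP; split; lra.
apply: (@continuity_under_integral _ _ _ (@lebesgue_measure R)
  (fun r z => ppow (1 - b - 1) z * p (r - z)) setT measurableT
  (r - 1) (r + 1) _ _ (g (r + 1))) => //.
- by move=> x _; exact: integrable_frac_conv.
- apply: aeW => z _ x _; apply: cvgMr.
  apply: (@continuous_comp _ _ _ (fun x => x - z) p); last exact: cp.
  by apply: cvgB; [exact: cvg_id|exact: cvg_cst].
- move=> x; rewrite /= in_itv/= => /andP[_ x1]; apply: aeW => z _.
  by rewrite ger0_norm ?conv_ge0//; apply: conv_dom; exact: ltW.
Qed.

Lemma laplace_frac_conv s : 0 < s ->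
  (\int[@lebesgue_measure R]_r (frac_conv r * expR (- (s * r)))%:E =
   (Gamma (1 - b) * s `^ (- (1 - b)) * expR (- s `^ b))%:E)%E.
Proof.
move=> s0.
transitivity (\int[@lebesgue_measure R]_r \int[@lebesgue_measure R]_z
   (ppow (1 - b - 1) z * p (r - z) * expR (- (s * r)))%:E)%E.
  apply: eq_integral => r _.
  under [RHS]eq_integral do rewrite EFinM.
  rewrite (integralZr _ (integrable_frac_conv r))// EFinM; congr (_ * _)%E.
  rewrite /frac_conv /Rintegral fineK//.
  exact: (integrable_fin_num _ (integrable_frac_conv r)).
rewrite tonelli_on//=; last 2 first.
- apply: measurable_funTS; apply/measurable_EFinP; apply: measurable_funM.
    apply: measurable_funM.
      by apply: (measurableT_comp (@measurable_ppow R _)); exact: measurable_snd.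
    apply: (measurableT_comp mp); apply: measurable_funB.
      exact: measurable_fst.
    exact: measurable_snd.
  by apply: (measurableT_comp (@measurable_expRN R setT s)); exact: measurable_fst.
- by move=> r z _ _; rewrite lee_fin mulr_ge0 ?expR_ge0// mulr_ge0 ?ppow_ge0.
have mps : measurable_fun [set: R] (fun r => (p r * expR (- (s * r)))%:E).
  by apply/measurable_EFinP; apply: measurable_funM => //; exact: measurable_expRN.
transitivity (\int[@lebesgue_measure R]_z ((ppow (1 - b - 1) (z - 0) * expR (- (s * z)))%:E * (expR (- s `^ b))%:E))%E.
  apply: eq_integral => z _.
  rewrite (@ge0_integral_affine R 1 z)//; last 2 first.
  - apply/measurable_EFinP; apply: measurable_funM; last exact: measurable_expRN.
    apply: measurable_funM => //.
    by apply: measurableT_comp => //; exact: measurable_funB.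
  - by move=> r; rewrite lee_fin mulr_ge0 ?expR_ge0// mulr_ge0 ?ppow_ge0.
  rewrite normr1 mul1e -(laplace_density s0) -ge0_integralZl//; last 2 first.
  - by move=> r _; rewrite lee_fin mulr_ge0 ?expR_ge0.
  - by rewrite lee_fin mulr_ge0 ?ppow_ge0 ?expR_ge0.
  congr (integral _ _ _); apply/funext => r; rewrite subr0 mul1r addrK -EFinM mulrDr opprD expRD; congr EFin.
  ring.
rewrite ge0_integralZr//; last 2 first.
- apply/measurable_EFinP; apply: measurable_funM; last exact: measurable_expRN.
  apply: (measurableT_comp (@measurable_ppow R _)); exact: measurable_funB.
- by move=> r _; rewrite lee_fin mulr_ge0 ?ppow_ge0 ?expR_ge0.
by rewrite integral_ppow_expR// mulr0 oppr0 expR0 mul1r -EFinM.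
Qed.

(** Both sides, multiplied by [b / Gamma (1 - b)], have Laplace transform
    [b s^(b-1) e^(-s^b)]: the left one as a convolution, the right one as minus the
    derivative of the Laplace transform of the law. *)
Lemma frac_conv_density x : 0 < x ->
  frac_conv x = Gamma (1 - b) / b * (x * p x).
Proof.
move=> x0.
have G0 : 0 < Gamma (1 - b) by exact: Gamma_gt0.
pose V r := b / Gamma (1 - b) * frac_conv r.
have cV : continuous V by move=> r; apply: cvgMr; exact: continuous_frac_conv.
have V0 r : 0 <= V r.
  by rewrite mulr_ge0 ?frac_conv_ge0// divr_ge0// ltW.
have fneg r : r <= 0 -> frac_conv r = 0.
  move=> r0; rewrite /frac_conv /Rintegral integral0_eq// => z _.
  have [z0|z0] := leP z 0; first by rewrite ppow_le// mul0r.
  by rewrite pneg ?mulr0// subr_le0 (le_trans r0)// ltW.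
have mfs s : measurable_fun [set: R] (fun r => frac_conv r * expR (- (s * r))).
  apply: measurable_funM; last exact: measurable_expRN.
  by apply: continuous_measurable_fun; exact: continuous_frac_conv.
have HV y : (\int[P]_w (X w ^+ 1 * \1_[set t | t <= y] (X w))%:E =
     \int[@lebesgue_measure R]_(r in `]0%R, +oo[) (V r * \1_[set t | t <= y] r)%:E)%E.
  apply: ge0_laplace_unique => //.
  - by apply: measurable_funTS; exact: continuous_measurable_fun.
  - by move=> w _; rewrite exprn_ge0.
  - by move=> r /=; rewrite in_itv/= andbT => /ltW.
  - move=> m; have := integrable_pow_expRN P 1 mX X0 (ltr0Sn R m).
    exact: integrable_lty.
  - move=> m; have m0 := ltr0Sn R m.
    transitivity (\int[P]_w (X w ^+ 1 * expR (- (m.+1%:R * X w))))%:E.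
      rewrite /Rintegral fineK//; apply: integrable_fin_num => //.
      exact: integrable_pow_expRN.
    have [-> // _] := stable_moments mX X0 b0 b1 HX.
    transitivity ((b / Gamma (1 - b))%:E * (Gamma (1 - b) * m.+1%:R `^ (- (1 - b)) * expR (- m.+1%:R `^ b))%:E)%E.
      by rewrite -EFinM; congr EFin; field; rewrite gt_eqF.
    rewrite -laplace_frac_conv// -ge0_integralZl//; last 3 first.
    + by apply/measurable_EFinP; exact: mfs.
    + by move=> r _; rewrite lee_fin mulr_ge0 ?frac_conv_ge0 ?expR_ge0.
    + by rewrite lee_fin divr_ge0// ltW.
    rewrite [RHS]integral_mkcond; apply: eq_integral => r _.
    rewrite patchE; case: ifPn => [_|r0]; first by rewrite -EFinM mulrA.
    rewrite fneg ?mul0r ?mule0// leNgt; apply: contra r0 => r0.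
    by rewrite inE/= in_itv/= r0.
have dV : is_derive x 1 (rvcdf P X) (V x / x ^+ 1).
  apply: is_derive_rvcdf => //.
  - by move=> y _; exact: cV.
  - move=> u.
    have iV : (@lebesgue_measure R).-integrable `[0%R, u] (EFin \o V).
      apply: continuous_compact_integrable; first exact: segment_compact.
      exact: continuous_subspaceT.
    apply: integrableS iV => //.
    by move=> y /=; rewrite !in_itv/= => /andP[/ltW ->].
  - move=> y y0; rewrite HV [RHS]integral_mkcond [LHS]integral_mkcond.
    apply: eq_integral => r _; rewrite !patchE indicE.
    case: (boolP (r \in `]0%R, +oo[%classic)) => [|rn].
      rewrite inE/= in_itv/= andbT => r0.
      have [ry|yr] := leP r y.
        by rewrite !mem_set/= ?mulr1// in_itv/= r0.
      by rewrite !memNset/= ?mulr0// ?in_itv/= ?leNgt yr// andbF.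
    rewrite memNset//=; move: rn; rewrite notin_setE/= !in_itv/= andbT => /negP rn.
    by rewrite (negbTE rn).
have dp := dF x0.
have : V x / x ^+ 1 = p x.
  by rewrite -(@derive_val _ _ _ _ _ _ _ dV) -(@derive_val _ _ _ _ _ _ _ dp).
rewrite expr1 /V => <-.
by field; rewrite !gt_eqF.
Qed.

End stable_convolution.

(** * The Caputo derivative of a mixture of rescaled distributions *)

Lemma fubini_on (R : realType) d1 d2 (T1 : measurableType d1) (T2 : measurableType d2)
   (m1 : {sigma_finite_measure set T1 -> \bar R})
   (m2 : {sigma_finite_measure set T2 -> \bar R}) (A : set T1) (B : set T2)
   (f : T1 -> T2 -> R) :
  measurable A -> measurable B ->
  measurable_fun (A `*` B) (fun z => f z.1 z.2) ->
  (\int[m2]_(y in B) \int[m1]_(x in A) `|f x y|%:E < +oo)%E ->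
  m1.-integrable A (fun x => \int[m2]_(y in B) (f x y)%:E)%E /\
  (\int[m1]_(x in A) \int[m2]_(y in B) (f x y)%:E =
   \int[m2]_(y in B) \int[m1]_(x in A) (f x y)%:E)%E.
Proof.
move=> mA mB mf fin.
pose F : T1 * T2 -> \bar R := (fun z => (f z.1 z.2)%:E) \_ (A `*` B).
have mF : measurable_fun setT F.
  apply/(measurable_restrictT _ _).1 => //; first exact: measurableX.
  exact/measurable_EFinP.
have FE x y : F (x, y) = ((((fun y => (f x y)%:E) \_ B) y) * (\1_A x)%:E)%E.
  rewrite /F !patchE in_setX/= indicE; case: (x \in A) => /=; last by rewrite mule0.
  by rewrite mule1.
have FE2 x y : F (x, y) = ((((fun x => (f x y)%:E) \_ A) x) * (\1_B y)%:E)%E.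
  rewrite FE !patchE !indicE; case: (x \in A); case: (y \in B);
  by rewrite ?mule1 ?mule0 ?mul0e.
have E1 : (fun x => \int[m2]_y F (x, y))%E = (fun x => \int[m2]_(y in B) (f x y)%:E)%E \_ A.
  apply/funext => x; rewrite patchE; case: ifPn => xA.
    by rewrite [RHS]integral_mkcond; apply: eq_integral => y _; rewrite FE indicE xA mule1.
  by apply: integral0_eq => y _; rewrite FE indicE (negbTE xA) mule0.
have E2 : (fun y => \int[m1]_x F (x, y))%E = (fun y => \int[m1]_(x in A) (f x y)%:E)%E \_ B.
  apply/funext => y; rewrite patchE; case: ifPn => yB.
    by rewrite [RHS]integral_mkcond; apply: eq_integral => x _; rewrite FE2 indicE yB mule1.
  by apply: integral0_eq => x _; rewrite FE2 indicE (negbTE yB) mule0.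
have iF : (m1 \x m2)%E.-integrable setT F.
  apply/(integrable21ltyP _ _ mF).
  apply: le_lt_trans fin; rewrite le_eqVlt; apply/orP; left; apply/eqP.
  rewrite [RHS]integral_mkcond; apply: eq_integral => y _.
  rewrite patchE; case: ifPn => yB.
    rewrite [RHS]integral_mkcond; apply: eq_integral => x _.
    rewrite FE2 indicE yB mule1 !patchE; case: ifPn => // _.
    by rewrite abse0.
  by apply: integral0_eq => x _; rewrite FE2 indicE (negbTE yB) mule0 abse0.
have iA := integrable_fubini_F iF.
have := Fubini iF.
rewrite -[LHS]/(\int[m1]_x (fun x => \int[m2]_y F (x, y)) x)%E.
rewrite -[RHS]/(\int[m2]_y (fun y => \int[m1]_x F (x, y)) y)%E E1 E2 -!integral_mkcond => EF.
split => //; apply/(integrable_mkcond _ mA).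
by rewrite -E1.
Qed.

Section caputo_of_mixture.
Context (R : realType) (b : R) (b0 : 0 < b) (b1 : b < 1).
Context (p F : R -> R) (cp : continuous p) (p0 : forall x, 0 <= p x)
  (pneg : forall x, x <= 0 -> p x = 0)
  (C : R) (C0 : 0 <= C) (pC : forall x, 0 < x -> p x <= C /\ x `^ (1 + b) * p x <= C)
  (dF : forall x : R, 0 < x -> is_derive x 1 F (p x))
  (F0 : forall x, 0 <= F x) (F1 : forall x, F x <= 1)
  (mF : measurable_fun [set: R] F)
  (fconv : forall x, 0 < x -> frac_conv b p x = Gamma (1 - b) / b * (x * p x)).
Context (g : R -> R) (ig : (@lebesgue_measure R).-integrable `]0%R, +oo[ (EFin \o g)).

(** The derivative in [t] of [F (t u^(-1/b))], that is, the density at [t] of the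
    subordinator at time [u]. *)
Definition scaled_density (t u : R) : R := u `^ (- b^-1) * p (t * u `^ (- b^-1)).

(** Minus the derivative in [u] of [F (t u^(-1/b))], that is, the density at [u]
    of the inverse subordinator at time [t]. *)
Definition inverse_density (t u : R) : R :=
  let x := t * u `^ (- b^-1) in u^-1 * (x * p x) / b.

(** The expectation of [q0 + \int_0^Y g] when [P (Y >= u) = F (t u^(-1/b))]. *)
Definition mixture (q0 t : R) : R :=
  q0 + \int[@lebesgue_measure R]_(u in `]0%R, +oo[) (g u * F (t * u `^ (- b^-1))).

Let mg : measurable_fun (`]0%R, +oo[ : set R) g.
Proof. by have /integrableP[/measurable_EFinP] := ig. Qed.

Lemma inverse_density_ge0 t u : 0 < t -> 0 < u -> 0 <= inverse_density t u.
Proof.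
move=> t0 u0; rewrite /inverse_density mulr_ge0 ?invr_ge0 ?(ltW b0)//.
by rewrite mulr_ge0 ?invr_ge0 ?(ltW u0)// mulr_ge0// mulr_ge0 ?(ltW t0) ?powR_ge0.
Qed.

(** Uniform in [u], because [u^(-1) = t^(-b) x^b] for [x = t u^(-1/b)] and
    [x^(1+b) p x] is bounded. *)
Lemma inverse_density_le t u : 0 < t -> 0 < u -> inverse_density t u <= C * t `^ (- b) / b.
Proof.
move=> t0 u0; rewrite /inverse_density; set x := t * _.
have x0 : 0 < x by rewrite mulr_gt0// powR_gt0.
have [_ H] := pC x0.
rewrite ler_wpM2r ?invr_ge0 ?(ltW b0)//.
have uE : u^-1 = t `^ (- b) * x `^ b.
  rewrite /x powRM ?powR_ge0 ?(ltW t0)// mulrA -powRD ?(gt_eqF t0) ?implybT// addNr powRr0 mul1r.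
  by rewrite -powRrM mulNr mulVf ?gt_eqF// powR_inv1// ltW.
have -> : u^-1 * (x * p x) = t `^ (- b) * (x `^ (1 + b) * p x).
  rewrite uE addrC powRD ?(gt_eqF x0) ?implybT// powRr1 ?(ltW x0)//; ring.
by rewrite mulrC ler_wpM2r ?powR_ge0.
Qed.

Lemma scaled_density_ge0 t u : 0 <= scaled_density t u.
Proof. by rewrite /scaled_density mulr_ge0 ?powR_ge0. Qed.

(** Uniform in [u], because [x p x] is bounded. This allows differentiation under
    the integral sign against any integrable function. *)
Lemma scaled_density_le t u : 0 < t -> 0 < u -> scaled_density t u <= C / t.
Proof.
move=> t0 u0; rewrite /scaled_density; set c := u `^ _.
have c0 : 0 < c by rewrite powR_gt0.
have x0 : 0 < t * c by rewrite mulr_gt0.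
rewrite ler_pdivlMr//.
have -> : c * p (t * c) * t = (t * c) * p (t * c) by ring.
have [pC1 pC2] := pC x0.
have [x1|x1] := leP (t * c) 1.
  by apply: le_trans pC1; rewrite ler_piMl.
apply: le_trans pC2; rewrite ler_wpM2r// -[leLHS]powRr1 ?(ltW x0)//.
by apply: ler_powR; rewrite ?(ltW x1)// lerDl ltW.
Qed.

Lemma is_derive_scaled_cdf (t u : R) : 0 < t -> 0 < u ->
  is_derive t 1 (fun t => F (t * u `^ (- b^-1))) (scaled_density t u).
Proof.
move=> t0 u0; rewrite /scaled_density; set c := u `^ _.
have c0 : 0 < c by rewrite powR_gt0.
have dc : is_derive t 1 (fun t => t * c) c.
  by apply: is_derive_eq; rewrite /GRing.scale/= mulr0 add0r mulr1.
have := @is_derive1_comp R F (fun t => t * c) t _ _ (dF (mulr_gt0 t0 c0)) dc.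
by rewrite mulrC.
Qed.

Let m_scale t : measurable_fun [set: R] (fun u => t * u `^ (- b^-1)).
Proof. by apply: measurable_funM => //; exact: measurable_powR. Qed.

Let int_gF t : (@lebesgue_measure R).-integrable `]0%R, +oo[
  (EFin \o (fun u => g u * F (t * u `^ (- b^-1)))).
Proof.
apply: le_integrable ig => //.
- apply/measurable_EFinP; apply: measurable_funM => //.
  by apply: measurable_funTS; apply: (measurableT_comp mF); exact: m_scale.
- by move=> u _ /=; rewrite lee_fin normrM ler_piMr// ger0_norm.
Qed.

Lemma mixture_derive (q0 t : R) : 0 < t ->
  is_derive t 1 (mixture q0)
    (\int[@lebesgue_measure R]_(u in `]0%R, +oo[) (g u * scaled_density t u)).
Proof.
move=> t0.
pose f t u := g u * F (t * u `^ (- b^-1)).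
pose I : set R := `]t / 2, t * 2[%classic.
have It : I t by rewrite /I /= in_itv/=; apply/andP; split; lra.
have t20 : 0 < t / 2 by rewrite divr_gt0.
have I0 x : I x -> t / 2 < x /\ 0 < x.
  by rewrite /I /= in_itv/= => /andP[tx _]; split => //; apply: lt_trans tx.
have df x u : I x -> (`]0%R, +oo[%classic : set R) u ->
    is_derive x 1 (f ^~ u) (g u * scaled_density x u).
  move=> /I0[_ x0]; rewrite /= in_itv/= andbT => u0.
  by apply: is_deriveZ; exact: is_derive_scaled_cdf.
pose G u := `|g u| * (C / (t / 2)).
have G0 u : 0 <= G u by rewrite mulr_ge0// divr_ge0// ltW.
have iG : (@lebesgue_measure R).-integrable `]0%R, +oo[ (EFin \o G).
  have h := integrable_norm ig.
  have := @integrableZr _ _ _ (@lebesgue_measure R) `]0%R, +oo[%classic (measurable_itv _) (C / (t / 2)) _ h.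
  by apply: eq_integrable.
have mB : measurable (`]0%R, +oo[%classic : set (measurableTypeR R)) by exact: measurable_itv.
have intf x : I x -> (@lebesgue_measure R).-integrable `]0%R, +oo[ (EFin \o f x).
  by move=> _; exact: int_gF.
have derf1 x u : I x -> (`]0%R, +oo[%classic : set R) u -> derivable (f ^~ u) x 1.
  by move=> Ix u0; have h := df x u Ix u0; exact: ex_derive.
have Gub x u : I x -> (`]0%R, +oo[%classic : set R) u -> `|partial1of2 f x u| <= G u.
  move=> Ix u0; have h := df x u Ix u0; have [tx x0] := I0 _ Ix.
  rewrite partial1of2E derive_val normrM ler_wpM2l// ger0_norm ?scaled_density_ge0//.
  move: u0; rewrite /= in_itv/= andbT => u0.
  apply: le_trans (scaled_density_le x0 u0) _.
  by rewrite ler_wpM2l// lef_pV2 ?posrE// ltW.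
have D := derivable_under_integral mB It intf derf1 G0 iG Gub.
have E := differentiation_under_integral mB It intf derf1 G0 iG Gub.
pose J t := \int[@lebesgue_measure R]_(u in `]0%R, +oo[) (g u * F (t * u `^ (- b^-1))).
have dJ : is_derive t 1 J (\int[@lebesgue_measure R]_(u in `]0%R, +oo[) (g u * scaled_density t u)).
  apply: DeriveDef; first exact: D.
  rewrite -derive1E [LHS]E; apply: eq_Rintegral => u; rewrite inE => u0.
  have h := df t u It u0; by rewrite partial1of2E derive_val.
have := is_deriveD (is_derive_cst q0 t 1) dJ.
by rewrite add0r.
Qed.

(** The fractional integral in time of the density of [D u] is a multiple of the
    density of [Y t] at [u]. In terms of Laplace transforms in time it is the
    product of [s^(b-1)] and [e^(-u s^b)]; here it is [frac_conv_density] after the substitution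
    [s = t - u^(1/b) z]. *)
Let scaled_conv t u : 0 < t -> 0 < u ->
  (\int[@lebesgue_measure R]_(s in `]0%R, t[) ((t - s) `^ (- b) * scaled_density s u)%:E =
   (Gamma (1 - b) * inverse_density t u)%:E)%E.
Proof.
move=> t0 u0.
pose c := u `^ b^-1; have c0 : 0 < c by exact: powR_gt0.
have ci : u `^ (- b^-1) = c^-1 by rewrite powRN.
pose x := t * c^-1; have x0 : 0 < x by rewrite mulr_gt0 ?invr_gt0.
have mpp : measurable_fun [set: R] p by exact: continuous_measurable_fun.
pose k := 1 - b - 1.
have kE : k = - b by rewrite /k; ring.
have cb : c `^ k = u^-1.
  by rewrite kE /c -powRrM mulrN mulVf ?gt_eqF// powR_inv1// ltW.
transitivity (\int[@lebesgue_measure R]_s (ppow k (t - s) * (c^-1 * p (s * c^-1)))%:E)%E.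
  rewrite [LHS]integral_mkcond; apply: eq_integral => s _.
  rewrite patchE; case: (boolP (s \in _)) => [|sn].
    rewrite inE/= in_itv/= => /andP[s0 st].
    by rewrite /scaled_density ci ppow_gt ?subr_gt0// kE.
  have [s0|s0] := leP s 0.
    by rewrite pneg ?mulr0// mulr_le0_ge0// invr_ge0 ltW.
  have [st|st] := leP t s; first by rewrite ppow_le ?mul0r// subr_le0.
  by move: sn; rewrite notin_setE/= in_itv/= s0 st.
rewrite (@ge0_integral_affine R (- c) t); first last.
- by move=> s; rewrite lee_fin mulr_ge0 ?ppow_ge0// mulr_ge0// invr_ge0 ltW.
- apply/measurable_EFinP; apply: measurable_funM.
    by apply: (measurableT_comp (@measurable_ppow R _)); exact: measurable_funB.
  apply: measurable_funM => //; apply: (measurableT_comp mpp).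
  exact: measurable_funM.
- by rewrite oppr_eq0 gt_eqF.
rewrite normrN (gtr0_norm c0) -ge0_integralZl//; last 3 first.
- apply/measurable_EFinP; apply: measurable_funM.
    apply: (measurableT_comp (@measurable_ppow R _)); apply: measurable_funB => //.
    by apply: measurable_funD => //; exact: measurable_funM.
  apply: measurable_funM => //; apply: (measurableT_comp mpp).
  by apply: measurable_funM => //; apply: measurable_funD => //; exact: measurable_funM.
- by move=> s _; rewrite lee_fin mulr_ge0 ?ppow_ge0// mulr_ge0// invr_ge0 ltW.
- by rewrite lee_fin ltW.
have E z : (c%:E * (ppow k (t - (- c * z + t)) * (c^-1 * p ((- c * z + t) * c^-1)))%:E =
    (u^-1)%:E * (ppow k z * p (x - z))%:E)%E.
  rewrite -!EFinM; congr EFin.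
  have -> : t - (- c * z + t) = c * z by ring.
  have -> : (- c * z + t) * c^-1 = x - z by rewrite /x; field; rewrite gt_eqF.
  have [z0|z0] := leP z 0.
    by rewrite !ppow_le ?mul0r ?mulr0//; rewrite pmulr_rle0.
  rewrite !ppow_gt ?mulr_gt0// powRM ?(ltW c0) ?(ltW z0)// cb.
  by field; rewrite !gt_eqF.
rewrite (_ : (fun z => _) = (fun z => (u^-1)%:E * (ppow k z * p (x - z))%:E)%E); last first.
  by apply/funext => z; rewrite E.
rewrite ge0_integralZl//; last 3 first.
- apply/measurable_EFinP; apply: measurable_funM; first exact: measurable_ppow.
  by apply: (measurableT_comp mpp); exact: measurable_funB.
- by move=> s _; rewrite lee_fin mulr_ge0 ?ppow_ge0.
- by rewrite lee_fin invr_ge0 ltW.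
have pC' y : 0 < y -> p y <= C by move=> /pC[].
rewrite -[X in (_ * X)%E]fineK; last first.
  exact: (integrable_fin_num _ (integrable_frac_conv b1 cp p0 pneg C0 pC' x)).
rewrite -[fine _]/(frac_conv b p x) fconv// -EFinM; congr EFin.
by rewrite /inverse_density ci -/x; field; rewrite !gt_eqF.
Qed.

Let int_gs s : 0 < s -> (@lebesgue_measure R).-integrable `]0%R, +oo[
  (EFin \o (fun u => g u * scaled_density s u)).
Proof.
move=> s0.
have mB : measurable (`]0%R, +oo[%classic : set (measurableTypeR R)) by exact: measurable_itv.
have iC : (@lebesgue_measure R).-integrable `]0%R, +oo[ (EFin \o (fun u => g u * (C / s))).
  have := @integrableZr _ _ _ (@lebesgue_measure R) `]0%R, +oo[%classic mB (C / s) _ ig.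
  by apply: eq_integrable.
have mpp : measurable_fun [set: R] p by exact: continuous_measurable_fun.
apply: le_integrable iC; first exact: mB.
  apply/measurable_EFinP; apply: measurable_funM; first exact: mg.
  apply: measurable_funTS; apply: measurable_funM; first exact: measurable_powR.
  apply: (measurableT_comp mpp); exact: m_scale.
move=> u; rewrite /= in_itv/= andbT => u0; rewrite lee_fin normrM [leRHS]normrM.
apply: ler_wpM2l; first exact: normr_ge0.
rewrite (ger0_norm (scaled_density_ge0 s u)).
apply: le_trans (scaled_density_le s0 u0) _; exact: ler_norm.
Qed.

(** The derivative of [q] at [s] is the integral of [g u * scaled_density s u];
    exchanging this integral with the fractional one leaves [scaled_conv]. *)
Lemma caputo_mixture (q : R -> R) q0 t : 0 < t ->
  (forall s, 0 < s -> q s = mixture q0 s) ->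
  [/\ caputo_derivable b q t,
   (@lebesgue_measure R).-integrable `]0%R, +oo[ (EFin \o (fun u => g u * inverse_density t u)) &
   caputo b q t = \int[@lebesgue_measure R]_(u in `]0%R, +oo[) (g u * inverse_density t u)].
Proof.
move=> t0 Hq.
have dq (s : R) : 0 < s -> is_derive s 1 q
    (\int[@lebesgue_measure R]_(u in `]0%R, +oo[) (g u * scaled_density s u)).
  move=> s0; have dm := mixture_derive q0 s0.
  have qm : \forall y \near s, mixture q0 y = q y.
    by near=> y; rewrite Hq//; near: y; exact: lt_nbhsr.
  apply: DeriveDef.
    have dmix : derivable (mixture q0) s 1 by exact: ex_derive.
    exact: near_eq_derivable qm dmix.
  by rewrite -(near_eq_derive _ qm)// derive_val.
have G0 : 0 < Gamma (1 - b) by apply: Gamma_gt0; rewrite subr_gt0.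
have mpp : measurable_fun [set: R] p by exact: continuous_measurable_fun.
have mB : measurable (`]0%R, +oo[%classic : set (measurableTypeR R)) by exact: measurable_itv.
have mA : measurable (`]0%R, t[%classic : set (measurableTypeR R)) by exact: measurable_itv.
pose f s u := (t - s) `^ (- b) * (g u * scaled_density s u).
have mf : measurable_fun ((`]0%R, t[%classic : set (measurableTypeR R)) `*` (`]0%R, +oo[%classic : set (measurableTypeR R)))
    (fun z => f z.1 z.2).
  apply: measurable_funM.
    apply: measurable_funTS; apply: (measurableT_comp (@measurable_powR R _)).
    by apply: measurable_funB => //; exact: measurable_fst.
  apply: measurable_funM.
    apply: (measurable_comp mB _ mg); last by apply: measurable_funTS; exact: measurable_snd.
    by move=> _ [z [_ z2] <-].
  have mu2 : measurable_fun setT (fun z : measurableTypeR R * measurableTypeR R => z.2 `^ (- b^-1)).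
    by apply: (measurableT_comp (@measurable_powR R _)); exact: measurable_snd.
  apply: measurable_funTS; apply: measurable_funM => //.
  apply: (measurableT_comp mpp); apply: measurable_funM => //; exact: measurable_fst.
have mH : measurable_fun (`]0%R, +oo[%classic : set R) (inverse_density t).
  apply: (eq_measurable_fun (fun u : R => u `^ (-1) * (t * u `^ (- b^-1) * p (t * u `^ (- b^-1))) / b)).
    move=> u; rewrite inE/= in_itv/= andbT => u0.
    by rewrite powR_inv1// ltW.
  apply: measurable_funTS; apply: measurable_funM => //; apply: measurable_funM.
    exact: measurable_powR.
  apply: measurable_funM => //.
  by apply: (measurableT_comp mpp).
have iH : (@lebesgue_measure R).-integrable `]0%R, +oo[ (EFin \o (fun u => g u * inverse_density t u)).
  have iC : (@lebesgue_measure R).-integrable `]0%R, +oo[ (EFin \o (fun u => g u * (C * t `^ (- b) / b))).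
    have := @integrableZr _ _ _ (@lebesgue_measure R) `]0%R, +oo[%classic mB (C * t `^ (- b) / b) _ ig.
    by apply: eq_integrable.
  apply: le_integrable iC => //.
    by apply/measurable_EFinP; apply: measurable_funM.
  move=> u; rewrite /= in_itv/= andbT => u0; rewrite lee_fin normrM [leRHS]normrM ler_wpM2l//.
  rewrite (ger0_norm (inverse_density_ge0 t0 u0)).
  by apply: le_trans (inverse_density_le t0 u0) _; rewrite ler_norm.
have mks u : measurable_fun (`]0%R, t[%classic : set R) (fun s => (t - s) `^ (- b) * scaled_density s u).
  apply: measurable_funTS; apply: measurable_funM.
    by apply: (measurableT_comp (@measurable_powR R _)); exact: measurable_funB.
  apply: measurable_funM => //.
  by apply: (measurableT_comp mpp); exact: measurable_funM.
have ks0 s u : (0 <= ((t - s) `^ (- b) * scaled_density s u)%:E)%E.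
  by rewrite lee_fin mulr_ge0 ?powR_ge0 ?scaled_density_ge0.
have fin : (\int[@lebesgue_measure R]_(u in `]0%R, +oo[) \int[@lebesgue_measure R]_(s in `]0%R, t[) `|f s u|%:E < +oo)%E.
  have iGH : (@lebesgue_measure R).-integrable `]0%R, +oo[ (EFin \o (fun u => Gamma (1 - b) * (g u * inverse_density t u))).
    have := @integrableZl _ _ _ (@lebesgue_measure R) `]0%R, +oo[%classic mB (Gamma (1 - b)) _ iH.
    by apply: eq_integrable.
  have /integrableP[_] := iGH; apply: le_lt_trans.
  rewrite le_eqVlt; apply/orP; left; apply/eqP.
  apply: eq_integral => u; rewrite inE/= in_itv/= andbT => u0.
  rewrite (_ : (fun s => _) = (fun s => `|g u|%:E * ((t - s) `^ (- b) * scaled_density s u)%:E)%E); last first.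
    apply/funext => s; rewrite -EFinM /f mulrCA normrM; congr (_ * _)%:E.
    by apply: ger0_norm; rewrite mulr_ge0 ?powR_ge0 ?scaled_density_ge0.
  rewrite ge0_integralZl//; last by apply/measurable_EFinP; exact: mks.
  rewrite scaled_conv// -EFinM /= normrM [in RHS]normrM (ger0_norm (inverse_density_ge0 t0 u0)) (gtr0_norm G0).
  by congr EFin; ring.
have {fin ks0}[iA EA] := fubini_on mA mB mf fin.
have cE s : 0 < s -> ((caputo_integrand b q t s)%:E =
    \int[@lebesgue_measure R]_(u in `]0%R, +oo[) (f s u)%:E)%E.
  move=> s0; rewrite /caputo_integrand derive1E; have h := dq s s0.
  rewrite derive_val EFinM /Rintegral fineK; last exact: (integrable_fin_num _ (int_gs s0)).
  by rewrite -(integralZl _ (int_gs s0)).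
have cE' : {in `]0%R, t[%classic : set R, (fun s => \int[@lebesgue_measure R]_(u in `]0%R, +oo[) (f s u)%:E)%E =1
   EFin \o caputo_integrand b q t}.
  by move=> s; rewrite inE/= in_itv/= => /andP[s0 _]; rewrite /= cE.
split; [|exact: iH|].
  split; first by move=> s s0 _; have h := dq s s0; exact: ex_derive.
  apply: eq_integrable iA; [exact: mA|exact: cE'].
have EI : (\int[@lebesgue_measure R]_(s in `]0%R, t[) (caputo_integrand b q t s)%:E =
    \int[@lebesgue_measure R]_(s in `]0%R, t[) \int[@lebesgue_measure R]_(u in `]0%R, +oo[) (f s u)%:E)%E.
  by apply: eq_integral => s s0; rewrite -[LHS](cE' s s0).
rewrite /caputo {1}/Rintegral EI EA.
rewrite (_ : (\int[_]_(u in _) _)%E = \int[@lebesgue_measure R]_(u in `]0%R, +oo[) ((Gamma (1 - b))%:E * (g u * inverse_density t u)%:E))%E.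
  rewrite (integralZl mB iH) fineM; [|exact: fin_numE|exact: (integrable_fin_num mB iH)].
  by rewrite -[fine _%:E]/(Gamma (1 - b)) mulKf ?gt_eqF.
apply: eq_integral => u; rewrite inE/= in_itv/= andbT => u0.
have iks : (@lebesgue_measure R).-integrable `]0%R, t[ (EFin \o (fun s => (t - s) `^ (- b) * scaled_density s u)).
  apply/integrableP; split; first by apply/measurable_EFinP; exact: mks.
  rewrite (_ : (fun s => _) = (fun s => ((t - s) `^ (- b) * scaled_density s u)%:E)).
    by rewrite (scaled_conv t0 u0) ltry.
  apply/funext => s /=; congr EFin; apply: ger0_norm.
  by apply: mulr_ge0; [exact: powR_ge0|exact: scaled_density_ge0].
rewrite (_ : (fun s => _) = (fun s => (g u)%:E * ((t - s) `^ (- b) * scaled_density s u)%:E)%E); last first.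
  by apply/funext => s; rewrite -EFinM /f mulrCA.
rewrite (integralZl mA iks) (scaled_conv t0 u0) -!EFinM; congr EFin; ring.
Unshelve. all: by end_near.
Qed.
End caputo_of_mixture.

(** * The law of the inverse stable subordinator *)

Lemma rvcdfE (R : realType) d (T : measurableType d) (P : probability T R) (X : T -> R) x :
  measurable_fun setT X -> (rvcdf P X x)%:E = P [set w | X w <= x].
Proof.
move=> mX; have mS : measurable [set w | X w <= x].
  rewrite -[X in measurable X]setTI; exact: measurable_fun_le.
rewrite /rvcdf /Rintegral fineK; last first.
  by apply: integrable_fin_num => //; exact: integrable_rvcdf.
rewrite (_ : (fun w => _) = (fun w => (\1_[set w | X w <= x] w)%:E)).
  by rewrite integral_indic// setIT.
by apply/funext => w; rewrite !indicE.
Qed.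

Section inverse_stable.
Context (R : realType) d (T : measurableType d) (P : probability T R)
  (b : R) (b0 : 0 < b) (b1 : b < 1) (D : R -> T -> R)
  (hD : is_stable_subordinator P b D).

Let X := D 1.
Let Y := inverse_subordinator D.

Lemma stable_ge0 t w : 0 <= t -> 0 <= D t w.
Proof.
by move=> t0; rewrite -(stable_start hD w); apply: (stable_nondecreasing hD).
Qed.

Let mD t : 0 <= t -> measurable_fun setT (D t).
Proof. exact: (stable_measurable hD). Qed.

Lemma stable_unit_laplace s : 0 < s -> \int[P]_w (expR (- (s * X w))) = expR (- s `^ b).
Proof.
move=> s0; have := stable_laplace hD (ltW s0) (@ler01 R).
rewrite unlock mulN1r => H.
rewrite /Rintegral (_ : (fun w => _) = (fun w => (expR (- s * D 1 w))%:E)) ?H//.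
by apply/funext => w; rewrite mulNr.
Qed.

(** The variables [D u] and [u^(1/b) D 1] have the same Laplace transform. *)
Lemma stable_scaling u t : 0 < u ->
  P [set w | D u w <= t] = (rvcdf P X (t * u `^ (- b^-1)))%:E.
Proof.
move=> u0; rewrite rvcdfE//; last exact: mD.
pose c := u `^ b^-1; have c0 : 0 < c by exact: powR_gt0.
have mu := mD (ltW u0).
have mX : measurable_fun setT (fun w => c * X w) by apply: measurable_funM => //; exact: mD.
transitivity (P [set w | c * X w <= t]); last first.
  congr (P _); apply/seteqP; split => w /=; by rewrite powRN ler_pdivlMr// mulrC.
have HL s : 0 < s -> (\int[P]_w (1 * expR (- (s * D u w)))%:E = \int[P]_w (1 * expR (- (s * (c * X w))))%:E)%E.
  move=> s0; transitivity ((expR (- u * s `^ b))%:E).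
    have := stable_laplace hD (ltW s0) (ltW u0).
    rewrite unlock => <-; apply: eq_integral => w _; rewrite mul1r mulNr//.
  have sc0 : 0 < s * c by rewrite mulr_gt0.
  have := stable_laplace hD (ltW sc0) (@ler01 R).
  rewrite unlock powRM ?(ltW s0) ?(ltW c0)// -powRrM mulVf ?gt_eqF// powRr1 ?(ltW u0)//.
  rewrite mulN1r mulNr (mulrC u) => <-; apply: eq_integral => w _.
  by rewrite mul1r mulrA mulNr.
have := @ge0_laplace_unique R _ _ T T P P setT setT (cst 1) (D u) (cst 1) (fun w => c * X w)
  measurableT measurableT.
move=> /(_ (measurable_cst _) mu (measurable_cst _) mX).
move=> /(_ (fun w _ => conj ler01 (stable_ge0 w (ltW u0)))).
have h w : setT w -> 0 <= (cst 1 w : R) /\ 0 <= c * X w.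
  by move=> _; split; [exact: ler01|rewrite mulr_ge0 ?(ltW c0)// stable_ge0].
move=> /(_ h) {h}.
have fin n : (\int[P]_(x in setT) (cst 1 x * expR (- (n.+1%:R * D u x)))%:E < +oo)%E.
  have := integrable_pow_expRN P 0 mu (fun w => stable_ge0 w (ltW u0)) (ltr0Sn R n).
  exact: integrable_lty.
move=> /(_ fin (fun n => HL _ (ltr0Sn R n)) t).
have E (Z : T -> R) : measurable_fun setT Z ->
    (\int[P]_(w in setT) (cst 1 w * \1_[set y : R | (y <= t)%R] (Z w))%R%:E = P [set w | (Z w <= t)%R])%E.
  move=> mZ; rewrite -rvcdfE// /rvcdf /Rintegral fineK; last first.
    by apply: integrable_fin_num => //; exact: integrable_rvcdf.
  by apply: eq_integral => w _; rewrite mul1r.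
by rewrite !E.
Qed.

(** On this event the passage time is the infimum of the empty set, and the
    default value of that infimum is zero. *)
Let never t := [set w | forall n : nat, D n%:R w <= t].

Let m_le t x : 0 <= t -> measurable [set w | D t w <= x].
Proof.
move=> t0; rewrite -[X in measurable X]setTI; apply: measurable_fun_le => //.
exact: mD.
Qed.

Let m_never t : measurable (never t).
Proof.
rewrite (_ : never t = \bigcap_n [set w | D n%:R w <= t]).
  by apply: bigcapT_measurable => n; exact: m_le.
by apply/seteqP; split => w /= h n; [move=> _; exact: h|exact: (h n I)].
Qed.

(** By scaling, [P (D n <= t)] vanishes as [n] grows. *)
Let never0 t : P (never t) = 0%E.
Proof.
have [C C0 HC] := rvcdf_le_pow (mD ler01) (fun w => stable_ge0 w ler01) b0 stable_unit_laplace 1.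
apply/eqP; rewrite eq_le measure_ge0 andbT.
apply/lee_addgt0Pr => e e0; rewrite add0e.
pose t' := Num.max t 1; have t'0 : 0 < t' by rewrite lt_max ltr01 orbT.
(* Here [n] is chosen with [n^(-1/b) <= eta], so that [C t' n^(-1/b) <= e]. *)
pose eta := Num.min 1 (e / (C + 1)) / t'.
have C1 : 0 < C + 1 by rewrite ltr_wpDl.
have eta0 : 0 < eta by rewrite divr_gt0// lt_min ltr01/= divr_gt0.
pose n := (Num.truncn (eta `^ (- b))).+1.
have n0 : 0 < n%:R :> R by [].
have nE : n%:R `^ (- b^-1) <= eta.
  have h : eta `^ (- b) <= n%:R by rewrite ltW// truncnS_gt.
  rewrite powRN -[leRHS]invrK lef_pV2 ?posrE ?powR_gt0 ?invr_gt0//.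
  apply: (@le_trans _ _ ((eta `^ (- b)) `^ b^-1)); last first.
    by apply: ge0_ler_powR; rewrite ?nnegrE ?powR_ge0 ?invr_ge0 ?(ltW b0).
  by rewrite -powRrM mulNr divff ?gt_eqF// powR_inv1// ltW.
apply: (@le_trans _ _ (P [set w | D n%:R w <= t])).
  by apply: le_measure; rewrite ?inE//; [exact: m_le|move=> w; exact].
rewrite stable_scaling// lee_fin.
apply: (@le_trans _ _ (rvcdf P X (t' * n%:R `^ (- b^-1)))).
  apply: rvcdf_nd; first exact: mD.
  by rewrite ler_wpM2r ?powR_ge0// le_max lexx.
have z0 : 0 < t' * n%:R `^ (- b^-1) by rewrite mulr_gt0 ?powR_gt0.
have zle : t' * n%:R `^ (- b^-1) <= Num.min 1 (e / (C + 1)).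
  apply: (@le_trans _ _ (t' * eta)); first by rewrite ler_wpM2l// ltW.
  by rewrite /eta mulrC divfK// gt_eqF.
apply: le_trans (HC _ z0 _) _; first by apply: le_trans zle _; rewrite ge_min lexx.
rewrite expr1; apply: (@le_trans _ _ ((C + 1) * (e / (C + 1)))).
  rewrite ler_pM ?(ltW z0)// ?lerDl//.
  by apply: le_trans zle _; rewrite ge_min lexx orbT.
by rewrite mulrCA divff ?mulr1// gt_eqF.
Qed.

Lemma inverse_subordinator_ge0 t w : 0 <= Y t w.
Proof.
rewrite /Y /inverse_subordinator; set S := [set x | _].
have [->|/set0P S0] := eqVneq S set0; first by rewrite inf0.
by apply: lb_le_inf => // x [].
Qed.

Let Y_lt t u w : 0 <= u -> t < D u w -> Y t w <= u.
Proof.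
move=> u0 tu; apply: ge_inf; last by split.
by exists 0 => x [].
Qed.

Let Y_ge t u w : 0 <= u -> D u w <= t -> ~ never t w -> u <= Y t w.
Proof.
move=> u0 ut /existsNP[n /negP]; rewrite -ltNge => tn.
apply: lb_le_inf; first by exists n%:R; split.
move=> x [x0 tx]; rewrite leNgt; apply/negP => xu.
have := lt_le_trans tx (le_trans (stable_nondecreasing hD w x0 (ltW xu)) ut).
by rewrite ltxx.
Qed.

Let Y_never t w : never t w -> Y t w = 0.
Proof.
move=> nw; rewrite /Y /inverse_subordinator.
rewrite (_ : [set x | _] = set0) ?inf0//.
apply/seteqP; split => // x [x0 tx].
have xn : x <= (Num.truncn x).+1%:R by rewrite ltW// truncnS_gt.
have := lt_le_trans tx (le_trans (stable_nondecreasing hD w x0 xn) (nw _)).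
by rewrite ltxx.
Qed.

(** Outside the event [never t], [Y t >= x] holds if and only if [D y <= t]
    for all [y < x], and a sequence of [y] increasing to [x] suffices. *)
Lemma measurable_inverse_subordinator t : measurable_fun setT (Y t).
Proof.
apply: (measurability _ (RGenCInfty.measurableE R)) => _ [_ [x ->] <-].
rewrite setTI; have [x0|x0] := leP x 0.
  rewrite (_ : _ @^-1` _ = setT)//; apply/seteqP; split => // w _ /=.
  by rewrite in_itv/= andbT (le_trans x0)// inverse_subordinator_ge0.
pose y n : R := x * (1 - n.+1%:R^-1).
have y0 n : 0 <= y n.
  by rewrite /y mulr_ge0 ?(ltW x0)// subr_ge0 invf_le1// ler1n.
have yx n : y n < x by rewrite /y gtr_pMr// gtrBl.
rewrite (_ : _ @^-1` _ = ~` never t `&` \bigcap_n [set w | D (y n) w <= t]).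
  apply: measurableI; first exact/measurableC.
  by apply: bigcapT_measurable => n; exact: m_le.
apply/seteqP; split => w /=; rewrite in_itv/= andbT.
  move=> xY; split.
    by move=> /Y_never Y0; move: xY; rewrite Y0 leNgt x0.
  move=> n _ /=; rewrite leNgt; apply/negP => /(Y_lt (y0 n)).
  by move=> /(le_trans xY); rewrite leNgt yx.
move=> [nw H]; apply/ler_addgt0Pl => e e0.
have ex : 0 < e / x by rewrite divr_gt0.
have [n] := ltr_add_invr ex; rewrite add0r => ne.
rewrite -lerBlDl; apply: (@le_trans _ _ (y n)); last first.
  exact: (Y_ge (y0 n) (H n I) nw).
rewrite /y mulrBr mulr1 lerD2l lerN2 -ler_pdivlMl// mulrC; exact: ltW.
Qed.

Lemma inverse_subordinator_tail_le t x y : 0 <= y -> y < x ->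
  (P [set w | (x <= Y t w)%R] <= P [set w | (D y w <= t)%R])%E.
Proof.
move=> y0 yx; apply: le_measure; rewrite ?inE.
- rewrite -[X in measurable X]setTI; apply: measurable_fun_le => //.
  exact: measurable_inverse_subordinator.
- exact: m_le.
move=> w /= xY; rewrite leNgt; apply/negP => /(Y_lt y0) /(le_trans xY).
by rewrite leNgt yx.
Qed.

Lemma le_inverse_subordinator_tail t x : 0 <= x ->
  (P [set w | (D x w <= t)%R] <= P [set w | (x <= Y t w)%R])%E.
Proof.
move=> x0.
have mY : measurable [set w | (x <= Y t w)%R].
  rewrite -[X in measurable X]setTI; apply: measurable_fun_le => //.
  exact: measurable_inverse_subordinator.
apply: (@le_trans _ _ (P ([set w | (x <= Y t w)%R] `|` never t))).
  apply: le_measure; rewrite ?inE; [exact: m_le|exact: measurableU|].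
  by move=> w /= Dx; have [nw|nw] := pselect (never t w); [right|left; exact: Y_ge].
apply: le_trans (measureU2 _ mY (m_never t)) _.
by rewrite [X in (_ + X)%E](never0 t) adde0.
Qed.

End inverse_stable.

Section inverse_stable_density.
Context (R : realType) d (T : measurableType d) (P : probability T R)
  (b : R) (b0 : 0 < b) (b1 : b < 1) (D : R -> T -> R)
  (hD : is_stable_subordinator P b D).

Let F := rvcdf P (D 1).
Let Y := inverse_subordinator D.

Context (p : R -> R) (dF : forall x : R, 0 < x -> is_derive x 1 F (p x)).

Lemma is_derive_tail (t u : R) : 0 < t -> 0 < u ->
  is_derive u 1 (fun u => F (t * u `^ (- b^-1))) (- inverse_density b p t u).
Proof.
move=> t0 u0.
have x0 : 0 < t * u `^ (- b^-1) by rewrite mulr_gt0 ?powR_gt0.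
have d1 : is_derive u 1 (fun u => u `^ (- b^-1)) (- b^-1 * u `^ (- b^-1 - 1)).
  exact: is_derive1_powR.
have d2 : is_derive u 1 (fun u => t * u `^ (- b^-1)) (t * (- b^-1 * u `^ (- b^-1 - 1))).
  exact: is_deriveZ.
have d3 := @is_derive1_comp R F (fun u => t * u `^ (- b^-1)) u _ _ (dF x0) d2.
apply: (is_derive_eq d3); rewrite /inverse_density.
rewrite powRB ?(gt_eqF u0) ?implybT// powRr1 ?(ltW u0)//.
by field; rewrite !gt_eqF.
Qed.

(** The tail lies between [P (D u <= t)] and the left limit of [P (D y <= t)] at
    [y = u]; these agree since [F] is continuous. *)
Lemma inverse_subordinator_tail t u : 0 < t -> 0 < u ->
  P [set w | (u <= Y t w)%R] = (F (t * u `^ (- b^-1)))%:E.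
Proof.
move=> t0 u0; apply/eqP; rewrite eq_le; apply/andP; split; last first.
  rewrite -(stable_scaling b0 hD t u0).
  exact: (le_inverse_subordinator_tail b0 hD t (ltW u0)).
set m := P _; have mfin : m \is a fin_num.
  rewrite fin_num_measure// -[X in measurable X]setTI; apply: measurable_fun_le => //.
  exact: (measurable_inverse_subordinator hD).
rewrite -(fineK mfin) lee_fin.
have c : F (t * y `^ (- b^-1)) @[y --> u^'-] --> F (t * u `^ (- b^-1)).
  apply: cvg_at_left_filter; apply: derivable_cvg.
  by have h := is_derive_tail t0 u0; exact: ex_derive.
apply: (cvgr_to_ge c).
near=> y.
have y0 : 0 < y by near: y; exact: nbhs_left_gt.
have yu : y < u by near: y; exact: nbhs_left_lt.
rewrite -lee_fin (fineK mfin) -(stable_scaling b0 hD t y0).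
exact: (inverse_subordinator_tail_le hD t (ltW y0) yu).
Unshelve. all: by end_near. Qed.

(** Integrals of [f] over half-lines are [1 - F (t u^(-1/b))], and almost every
    point is a point at which the integral of [f] has derivative [f]. *)
Lemma inverse_density_ae t (f : R -> R) : 0 < t -> is_density P (Y t) f ->
  {ae @lebesgue_measure R, forall u, 0 < u -> f u = inverse_density b p t u}.
Proof.
move=> t0 hf.
pose f' := f \_ `[0%R, +oo[.
have mf' : measurable_fun [set: R] f'.
  apply/(measurable_restrictT _ _).1; first exact: measurable_itv.
  exact: (density_measurable hf).
have f'0 x : 0 <= f' x.
  rewrite /f' patchE; case: ifPn => //; rewrite inE/= in_itv/= andbT.
  exact: (density_ge0 hf).
have Pf A : measurable A -> P (Y t @^-1` A) = (\int[@lebesgue_measure R]_(x in A) (f' x)%:E)%E.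
  move=> mA; rewrite (density_prob hf mA) [LHS]integral_mkcond [RHS]integral_mkcond.
  apply: eq_integral => x _; rewrite !patchE in_setI.
  by case: (x \in A) => //=; rewrite /f' patchE; case: ifPn.
have mY A : measurable A -> measurable (Y t @^-1` A).
  move=> mA; rewrite -[X in measurable X]setTI.
  exact: (measurable_inverse_subordinator hD t measurableT mA).
have if' : (@lebesgue_measure R).-integrable setT (EFin \o f').
  apply/integrableP; split; first exact/measurable_EFinP.
  rewrite (_ : (fun x => _) = (fun x => (f' x)%:E)); last first.
    by apply/funext => x /=; rewrite ger0_norm.
  rewrite -Pf//; apply: le_lt_trans (probability_le1 P _) _; last exact: ltry.
  exact: mY.
have lif' : locally_integrable [set: R] f'.
  apply: open_integrable_locally => //; exact: openT.
have ify y : (@lebesgue_measure R).-integrable `]-oo, y] (EFin \o f').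
  by apply: integrableS if'.
have GE y : 0 < y -> \int[@lebesgue_measure R]_(x in `]-oo, y]) f' x = 1 - F (t * y `^ (- b^-1)).
  move=> y0; rewrite /Rintegral -Pf//.
  have E1 : P (Y t @^-1` `[y, +oo[) = (F (t * y `^ (- b^-1)))%:E.
    rewrite -inverse_subordinator_tail//; congr (P _).
    by apply/seteqP; split => w /=; rewrite in_itv/= andbT.
  have E2 : P (Y t @^-1` `]y, +oo[) = P (Y t @^-1` `[y, +oo[).
    rewrite !Pf// integral_itv_obnd_cbnd//.
    by apply: measurable_funTS; exact/measurable_EFinP.
  have -> : Y t @^-1` `]-oo, y] = ~` (Y t @^-1` `]y, +oo[).
    by apply/seteqP; split => w /=; rewrite !in_itv/= andbT leNgt => /negP.
  by rewrite probability_setC; [rewrite E2 E1|exact: mY].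
have := FTC1Ny ify lif'.
apply: filterS; first exact: (ae_filter_ringOfSetsType (@lebesgue_measure R)).
move=> y [dG Gd] y0.
have dd := is_derive_tail t0 y0.
have nE : {near y, (fun y => \int[@lebesgue_measure R]_(x in `]-oo, y]) f' x) =1
   (fun y => 1 - F (t * y `^ (- b^-1)))}.
  by near=> z; apply: GE; near: z; exact: lt_nbhsr.
have -> : f y = f' y by rewrite /f' patchE mem_set//= in_itv/= (ltW y0).
rewrite -Gd derive1E (near_eq_derive _ nE)//.
have d2 : is_derive y 1 (fun y => 1 - F (t * y `^ (- b^-1))) (0 - - inverse_density b p t y).
  exact: is_deriveB.
by rewrite derive_val sub0r opprK.
Unshelve. all: by end_near. Qed.

End inverse_stable_density.

(** * Integration of a right derivative *)

(** A form of the Vitali-Caratheodory theorem. The interval is cut into the level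
    sets on which [f] varies by at most [eta]; each is enlarged to an open set of
    nearly the same measure, and [w] adds up the upper levels over these open sets.
    The enlargement is what makes [w] dominate [f x] in a neighbourhood of [x]. *)
Lemma locally_bounded_majorant (R : realType) (a b eta e : R) (f : R -> R) :
  a <= b -> 0 < eta -> 0 < e ->
  measurable_fun (`[a, b] : set R) f -> (forall x, a <= x <= b -> 0 <= f x) ->
  exists w : R -> \bar R, [/\ measurable_fun [set: R] w, forall x, (0 <= w x)%E,
   (\int[@lebesgue_measure R]_(x in `[a, b]) w x <=
    \int[@lebesgue_measure R]_(x in `[a, b]) (f x)%:E + (eta * (b - a) + e)%:E)%E &
   forall x, a <= x <= b -> exists c r, [/\ 0 < r, f x <= c &
     forall y, `|y - x| < r -> (c%:E <= w y)%E]].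
Proof.
move=> ab eta0 e0 mf f0.
pose c (i : nat) : R := i.+1%:R * eta.
have c0 i : 0 < c i by rewrite mulr_gt0.
pose E (i : nat) : set R := `[a, b]%classic `&` f @^-1` `[i%:R * eta, i.+1%:R * eta[%classic.
have mE i : measurable (E i) by apply: mf => //; exact: measurable_itv.
have muab : @lebesgue_measure R `[a, b]%classic = (b - a)%:E.
  rewrite lebesgue_measure_itv/= lte_fin; case: ltP => [_|ba]; first by rewrite -EFinB.
  by have -> : a = b; [apply/eqP; rewrite eq_le ab|rewrite subrr].
have muE i : (@lebesgue_measure R (E i) < +oo)%E.
  apply: (@le_lt_trans _ _ (@lebesgue_measure R `[a, b]%classic)); last by rewrite muab ltry.
  by apply: le_measure; rewrite ?inE//; [exact: mE|exact: subIsetl].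
(* The errors [c i * ei i] add up to [e]. *)
pose ei (i : nat) : R := e / (2 ^ i.+1)%:R / c i.
have ei0 i : 0 < ei i by rewrite divr_gt0// divr_gt0// ltr0n expn_gt0.
have /choice[V HV] : forall i, exists V : set R, [/\ open V, E i `<=` V &
    (@lebesgue_measure R (V `\` E i) < (ei i)%:E)%E].
  move=> i; have [V [oV EV ei_]] := lebesgue_regularity_outer (mE i) (muE i) (ei0 i).
  by exists V; split.
have mV i : measurable (V i) by have [oV _ _] := HV i; exact: open_measurable.
pose w x := (\sum_(0 <= i <oo) (c i * \1_(V i) x)%:E)%E.
have t0 (S : set R) i x : (0 <= (c i * \1_S x)%:E)%E.
  by rewrite lee_fin mulr_ge0 ?(ltW (c0 i))// indicE.
have mt (S : nat -> set (measurableTypeR R)) i : measurable (S i) ->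
    measurable_fun [set: R] (fun x => (c i * \1_(S i) x)%:E).
  by move=> mS; apply/measurable_EFinP; apply: measurable_funM.
exists w; split.
- by apply: ge0_emeasurable_sum => [i x _ _|i _]; [exact: t0 | exact: (mt V i (mV i))].
- by move=> x; apply: nneseries_ge0.
- rewrite /w integral_nneseries//; last by move=> i; apply: measurable_funTS; exact: (mt V i (mV i)).
  have intI (S : nat -> set (measurableTypeR R)) i : measurable (S i) ->
     (\int[@lebesgue_measure R]_(x in `[a, b]) (c i * \1_(S i) x)%:E =
      (c i)%:E * @lebesgue_measure R (S i `&` `[a, b]))%E.
    move=> mS; under eq_integral do rewrite EFinM.
    rewrite ge0_integralZl//; last 2 first.
    + by apply: measurable_funTS; exact/measurable_EFinP.
    + by rewrite lee_fin ltW.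
    by rewrite integral_indic.
  apply: (@le_trans _ _ (\sum_(0 <= i <oo) ((c i)%:E * @lebesgue_measure R (E i) + (e / (2 ^ i.+1)%:R)%:E))%E).
    apply: lee_nneseries.
      by move=> i _ _; apply: integral_ge0 => x _; exact: t0.
    move=> i _; rewrite (intI V i (mV i)).
    apply: (@le_trans _ _ ((c i)%:E * (@lebesgue_measure R (E i) + (ei i)%:E))%E).
      rewrite lee_wpmul2l ?lee_fin ?(ltW (c0 i))//.
      have [_ EV Vei] := HV i.
      apply: (@le_trans _ _ (@lebesgue_measure R (E i `|` (V i `\` E i)))).
        apply: le_measure; rewrite ?inE.
        * exact: measurableI (mV i) (measurable_itv _).
        * exact: measurableU (mE i) (measurableD (mV i) (mE i)).
        * move=> x [Vx _]; have [Ex|nEx] := pselect (E i x); [by left|by right].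
      apply: (le_trans (measureU2 (@lebesgue_measure R) (mE i) (measurableD (mV i) (mE i)))).
      by rewrite leeD2l// ltW.
    rewrite muleDr//; last by rewrite fin_num_adde_defl.
    rewrite leeD2l// -EFinM lee_fin /ei le_eqVlt; apply/orP; left; apply/eqP.
    by rewrite mulrC divfK// gt_eqF.
  apply: le_trans (epsilon_trick _ _ (ltW e0)) _.
    by move=> i; rewrite mule_ge0// lee_fin ltW.
  rewrite EFinD addeA leeD2r//.
  have -> : (\sum_(0 <= i <oo) ((c i)%:E * @lebesgue_measure R (E i)) =
     \int[@lebesgue_measure R]_(x in `[a, b]) \sum_(0 <= i <oo) (c i * \1_(E i) x)%:E)%E.
    rewrite integral_nneseries//; last by move=> i; apply: measurable_funTS; exact: (mt E i (mE i)).
    apply: eq_eseriesr => i _; rewrite (intI E i (mE i)).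
    by congr (_ * _)%E; congr (_ _); apply/esym/setIidPl; exact: subIsetl.
  apply: (@le_trans _ _ (\int[@lebesgue_measure R]_(x in `[a, b]) ((f x)%:E + eta%:E))%E); last first.
    rewrite ge0_integralD//; last 2 first.
    + exact/measurable_EFinP.
    + by move=> x _; rewrite lee_fin ltW.
    apply: leeD; first exact: lexx.
    rewrite integral_cst//=.
    by rewrite muab -EFinM.
  apply: ge0_le_integral => //.
  + by move=> x _; apply: nneseries_ge0.
  + by apply: measurable_funTS; apply: ge0_emeasurable_sum => [i x _ _|i _]; [exact: t0 | exact: (mt E i (mE i))].
  + by apply: emeasurable_funD => //; exact/measurable_EFinP.
  + move=> x /=; rewrite in_itv/= => abx.
    pose n := Num.truncn (f x / eta).
    have fn : n%:R * eta <= f x by rewrite -ler_pdivlMr// truncn_le divr_ge0 ?f0// ltW.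
    have fn1 : f x < n.+1%:R * eta by rewrite -ltr_pdivrMr// truncnS_gt.
    rewrite (@nneseriesD1 _ _ n)//.
    rewrite eseries0 ?adde0; last first.
      move=> i _ /= ni; rewrite indicE memNset ?mulr0// => -[_ /=]; rewrite in_itv/= => /andP[i1 i2].
      move/eqP: ni; apply; apply/eqP; rewrite eqn_leq.
      rewrite -ltnS -(ltr_nat R) -(ltr_pM2r eta0) (le_lt_trans i1 fn1)/=.
      by rewrite -ltnS -(ltr_nat R) -(ltr_pM2r eta0) (le_lt_trans fn i2).
    rewrite indicE mem_set/= ?mulr1; last by split => //=; rewrite in_itv/= fn fn1.
    by rewrite -EFinD lee_fin /c -natr1 mulrDl mul1r lerD2r.
- move=> x abx.
  pose n := Num.truncn (f x / eta).
  have fn : n%:R * eta <= f x by rewrite -ler_pdivlMr// truncn_le divr_ge0 ?f0// ltW.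
  have fn1 : f x < n.+1%:R * eta by rewrite -ltr_pdivrMr// truncnS_gt.
  have [oV EV _] := HV n.
  have Vx : V n x by apply: EV; split => //=; rewrite in_itv/= fn fn1.
  have := open_nbhs_nbhs (conj oV Vx); move=> /nbhs_ballP[r /= r0 rV].
  exists (c n), r; split => //; first exact: ltW.
  move=> y yx; rewrite /w (@nneseriesD1 _ _ n)//.
  rewrite indicE mem_set ?mulr1; last by apply: rV; rewrite /ball/= distrC.
  by rewrite leeDl//; apply: nneseries_ge0.
Qed.

(** If the bound failed at [b], consider the infimum [s] of the points where it
    fails. Left continuity of [A] shows that it holds at [s], and the local control
    of the increments propagates it to the right of [s]. *)
Lemma le_integral_majorant (R : realType) (a b eta : R) (A : R -> R) (w : R -> \bar R) :
  a <= b -> 0 < eta ->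
  measurable_fun [set: R] w -> (forall x, (0 <= w x)%E) ->
  (forall x : R, a < x <= b -> A y @[y --> x^'-] --> A x) ->
  (forall x, a <= x < b -> exists c r, 0 < r /\
     forall y, x < y -> y < x + r -> (c%:E <= w y)%E /\ A y - A x <= (c + eta) * (y - x)) ->
  ((A b - A a)%:E <= \int[@lebesgue_measure R]_(x in `[a, b]) w x + (eta * (b - a))%:E)%E.
Proof.
move=> ab eta0 mw w0 Al Ar.
pose I y := (\int[@lebesgue_measure R]_(x in `[a, y]) w x)%E.
pose G y := ((A y - A a)%:E <= I y + (eta * (y - a))%:E)%E.
have mwD D : measurable_fun D w by exact: measurable_funTS.
have Imon s y : s <= y -> (I s <= I y)%E.
  move=> sy; apply: ge0_subset_integral => //; [exact: mwD|].
  by move=> x /=; rewrite !in_itv/= => /andP[-> xs]; exact: le_trans xs sy.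
have [//|nGb] := pselect (G b).
pose S := [set y | a <= y <= b /\ ~ G y].
have Sb : S b by split; rewrite ?ab ?lexx.
have lS : has_inf S by split; [exists b | exists a => y [/andP[]]].
pose s := inf S.
have as_ : a <= s by apply: lb_le_inf; [exists b | move=> y [/andP[]]].
have sb : s <= b by apply: ge_inf => //; case: lS.
have below y : a <= y -> y < s -> G y.
  move=> ay ys; apply: contrapT => nG.
  suff : s <= y by rewrite leNgt ys.
  apply: ge_inf; first by case: lS.
  by split => //; rewrite ay (le_trans (ltW ys) sb).
have Gs : G s.
  have [->|] := eqVneq s a.
    by rewrite /G !subrr mulr0 adde0; apply: integral_ge0 => x _; exact: w0.
  move=> sa; have {as_ sa}as_ : a < s by rewrite lt_neqAle eq_sym sa.
  rewrite /G; case E : (I s) => [r| |]; last 2 first.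
  - by rewrite addye// leey.
  - have : (0 <= I s)%E by apply: integral_ge0 => x _; exact: w0.
    by rewrite E.
  rewrite -EFinD lee_fin lerBlDr.
  apply: (cvgr_to_le (Al s _)); first by rewrite as_.
  near=> y.
  have ay : a < y by near: y; exact: nbhs_left_gt.
  have ys : y < s by near: y; exact: nbhs_left_lt.
  have := below y (ltW ay) ys; rewrite /G.
  move=> /le_trans/(_ (leeD2r _ (Imon _ _ (ltW ys)))); rewrite E -EFinD lee_fin lerBlDr.
  move=> /le_trans; apply; rewrite lerD2r lerD2l ler_pM2l//.
  by rewrite lerD2r ltW.
have {}sb : s < b.
  by rewrite lt_neqAle sb andbT; apply/eqP => sb'; apply: nGb; rewrite -sb'.
have [c [r [r0 cr]]] := Ar s (introT andP (conj as_ sb)).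
have [y [/andP[ay yb] nGy] ysr] := inf_adherent r0 lS.
have sy : s < y.
  rewrite lt_neqAle; apply/andP; split.
    by apply/eqP => sy; apply: nGy; rewrite -sy.
  by apply: ge_inf; [case: lS | split; rewrite ?ay].
exfalso; apply: nGy; rewrite /G.
have [_ Ays] := cr y sy ysr.
have -> : I y = (I s + \int[@lebesgue_measure R]_(x in `]s, y]) w x)%E.
  rewrite /I -ge0_integral_setU//; [|exact: mwD|].
  - congr (integral _ _ _); rewrite -itv_bndbnd_setU ?bnd_simp//.
    exact: ltW.
  - apply/disj_setPS => x [] /=.
    by rewrite !in_itv/= => /andP[_ xs] /andP[sx _]; move: (lt_le_trans sx xs); rewrite ltxx.
have cint : ((c * (y - s))%:E <= \int[@lebesgue_measure R]_(x in `]s, y]) w x)%E.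
  have [c0|c0] := leP c 0.
    apply: (@le_trans _ _ 0%E); first by rewrite lee_fin mulr_le0_ge0// subr_ge0 ltW.
    by apply: integral_ge0 => x _; exact: w0.
  apply: (@le_trans _ _ (\int[@lebesgue_measure R]_(x in `]s, y]) c%:E)%E).
    rewrite integral_cst//= lebesgue_measure_itv/= lte_fin sy -EFinB.
    by rewrite -EFinM.
  apply: ge0_le_integral => //.
  - by move=> x _; rewrite lee_fin ltW.
  - exact: mwD.
  - move=> x /=; rewrite in_itv/= => /andP[sx xy].
    by have [] := cr x sx (le_lt_trans xy ysr).
have -> : A y - A a = (A s - A a) + (A y - A s) by ring.
have -> : eta * (y - a) = eta * (s - a) + eta * (y - s) by ring.
rewrite EFinD [(eta * (s - a) + _)%:E]EFinD addeACA.
apply: leeD => //.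
apply: (@le_trans _ _ ((c * (y - s))%:E + (eta * (y - s))%:E)%E).
  by rewrite -EFinD lee_fin -mulrDl.
by rewrite leeD2r.
Unshelve. all: by end_near.
Qed.

Lemma le_integral_right_derivative_ge0 (R : realType) (a b : R) (A f : R -> R) :
  a <= b -> measurable_fun (`[a, b] : set R) f ->
  (forall x, a <= x <= b -> 0 <= f x) ->
  (forall x : R, a < x <= b -> A y @[y --> x^'-] --> A x) ->
  (forall x, a <= x < b -> forall e, 0 < e -> exists2 r, 0 < r &
     forall y, x < y -> y < x + r -> A y - A x <= (f x + e) * (y - x)) ->
  ((A b - A a)%:E <= \int[@lebesgue_measure R]_(x in `[a, b]) (f x)%:E)%E.
Proof.
move=> ab mf f0 Al Ar; apply/lee_addgt0Pr => e e0.
(* Half of [e] pays for the open enlargements; [eta (b - a)] is paid twice, for the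
   width of the levels and for the slack in the right derivative. *)
pose eta := e / 2 / (2 * (b - a) + 1).
have ba : 0 <= b - a by rewrite subr_ge0.
have den : 0 < 2 * (b - a) + 1 by rewrite ltr_wpDl// mulr_ge0.
have e20 : 0 < e / 2 by rewrite divr_gt0.
have eta0 : 0 < eta by rewrite divr_gt0.
have [w [mw w0 wf wc]] := locally_bounded_majorant ab eta0 e20 mf f0.
apply: (@le_trans _ _ (\int[@lebesgue_measure R]_(x in `[a, b]) w x + (eta * (b - a))%:E)%E).
  apply: le_integral_majorant => // x /andP[ax xb].
  have [c [r [r0 fc cw]]] := wc x (introT andP (conj ax (ltW xb))).
  have [r' r'0 Axy] := Ar x (introT andP (conj ax xb)) _ eta0.
  exists c, (Num.min r r'); split; first by rewrite lt_min r0.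
  move=> y xy yr; split.
    apply: cw; rewrite gtr0_norm ?subr_gt0// ltrBlDl (lt_le_trans yr)// lerD2l.
    by rewrite ge_min lexx.
  apply: le_trans (Axy y xy _) _.
    by apply: (lt_le_trans yr); rewrite lerD2l ge_min lexx orbT.
  by rewrite ler_wpM2r ?subr_ge0 ?(ltW xy)// lerD2r.
apply: le_trans (leeD2r _ wf) _; rewrite -addeA -EFinD leeD2l// lee_fin.
have -> : eta * (b - a) + e / 2 + eta * (b - a) = eta * (2 * (b - a)) + e / 2 by ring.
have ee : e = eta * (2 * (b - a) + 1) + e / 2 by rewrite /eta divfK ?gt_eqF// -splitr.
by rewrite [leRHS]ee lerD2r ler_wpM2l ?(ltW eta0)// lerDl.
Qed.

(** The previous lemma applies to [A x + N x] once [f] is truncated below at [- N];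
    then [N] tends to infinity. *)
Lemma le_integral_right_derivative (R : realType) (a b : R) (A f : R -> R) :
  a <= b -> (@lebesgue_measure R).-integrable `[a, b] (EFin \o f) ->
  (forall x : R, a < x <= b -> A y @[y --> x^'-] --> A x) ->
  (forall x, a <= x < b -> forall e, 0 < e -> exists2 r, 0 < r &
     forall y, x < y -> y < x + r -> A y - A x <= (f x + e) * (y - x)) ->
  ((A b - A a)%:E <= \int[@lebesgue_measure R]_(x in `[a, b]) (f x)%:E)%E.
Proof.
move=> ab intf Al Ar.
have mf : measurable_fun (`[a, b] : set R) f.
  by apply/measurable_EFinP; exact: measurable_int intf.
pose g (N : nat) x := Num.max (f x) (- N%:R).
have mg N : measurable_fun (`[a, b] : set R) (g N) by exact: measurable_maxr.
have gf N x : `|g N x| <= `|f x|.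
  rewrite /g; case: (leP (f x) (- N%:R)) => // fN.
  have fx0 : f x <= 0 by rewrite (le_trans fN)// oppr_le0.
  by rewrite normrN ger0_norm// ler0_norm// lerNr.
have intg N : (@lebesgue_measure R).-integrable `[a, b] (EFin \o g N).
  apply: le_integrable intf => //; first by apply/measurable_EFinP; exact: mg.
  by move=> x _; rewrite /= lee_fin.
have ba : 0 <= b - a by rewrite subr_ge0.
have muab : @lebesgue_measure R `[a, b]%classic = (b - a)%:E.
  rewrite lebesgue_measure_itv/= lte_fin; case: ltP => [_|ba']; first by rewrite -EFinB.
  by have -> : a = b; [apply/eqP; rewrite eq_le ab|rewrite subrr].
have icst (N : nat) : (@lebesgue_measure R).-integrable `[a, b] (EFin \o (fun=> N%:R : R)).
  apply: measurable_bounded_integrable => //; last exact: bounded_cst.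
  by rewrite [ltLHS]muab ltry.
have bound N : ((A b - A a)%:E <= \int[@lebesgue_measure R]_(x in `[a, b]) (g N x)%:E)%E.
  have := @le_integral_right_derivative_ge0 _ a b (fun x => A x + N%:R * x) (fun x => g N x + N%:R) ab.
  have -> : (fun x => A x + N%:R * x) b - (fun x => A x + N%:R * x) a = A b - A a + N%:R * (b - a).
    by rewrite /=; ring.
  rewrite (_ : (fun x => (g N x + N%:R)%:E) = (EFin \o g N) \+ (EFin \o (fun=> N%:R : R)))%E//.
  rewrite integralD//= integral_cst//= muab -EFinM EFinD leeD2rE//.
  apply.
  - by apply: measurable_funD.
  - by move=> x _; rewrite -lerBlDr sub0r le_max lexx orbT.
  - move=> x xab; apply: cvgD; first exact: Al.
    apply: cvgM; first exact: cvg_cst.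
    exact/cvg_at_left_filter/cvg_id.
  - move=> x xab e e0; have [r r0 Axy] := Ar x xab e e0.
    exists r => // y xy yr.
    have -> : A y + N%:R * y - (A x + N%:R * x) = A y - A x + N%:R * (y - x) by ring.
    apply: (@le_trans _ _ ((f x + e) * (y - x) + N%:R * (y - x))).
      by rewrite lerD2r; exact: Axy.
    rewrite -mulrDl ler_wpM2r ?subr_ge0 ?(ltW xy)//.
    by rewrite addrAC lerD2r lerD2r le_max lexx.
have cvgI : (\int[@lebesgue_measure R]_(x in `[a, b]) (g N x)%:E @[N --> \oo] -->
   \int[@lebesgue_measure R]_(x in `[a, b]) (f x)%:E)%E.
  apply: (@dominated_cvg _ _ _ (@lebesgue_measure R) _ _ _ _ (fun x => `|f x|%:E)%E) => //.
  - by move=> n; apply/measurable_EFinP; exact: mg.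
  - move=> x _; apply: cvg_near_cst; near=> N.
    congr EFin; apply/max_idPl; rewrite lerNl.
    near: N; exact: nbhs_infty_ger.
  - by have := integrable_abse intf; apply: eq_integrable.
  - by move=> n x _; rewrite /= lee_fin.
apply: (cvge_to_ge cvgI); near=> N; exact: bound.
Unshelve. all: by end_near.
Qed.

(** A fundamental theorem of calculus for functions that are known only to have a
    right derivative, without exceptional points (a null set of these would let the
    Cantor function in), and without any continuity of this derivative. *)
Lemma integral_right_derivative (R : realType) (a b : R) (A f : R -> R) :
  a <= b -> (@lebesgue_measure R).-integrable `[a, b] (EFin \o f) ->
  (forall x : R, a < x <= b -> A y @[y --> x^'-] --> A x) ->
  (forall x : R, a <= x < b ->
     h^-1 * (A (x + h) - A x) @[h --> 0^'+] --> f x) ->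
  (\int[@lebesgue_measure R]_(x in `[a, b]) (f x)%:E)%E = (A b - A a)%:E.
Proof.
move=> ab intf Al Ar.
have key (A' f' : R -> R) :
    (forall x : R, a <= x < b -> h^-1 * (A' (x + h) - A' x) @[h --> 0^'+] --> f' x) ->
    forall x, a <= x < b -> forall e, 0 < e -> exists2 r, 0 < r &
     forall y, x < y -> y < x + r -> A' y - A' x <= (f' x + e) * (y - x).
  move=> Ar' x xab e e0.
  have /cvgr_lt/(_ (f' x + e)) := Ar' x xab.
  rewrite ltrDl => /(_ e0) [r /= r0 rP]; exists r => // y xy yr.
  have := rP (y - x); rewrite /= sub0r normrN gtr0_norm ?subr_gt0// ltrBlDl => /(_ yr xy).
  by rewrite [x + _]addrC subrK mulrC ltr_pdivrMr ?subr_gt0// => /ltW.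
apply/eqP; rewrite eq_le; apply/andP; split; last first.
  by apply: le_integral_right_derivative => //; exact: key.
rewrite -leeN2 -integralN/=; last exact: integrable_add_def.
have -> : (- (A b - A a))%R = - A b - - A a by ring.
apply: (@le_integral_right_derivative _ a b (fun x => - A x) (fun x => - f x)) => //.
- by have := integrableN intf; apply: eq_integrable.
- by move=> x xab; apply: cvgN; exact: Al.
- apply: key => x xab.
  rewrite (_ : (fun h => _) = (fun h => - (h^-1 * (A (x + h) - A x)))); last first.
    by apply/funext => h; ring.
  by apply: cvgN; exact: Ar.
Qed.

(** * Increments of the counting process *)

Lemma littleo_id_cvg (R : realType) (f : R -> R) :
  f =o_ (0^'+) (fun h : R => h) -> h^-1 * f h @[h --> 0^'+] --> (0 : R).
Proof.
move=> /eqoP fo; apply/cvgr0Pnorm_le => e e0.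
have := fo e e0; apply: filter_app; near=> h => fh.
have h0 : 0 < h by near: h; exact: nbhs_right_gt.
by rewrite normrM normfV (gtr0_norm h0) mulrC ler_pdivrMr// -{2}(gtr0_norm h0).
Unshelve. all: by end_near.
Qed.

Section counting_process_increments.
Context (R : realType) (d : measure_display) (T : measurableType d).
Context (P : probability T R) (M : R -> T -> nat).
Hypothesis cM : counting_process M.
Hypothesis M0 : forall w, M 0 w = 0%N.
Hypothesis indM : independent_increments P (fun t w => (M t w)%:R).

Lemma measurable_counting_eq (t : R) n : 0 <= t -> measurable [set w | M t w = n].
Proof.
move=> t0; have := counting_measurable cM t0 measurableT (Y := [set n]).
by rewrite setTI; apply.
Qed.

Lemma measurable_increment (s t : R) : 0 <= s -> 0 <= t ->
  measurable_fun [set: T] (fun w => (M t w)%:R - (M s w)%:R : R).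
Proof.
move=> s0 t0; apply: measurable_funB.
- by apply: measurableT_comp => //; exact: counting_measurable.
- by apply: measurableT_comp => //; exact: counting_measurable.
Qed.

(** Truncated and real subtraction agree along nondecreasing paths. *)
Lemma increment_eqE n (s t : R) : 0 <= s -> s <= t ->
  [set w | (M t w - M s w)%N = n] =
  (fun w => (M t w)%:R - (M s w)%:R : R) @^-1` [set n%:R].
Proof.
move=> s0 st; apply/seteqP; split => w /=.
- by move=> <-; rewrite natrB// (counting_nondecreasing cM).
- by rewrite -natrB ?(counting_nondecreasing cM)// => /eqP; rewrite eqr_nat => /eqP.
Qed.

Lemma measurable_increment_eq n (s t : R) : 0 <= s -> s <= t ->
  measurable [set w | (M t w - M s w)%N = n].
Proof.
move=> s0 st; rewrite increment_eqE// -[X in measurable X]setTI.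
by apply: measurable_increment => //; exact: le_trans st.
Qed.

Lemma ngcp_pmf_ge0 n u v : 0 <= ngcp_pmf P M n u v.
Proof. exact: fine_ge0. Qed.

Lemma EFin_ngcp_pmf n (u v : R) : 0 <= u -> 0 <= v ->
  (ngcp_pmf P M n u v)%:E = P [set w | (M (u + v)%R w - M v w)%N = n].
Proof.
by move=> u0 v0; rewrite fineK// fin_num_measure//; apply: measurable_increment_eq;
  rewrite ?lerDr.
Qed.

Lemma ngcp_pmf_le1 n (u v : R) : 0 <= u -> 0 <= v -> ngcp_pmf P M n u v <= 1.
Proof.
move=> u0 v0; rewrite -lee_fin EFin_ngcp_pmf//; apply: probability_le1.
by apply: measurable_increment_eq; rewrite ?lerDr.
Qed.

Lemma ngcp_pmf_0 n v : ngcp_pmf P M n 0 v = (n == 0)%N%:R.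
Proof.
rewrite /ngcp_pmf add0r; have [->|n0] := eqVneq n 0%N.
- rewrite (_ : [set w | _] = setT) ?probability_setT//.
  by apply/seteqP; split => // w _ /=; rewrite subnn.
- rewrite (_ : [set w | _] = set0) ?measure0//.
  by apply/seteqP; split => // w /=; rewrite subnn => /esym/eqP; rewrite (negbTE n0).
Qed.

Lemma two_increments_indep (r s t : R) m n : 0 <= r -> r <= s -> s <= t ->
  P ([set w | (M s w - M r w)%N = m] `&` [set w | (M t w - M s w)%N = n]) =
  (P [set w | (M s w - M r w)%N = m] * P [set w | (M t w - M s w)%N = n])%E.
Proof.
move=> r0 rs st.
pose tt (i : nat) := if i is 0%N then r else if i is 1%N then s else t.
have tm i : tt i <= tt i.+1 by case: i => [|[|i]].
pose A (i : 'I_2) : set R := if i == ord0 then [set m%:R] else [set n%:R].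
have mA i : measurable (A i) by rewrite /A; case: ifP.
have := @indM 2%N tt r0 tm A mA.
rewrite 2!big_ord_recl big_ord0 mule1 /A/=.
rewrite -!increment_eqE//; last exact: le_trans rs.
move=> <-; congr (P _); apply/seteqP; split => [w [ws wt] i _|w W].
- case: i => [[|[|//]]] /= i2; rewrite ?increment_eqE//=.
  + by move: ws; rewrite increment_eqE.
  + by move: wt; rewrite increment_eqE//; exact: le_trans rs.
- split; first by rewrite increment_eqE//; exact: (W ord0).
  rewrite increment_eqE//; last exact: le_trans rs.
  exact: (W (lift ord0 ord0)).
Qed.

(** Increments over adjacent intervals are nonnegative, add up, and are
    independent. *)
Lemma ngcp_pmfD n (u v h : R) : 0 <= u -> 0 <= v -> 0 <= h ->
  ngcp_pmf P M n (u + h) v =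
  \sum_(m < n.+1) ngcp_pmf P M m u v * ngcp_pmf P M (n - m)%N h (u + v).
Proof.
move=> u0 v0 h0; apply/EFin_inj.
have uv0 : 0 <= u + v by rewrite addr_ge0.
rewrite EFin_ngcp_pmf ?addr_ge0// -sumEFin.
have e1 : h + (u + v) = u + h + v by ring.
under eq_bigr do rewrite EFinM !EFin_ngcp_pmf// e1.
have l1 : v <= u + v by rewrite lerDr.
have l2 : u + v <= u + h + v by rewrite -e1 lerDr.
under eq_bigr do rewrite -two_increments_indep//.
pose F m := [set w | (M (u + v)%R w - M v w)%N = m] `&`
            [set w | (M (u + h + v)%R w - M (u + v)%R w)%N = (n - m)%N].
have mF m : measurable (F m) by apply: measurableI; exact: measurable_increment_eq.
have tF : trivIset [set: nat] F.
  apply/trivIsetP => i j _ _ ij; apply/seteqP; split => // w [[/= wi _] [/= wj _]].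
  by move: ij; rewrite -wi -wj eqxx.
rewrite -(measure_bigsetU P mF tF n.+1) -bigcup_mkord.
congr (P _); apply/seteqP; split => w.
- move=> /= wn; exists (M (u + v) w - M v w)%N.
    by rewrite /= ltnS -wn leq_sub2r// (counting_nondecreasing cM).
  by split => //=; rewrite -wn subnBA ?(counting_nondecreasing cM)// subnK//
    (counting_nondecreasing cM)// (le_trans l1).
- move=> [m /= mn [/= wm wn]].
  rewrite -(subnKC (mn : m <= n)%N) -wn -wm.
  by rewrite addnC addnBA ?(counting_nondecreasing cM)// subnK// (counting_nondecreasing cM).
Qed.

(** Since the process starts at zero, its value is an increment, independent of
    the next one: the transition probabilities do not depend on the state. *)
Lemma cond_prob_increment (t h : R) m n : 0 <= t -> 0 <= h ->
  P [set w | M t w = m] != 0%E ->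
  cond_prob P [set w | M (t + h) w = (m + n)%N] [set w | M t w = m] =
  ngcp_pmf P M n h t.
Proof.
move=> t0 h0 Pm.
have tth : t <= t + h by rewrite lerDl.
have Em : [set w | M t w = m] = [set w | (M t w - M 0 w)%N = m].
  by apply/seteqP; split => w /=; rewrite M0 subn0.
have -> : ngcp_pmf P M n h t = fine (P [set w | (M (t + h)%R w - M t w)%N = n]).
  by rewrite /ngcp_pmf addrC.
have EI : [set w | M (t + h) w = (m + n)%N] `&` [set w | M t w = m] =
  [set w | (M t w - M 0 w)%N = m] `&` [set w | (M (t + h) w - M t w)%N = n].
  apply/seteqP; split => w /=; rewrite M0 subn0 => -[].
    by move=> -> ->; rewrite addKn.
  by move=> <- <-; rewrite subnKC// (counting_nondecreasing cM).
rewrite /cond_prob EI two_increments_indep// -Em fineM; last 2 first.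
- by rewrite fin_num_measure//; exact: measurable_counting_eq.
- by rewrite fin_num_measure//; exact: measurable_increment_eq.
rewrite mulrAC divff ?mul1r// fine_eq0//.
by rewrite fin_num_measure//; exact: measurable_counting_eq.
Qed.

Lemma ex_counting_pos (t : R) : 0 <= t -> exists m, P [set w | M t w = m] != 0%E.
Proof.
move=> t0; apply/not_existsP => H.
have : P setT = 0%E.
  rewrite (_ : setT = \bigcup_m [set w | M t w = m]); last first.
    by apply/seteqP; split => // w _; exists (M t w).
  rewrite measure_bigcup//; first by apply: eseries0 => i _ _; apply/eqP/negbNE/negP/H.
  - by move=> i _; exact: measurable_counting_eq.
  - by apply/trivIsetP => i j _ _ ij; apply/seteqP; split => // w [/= wi wj];
      move: ij; rewrite -wi -wj eqxx.
by rewrite probability_setT => /eqP; rewrite onee_eq0.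
Qed.

End counting_process_increments.

(** * Forward equations *)

Section ngcp_equations.
Context (R : realType) (d : measure_display) (T : measurableType d).
Context (P : probability T R) (k : nat) (lambda : nat -> R -> R) (M : R -> T -> nat).
Hypothesis hM : is_ngcp P k lambda M.
Let cM := ngcp_counting hM.
Let M0 := ngcp_start hM.
Let indM := ngcp_independent_increments hM.

(** The infinitesimal law of the increments, the negative weight at zero being the
    loss of mass. *)
Definition jump_rate (j : nat) (t : R) : R :=
  if j == 0%N then - \sum_(1 <= i < k.+1) lambda i t
  else if (j <= k)%N then lambda j t else 0.

(** The transition probabilities are read off from some state [m] occupied at time
    [t] with positive probability. *)
Lemma ngcp_pmf_jump_rate j (t : R) : 0 <= t ->
  h^-1 * (ngcp_pmf P M j h t - (j == 0)%N%:R) @[h --> 0^'+] --> jump_rate j t.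
Proof.
move=> t0; have [m Pm] := ex_counting_pos P cM t0.
have cE h n : 0 < h -> cond_prob P [set w | M (t + h) w = (m + n)%N] [set w | M t w = m] =
    ngcp_pmf P M n h t.
  by move=> h0; rewrite (cond_prob_increment cM M0 indM)// ltW.
have key c (f : R -> R) : (f =o_ (0^'+) (fun h : R => h)) ->
    (forall h, 0 < h -> f h = ngcp_pmf P M j h t - (j == 0)%N%:R - c * h) ->
    h^-1 * (ngcp_pmf P M j h t - (j == 0)%N%:R) @[h --> 0^'+] --> c.
  move=> /littleo_id_cvg fo fE; rewrite -[X in _ --> X]add0r.
  apply: cvg_trans (cvgD fo (cvg_cst c)); apply: near_eq_cvg; near=> h.
  have h0 : 0 < h by near: h; exact: nbhs_right_gt.
  rewrite -[LHS]/(h^-1 * f h + c) fE//.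
  by rewrite mulrBr [c * h]mulrC mulKf ?subrK// lt0r_neq0.
rewrite /jump_rate; have [j0|j0] := eqVneq j 0%N.
  have := ngcp_trans0 hM t0 Pm; move: key; rewrite j0 eqxx => /[apply]; apply => h h0.
  by have := cE h 0%N h0; rewrite addn0 => ->; rewrite [true%:R]mulr1n; ring.
case: ifP => jk.
  have := ngcp_trans_jump hM t0 Pm (introT andP (conj _ jk)); rewrite lt0n => /(_ j0).
  move: key; rewrite (negbTE j0) => /[apply]; apply => h h0.
  by rewrite cE// subr0.
have := @ngcp_trans_big _ _ _ _ _ _ _ hM t m (m + j) t0 Pm.
rewrite ltn_add2l ltnNge jk => /(_ erefl).
move: key; rewrite (negbTE j0) => /[apply]; apply => h h0.
by rewrite cE// mul0r !subr0.
Unshelve. all: by end_near.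
Qed.

Context (v : R) (v0 : 0 <= v).
Local Notation q n u := (ngcp_pmf P M n u v).

Definition forward_rhs (n : nat) (u : R) : R :=
  - (\sum_(1 <= j < k.+1) lambda j (u + v) * q n u)
  + \sum_(1 <= j < (minn n k).+1) lambda j (u + v) * q (n - j)%N u.

(** The form produced by differentiating the convolution formula [ngcp_pmfD]. *)
Lemma forward_rhsE n u :
  forward_rhs n u = \sum_(m < n.+1) q m u * jump_rate (n - m) (u + v).
Proof.
rewrite -(big_mkord xpredT (fun m => q m u * jump_rate (n - m) (u + v))).
rewrite big_nat_rev/= big_ltn//= add0n subSS subn0 subnn {1}/jump_rate eqxx /forward_rhs.
congr (_ + _).
  by rewrite mulrN mulrC mulr_suml.
rewrite [RHS](@big_cat_nat _ _ _ (minn n k).+1)//=; last by rewrite ltnS geq_minl.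
rewrite [X in _ = _ + X]big_nat [X in _ = _ + X]big1 ?addr0; last first.
  move=> j /andP[nkj jn]; rewrite ?add0n subSS subKn// /jump_rate.
  rewrite gtn_eqF; last exact: leq_ltn_trans nkj.
  rewrite ifF ?mulr0//; apply/negbTE; rewrite -ltnNge.
  by move: nkj; rewrite gtn_min ltnNge -ltnS jn.
apply: eq_big_nat => j /andP[j0]; rewrite ltnS leq_min => /andP[jn jk].
by rewrite ?add0n subSS subKn// /jump_rate gtn_eqF// jk mulrC.
Qed.

Lemma ngcp_pmf_right_derivative n (u : R) : 0 <= u ->
  h^-1 * (q n (u + h) - q n u) @[h --> 0^'+] --> forward_rhs n u.
Proof.
move=> u0; have uv0 : 0 <= u + v by rewrite addr_ge0.
rewrite forward_rhsE.
have H : \sum_(m < n.+1) q m u * (h^-1 * (ngcp_pmf P M (n - m) h (u + v) - (n - m == 0)%N%:R))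
    @[h --> 0^'+] --> \sum_(m < n.+1) q m u * jump_rate (n - m) (u + v).
  apply: cvg_big; first exact: add_continuous.
  move=> m _; apply: cvgM; first exact: cvg_cst.
  exact: ngcp_pmf_jump_rate.
apply: cvg_trans H; apply: near_eq_cvg; near=> h.
have h0 : 0 < h by near: h; exact: nbhs_right_gt.
rewrite (ngcp_pmfD cM indM)// ?ltW//.
have -> : q n u = \sum_(m < n.+1) q m u * (n - m == 0)%N%:R.
  rewrite big_ord_recr/= subnn eqxx mulr1 big1 ?add0r// => m _.
  by rewrite subn_eq0 leqNgt ltn_ord mulr0.
rewrite -sumrB mulr_sumr; apply: eq_bigr => m _.
by ring.
Unshelve. all: by end_near.
Qed.

Lemma ngcp_pmf_right_cvg n (u : R) : 0 <= u -> q n y @[y --> u^'+] --> q n u.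
Proof.
move=> u0; apply/cvgrPdist_le => e e0.
have : h * (h^-1 * (q n (u + h) - q n u)) @[h --> 0^'+] --> 0 * forward_rhs n u.
  apply: cvgM; last exact: ngcp_pmf_right_derivative.
  exact/cvg_at_right_filter/cvg_id.
rewrite mul0r => /cvgr0Pnorm_le/(_ e e0)[r /= r0 rP]; near=> y.
have uy : u < y by near: y; exact: nbhs_right_gt.
have yr : y < u + r by near: y; apply: nbhs_right_lt; rewrite ltrDl.
have := rP (y - u); rewrite /= sub0r normrN gtr0_norm ?subr_gt0// ltrBlDl => /(_ yr uy).
by rewrite mulrA divff ?mul1r ?subr_eq0 ?gt_eqF// [u + _]addrC subrK distrC.
Unshelve. all: by end_near.
Qed.

(** The two increments differ only if the process moves between [y + v] and
    [x + v]. *)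
Lemma ngcp_pmf_dist n (x y : R) : 0 <= y -> y <= x ->
  `|q n x - q n y| <= fine (P [set w | M (y + v) w <> M (x + v) w]).
Proof.
move=> y0 yx; have x0 : 0 <= x by exact: le_trans yx.
have yv0 : 0 <= y + v by rewrite addr_ge0.
have yvx : y + v <= x + v by rewrite lerD2r.
set N := [set w | _ <> _].
have mN : measurable N.
  rewrite (_ : N = ~` [set w | (M (x + v)%R w - M (y + v)%R w)%N = 0%N]).
    by apply: measurableC; exact: measurable_increment_eq.
  apply/seteqP; split => w; rewrite /N/= => H1 H2; apply: H1.
    apply/eqP; rewrite eqn_leq -[(M (x + v) w <= _)%N]subn_eq0 H2 eqxx andbT.
    by rewrite (counting_nondecreasing cM).
  by rewrite H2 subnn.
have key z1 z2 : 0 <= z1 -> 0 <= z2 ->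
    (forall w, ~ N w -> M (z1 + v) w = M (z2 + v) w) -> q n z1 <= q n z2 + fine (P N).
  move=> z10 z20 NE; rewrite -lee_fin EFinD !(EFin_ngcp_pmf P cM)// fineK ?fin_num_measure//.
  have m1 : measurable [set w | (M (z1 + v)%R w - M v w)%N = n].
    by apply: measurable_increment_eq; rewrite ?lerDr.
  have m2 : measurable [set w | (M (z2 + v)%R w - M v w)%N = n].
    by apply: measurable_increment_eq; rewrite ?lerDr.
  apply: le_trans (measureU2 P m2 mN); apply: le_measure; rewrite ?inE//.
    exact: measurableU.
  by move=> w /= <-; have [Nw|/NE ->] := pselect (N w); [right|left].
have NE w : ~ N w -> M (y + v) w = M (x + v) w by move=> /contrapT.
by rewrite ler_distl lerBlDr !key// => w /NE.
Qed.

(** This is where fixed jumps have to be excluded: right derivatives say nothing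
    about the left limits. *)
Lemma ngcp_pmf_left_cvg n (u : R) : 0 < u -> q n y @[y --> u^'-] --> q n u.
Proof.
move=> u0; have uv0 : 0 < u + v by rewrite ltr_wpDr.
apply/cvgrPdist_le => e e0.
have /fine_cvgP[_ /cvgrPdist_le/(_ e e0)] := ngcp_no_fixed_jump hM uv0.
move=> [r /= r0 rP]; near=> y.
have yu : y < u by near: y; exact: nbhs_left_lt.
have y0 : 0 < y by near: y; exact: nbhs_left_gt.
have yr : u - r < y by near: y; apply: nbhs_left_gt; rewrite ltrBlDr ltrDl.
have := rP (y + v).
rewrite /= opprD addrACA subrr addr0 gtr0_norm ?subr_gt0//.
rewrite ltrD2r ltrBlDr -ltrBlDl => /(_ yr yu).
rewrite sub0r normrN ger0_norm ?fine_ge0//; apply: le_trans.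
by apply: ngcp_pmf_dist => //; exact: ltW.
Unshelve. all: by end_near.
Qed.

End ngcp_equations.

Lemma itvcy_bigcup (R : realType) :
  (`[0, +oo[ : set R)%classic = \bigcup_(i : nat) `[0, i%:R]%classic.
Proof.
apply/seteqP; split => x.
  rewrite /= in_itv/= andbT => x0; exists (Num.truncn x).+1 => //=.
  by rewrite in_itv/= x0/= ltW// truncnS_gt.
by move=> [i _]; rewrite /= !in_itv/= => /andP[->].
Qed.

Lemma integrable_sum_nat (R : realType) d (T : measurableType d)
    (mu : {measure set T -> \bar R}) (D : set T) (m n : nat) (f : nat -> T -> R) :
  measurable D ->
  (forall j, (m <= j < n)%N -> mu.-integrable D (EFin \o f j)) ->
  mu.-integrable D (EFin \o (fun x => \sum_(m <= j < n) f j x)).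
Proof.
move=> mD fi.
have : mu.-integrable D (fun x => \sum_(m <= j < n | (m <= j < n)%N) (EFin \o f j) x)%E.
  by apply: integrable_sum.
apply: eq_integrable => // x _.
by rewrite /= sumEFin -big_nat.
Qed.

Section ngcp_integral_equations.
Context (R : realType) (d : measure_display) (T : measurableType d).
Context (P : probability T R) (k : nat) (lambda : nat -> R -> R) (M : R -> T -> nat).
Hypothesis hM : is_ngcp P k lambda M.
Let cM := ngcp_counting hM.
Context (v : R) (v0 : 0 <= v).
Local Notation q n u := (ngcp_pmf P M n u v).
Local Notation leb := (@lebesgue_measure R).

Lemma measurable_ngcp_pmf n : measurable_fun (`[0, +oo[ : set R) (fun u => q n u).
Proof.
apply: subspace_continuous_measurable_fun => //.
apply/continuous_within_itvcyP; split; last by apply: (ngcp_pmf_right_cvg hM v0); exact: lexx.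
move=> u; rewrite in_itv/= andbT => u0; apply/left_right_continuousP; split.
- exact: (ngcp_pmf_left_cvg hM v0 u0).
- exact: (ngcp_pmf_right_cvg hM v0 (ltW u0)).
Qed.

Lemma measurable_intensity j : (1 <= j <= k)%N ->
  measurable_fun (`[0, +oo[ : set R) (lambda j).
Proof.
move=> jk.
rewrite itvcy_bigcup.
apply/measurable_fun_bigcup => // i.
apply/measurable_EFinP.
exact: measurable_int (intensity_integrable (ngcp_intensities hM) jk (ler0n _ i)).
Qed.

Lemma measurable_shifted_intensity j : (1 <= j <= k)%N ->
  measurable_fun (`[0, +oo[ : set R) (fun u => lambda j (u + v)).
Proof.
move=> jk; apply: (@measurable_comp _ _ _ _ _ _ (`[0, +oo[ : set R) (lambda j)) => //.
- move=> _ [u + <-]; rewrite /= !in_itv/= !andbT => u0.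
  by rewrite addr_ge0.
- exact: measurable_intensity.
- by apply: measurable_funD.
Qed.

Lemma shifted_intensity_ge0 j (u : R) : (1 <= j <= k)%N -> 0 <= u -> 0 <= lambda j (u + v).
Proof. by move=> jk u0; rewrite (intensity_ge0 (ngcp_intensities hM))// addr_ge0. Qed.

Lemma integrable_shifted_intensity j (b : R) : (1 <= j <= k)%N -> 0 <= b ->
  leb.-integrable `[0, b] (EFin \o (fun u => lambda j (u + v))).
Proof.
move=> jk b0; have bv0 : 0 <= b + v by rewrite addr_ge0.
have sub : (`[0, b] : set R)%classic `<=` `[0, +oo[%classic.
  by move=> x; rewrite /= !in_itv/= => /andP[->].
apply/integrableP; split.
  apply/measurable_EFinP; apply: measurable_funS (measurable_shifted_intensity jk) => //.
have := intensity_integrable (ngcp_intensities hM) jk bv0.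
move=> /integrableP[mf]; apply: le_lt_trans.
set f := (EFin \o lambda j).
pose F := (fun x => `|f x|%E) \_ (`[0, b + v]%classic).
have mF : measurable_fun [set: R] F.
  by apply/(measurable_restrictT _ _).1 => //; exact: measurableT_comp.
have F0 x : (0 <= F x)%E by rewrite /F patchE; case: ifP.
have -> : (\int[leb]_(x in `[0%R, (b + v)%R]) `|f x|)%E = (\int[leb]_x F x)%E.
  by rewrite integral_mkcond.
rewrite (ge0_integral_affine v (oner_neq0 _) mF F0) normr1 mul1e.
rewrite integral_mkcond; apply: ge0_le_integral => //.
- by move=> x _; rewrite patchE; case: ifP.
- apply/(measurable_restrictT _ _).1 => //; apply: measurableT_comp => //.
  apply/measurable_EFinP; apply: measurable_funS (measurable_shifted_intensity jk) => //.
- apply: measurableT_comp => //.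
  by apply: measurable_funD => //; exact: measurable_funM.
- move=> x _; rewrite patchE; case: ifPn => // xb.
  rewrite /F patchE mem_set ?mul1r//.
  by move: xb; rewrite inE/= !in_itv/= => /andP[x0 xb]; rewrite addr_ge0//= lerD2r.
Qed.

Lemma integrable_intensity_pmf j m (b : R) : (1 <= j <= k)%N -> 0 <= b ->
  leb.-integrable `[0, b] (EFin \o (fun u => lambda j (u + v) * q m u)).
Proof.
move=> jk b0.
have sub : (`[0, b] : set R)%classic `<=` `[0, +oo[%classic.
  by move=> x; rewrite /= !in_itv/= => /andP[->].
apply: le_integrable (integrable_shifted_intensity jk b0) => //.
  apply/measurable_EFinP; apply: measurable_funM.
  - exact: measurable_funS (measurable_shifted_intensity jk).
  - exact: measurable_funS (measurable_ngcp_pmf m).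
move=> x /=; rewrite in_itv/= => /andP[x0 _].
rewrite lee_fin normrM ler_piMr// ger0_norm ?ngcp_pmf_ge0//.
exact: ngcp_pmf_le1.
Qed.

Lemma integrable_forward_rhs_itv n (b : R) : 0 <= b ->
  leb.-integrable `[0, b] (EFin \o forward_rhs P k lambda M v n).
Proof.
move=> b0.
have mb : measurable (`[0, b] : set (measurableTypeR R))%classic by [].
have I1 : leb.-integrable `[0, b] (EFin \o (fun u =>
    \sum_(1 <= j < k.+1) lambda j (u + v) * q n u)).
  by apply: integrable_sum_nat => // j jk; exact: integrable_intensity_pmf.
have I2 : leb.-integrable `[0, b] (EFin \o (fun u =>
    \sum_(1 <= j < (minn n k).+1) lambda j (u + v) * q (n - j)%N u)).
  apply: integrable_sum_nat => // j /andP[j1]; rewrite ltnS leq_min => /andP[_ jk].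
  by apply: integrable_intensity_pmf; rewrite ?j1.
by have := integrableD mb (integrableN I1) I2; apply: eq_integrable.
Qed.

Lemma integral_forward_rhs_itv n (b : R) : 0 <= b ->
  (\int[leb]_(u in `[0%R, b]) (forward_rhs P k lambda M v n u)%:E)%E =
  (q n b - (n == 0)%N%:R)%:E.
Proof.
move=> b0; rewrite -(ngcp_pmf_0 P M n v).
apply: (@integral_right_derivative _ 0 b (fun u => q n u)) => //.
- exact: integrable_forward_rhs_itv.
- by move=> x /andP[x0 _]; exact: (ngcp_pmf_left_cvg hM v0 x0).
- by move=> x /andP[x0 _]; exact: (ngcp_pmf_right_derivative hM v0 x0).
Qed.

Local Notation intensity u := (\sum_(1 <= j < k.+1) lambda j (u + v)).

Lemma intensity_sum_ge0 (u : R) : 0 <= u -> 0 <= intensity u.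
Proof.
move=> u0; rewrite big_nat; apply: sumr_ge0 => j jk.
exact: shifted_intensity_ge0.
Qed.

Lemma measurable_intensity_sum :
  measurable_fun (`[0, +oo[ : set R) (fun u => intensity u).
Proof.
rewrite (_ : (fun u => _) = (fun u => \sum_(i < k) lambda i.+1 (u + v))).
  by apply: measurable_sum => i; apply: measurable_shifted_intensity; rewrite ltn_ord.
by apply/funext => u; rewrite big_add1 big_mkord.
Qed.

Lemma le_intensity_sum j (u : R) : 0 <= u -> (1 <= j <= k)%N ->
  lambda j (u + v) <= intensity u.
Proof.
move=> u0 jk; rewrite (bigD1_seq j) ?iota_uniq ?mem_index_iota//=.
rewrite lerDl big_seq_cond; apply: sumr_ge0 => i /andP[]; rewrite mem_index_iota => ik _.
exact: shifted_intensity_ge0.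
Qed.

(** By the integrated forward equation, the mass leaving state [n] during [0, b] is
    the mass entering it minus the variation of [q n], so it exceeds the mass
    entering by at most one. The latter comes from lower states, whose total
    outflow is finite by induction. *)
Lemma integrable_intensity_sum_pmf n :
  leb.-integrable `[0, +oo[ (EFin \o (fun u => intensity u * q n u)).
Proof.
elim/ltn_ind: n => n IH.
pose S u := \sum_(1 <= j < (minn n k).+1) lambda j (u + v) * q (n - j)%N u.
pose S' u := \sum_(1 <= j < (minn n k).+1) intensity u * q (n - j)%N u.
have D0 : measurable (`[0, +oo[ : set (measurableTypeR R))%classic by [].
have sub b : (`[0, b] : set R)%classic `<=` `[0, +oo[%classic.
  by move=> x; rewrite /= !in_itv/= => /andP[->].
have iS' : leb.-integrable `[0, +oo[ (EFin \o S').
  apply: integrable_sum_nat => // j /andP[j1]; rewrite ltnS leq_min => /andP[jn _].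
  by apply: IH; rewrite ltn_subrL j1 (leq_trans j1).
have S'0 u : 0 <= u -> 0 <= S' u.
  by move=> u0; apply: sumr_ge0 => j _; rewrite mulr_ge0 ?intensity_sum_ge0 ?ngcp_pmf_ge0.
have SS' u : 0 <= u -> S u <= S' u.
  move=> u0; rewrite /S /S' big_nat [leRHS]big_nat; apply: ler_sum => j /andP[j1].
  rewrite ltnS leq_min => /andP[_ jk].
  by rewrite ler_wpM2r ?ngcp_pmf_ge0// le_intensity_sum// j1.
have f0 u : 0 <= u -> 0 <= intensity u * q n u.
  by move=> u0; rewrite mulr_ge0 ?intensity_sum_ge0 ?ngcp_pmf_ge0.
have mf : measurable_fun (`[0, +oo[ : set R) (fun u => intensity u * q n u).
  by apply: measurable_funM; [exact: measurable_intensity_sum|exact: measurable_ngcp_pmf].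
have bound (b : R) : 0 <= b ->
   (\int[leb]_(u in `[0%R, b]) (intensity u * q n u)%:E <=
    \int[leb]_(u in `[0%R, +oo[) (S' u)%:E + 1)%E.
  move=> b0.
  have mb : measurable (`[0, b] : set (measurableTypeR R))%classic by [].
  have iq : leb.-integrable `[0, b] (EFin \o (fun u => intensity u * q n u)).
    have : leb.-integrable `[0, b] (EFin \o (fun u =>
        \sum_(1 <= j < k.+1) lambda j (u + v) * q n u)).
      by apply: integrable_sum_nat => // j jk; exact: integrable_intensity_pmf.
    by apply: eq_integrable => // u _; rewrite /= mulr_suml.
  have iS'b : leb.-integrable `[0, b] (EFin \o S') by exact: integrableS iS'.
  have ig := integrable_forward_rhs_itv n b0.
  have : (\int[leb]_(u in `[0%R, b]) ((intensity u * q n u)%:E + (forward_rhs P k lambda M v n u)%:E)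
     <= \int[leb]_(u in `[0%R, b]) (S' u)%:E)%E.
    apply: le_integral => //.
    - by have := integrableD mb iq ig; apply: eq_integrable.
    - move=> u; rewrite inE/= in_itv/= => /andP[u0 _].
      rewrite -EFinD lee_fin /forward_rhs -mulr_suml addNKr.
      exact: SS'.
  rewrite integralD// (integral_forward_rhs_itv n b0).
  move=> le1.
  have : (\int[leb]_(u in `[0%R, b]) (S' u)%:E <= \int[leb]_(u in `[0%R, +oo[) (S' u)%:E)%E.
    apply: ge0_subset_integral => //.
    - by apply: measurable_int iS'.
    - by move=> u /=; rewrite in_itv/= andbT lee_fin => /S'0.
  move=> /(le_trans le1); rewrite -leeBrDr// => /le_trans; apply.
  rewrite leeD2l// -EFinN lee_fin opprB.
  rewrite lerBlDr (@le_trans _ _ 1)//; first by case: (n == 0)%N.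
  by rewrite lerDl ngcp_pmf_ge0.
apply/integrableP; split; first exact/measurable_EFinP.
rewrite (_ : (fun x => _) = (EFin \o (fun u => `|intensity u * q n u|)))//.
apply: (@le_lt_trans _ _ (\int[leb]_(u in `[0%R, +oo[) (S' u)%:E + 1)%E); last first.
  rewrite lte_add_pinfty ?ltry//.
  by have := integrable_fin_num D0 iS'; rewrite fin_numElt => /andP[].
pose f u := `|intensity u * q n u|%:E.
rewrite [X in (integral _ X _ <= _)%E]itvcy_bigcup; apply: (cvge_to_le
  (@ge0_nondecreasing_set_cvg_integral _ (measurableTypeR R) R
     (fun i : nat => `[0, i%:R]%classic) f leb _ _ _ _)).
- move=> i j ij; apply/subsetPset => x; rewrite /= !in_itv/= => /andP[-> /=] /le_trans; apply.
  by rewrite ler_nat.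
- by [].
- by move=> i; apply: measurable_funS (sub i%:R) _ => //; apply/measurable_EFinP; exact: measurableT_comp.
- by move=> i x _; rewrite lee_fin.
- near=> i; apply: le_trans (bound i%:R (ler0n _ i)).
  rewrite le_eqVlt; apply/orP; left; apply/eqP; apply: eq_integral => x.
  by rewrite inE/= in_itv/= => /andP[x0 _]; rewrite /f ger0_norm// f0.
Unshelve. all: by end_near.
Qed.

Lemma integrable_forward_rhs n :
  leb.-integrable `]0, +oo[ (EFin \o forward_rhs P k lambda M v n).
Proof.
have D0 : measurable (`]0, +oo[ : set (measurableTypeR R))%classic by [].
have sub : (`]0, +oo[ : set R)%classic `<=` `[0, +oo[%classic.
  by move=> x; rewrite /= !in_itv/= !andbT => /ltW.
have Iqj j m : (1 <= j <= k)%N ->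
    leb.-integrable `]0, +oo[ (EFin \o (fun u => lambda j (u + v) * q m u)).
  move=> jk; apply: (@le_integrable _ _ _ leb _ D0 _
    (EFin \o (fun u => intensity u * q m u))).
  - apply/measurable_EFinP; apply: measurable_funS sub _ => //; apply: measurable_funM.
    + exact: measurable_shifted_intensity.
    + exact: measurable_ngcp_pmf.
  - move=> x; rewrite /= in_itv/= andbT => /ltW x0; rewrite lee_fin !normrM.
    rewrite ler_wpM2r// !ger0_norm ?intensity_sum_ge0 ?shifted_intensity_ge0//.
    exact: le_intensity_sum.
  - exact: integrableS (integrable_intensity_sum_pmf m).
have I1 : leb.-integrable `]0, +oo[ (EFin \o (fun u =>
    \sum_(1 <= j < k.+1) lambda j (u + v) * q n u)).
  by apply: integrable_sum_nat => // j jk; exact: Iqj.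
have I2 : leb.-integrable `]0, +oo[ (EFin \o (fun u =>
    \sum_(1 <= j < (minn n k).+1) lambda j (u + v) * q (n - j)%N u)).
  apply: integrable_sum_nat => // j /andP[j1]; rewrite ltnS leq_min => /andP[_ jk].
  by apply: Iqj; rewrite j1.
by have := integrableD D0 (integrableN I1) I2; apply: eq_integrable.
Qed.

End ngcp_integral_equations.

(** * Evaluation at an independent random time *)

Section grid.
Context (R : realType).

(** The least multiple of [1 / (N + 1)] strictly above [z >= 0]: right
    neighbourhoods of [z] do not contain [z] itself. *)
Definition grid (N : nat) (z : R) : R := (Num.truncn (N.+1%:R * z)).+1%:R / N.+1%:R.

Lemma grid_gt N z : z < grid N z.
Proof. by rewrite ltr_pdivlMr// mulrC truncnS_gt. Qed.

Lemma grid_le N (z : R) : 0 <= z -> grid N z <= z + N.+1%:R^-1.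
Proof.
move=> z0; rewrite ler_pdivrMr// mulrDl mulVf// -natr1 lerD2r mulrC.
by rewrite truncn_le mulr_ge0.
Qed.

Lemma grid_cvg (z : R) : 0 <= z -> grid N z @[N --> \oo] --> z.
Proof.
move=> z0; apply: (@squeeze_cvgr _ _ _ _ (fun=> z) (fun N => z + N.+1%:R^-1)).
- by near=> N; rewrite (ltW (grid_gt N z)) grid_le.
- exact: cvg_cst.
- rewrite -[X in _ --> X]addr0; apply: cvgD; first exact: cvg_cst.
  exact: (@cvg_harmonic R).
Unshelve. all: by end_near.
Qed.

Lemma grid_right_cvg (f : R -> R) z : 0 <= z ->
  f x @[x --> z^'+] --> f z -> f (grid N z) @[N --> \oo] --> f z.
Proof.
move=> z0 /cvg_at_rightP; apply; split; first by move=> N; exact: grid_gt.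
exact: grid_cvg.
Qed.

Lemma grid_near_right (z : R) (A : set R) : 0 <= z -> nbhs z^'+ A ->
  \forall N \near \oo, A (grid N z).
Proof.
move=> z0 [r /= r0 rA].
have /cvgrPdist_lt/(_ r r0) := grid_cvg z0; apply: filterS => N zN.
by apply: rA => //; exact: grid_gt.
Qed.

Lemma gridE N (z : R) i : 0 <= z ->
  i%:R <= N.+1%:R * z < i.+1%:R -> grid N z = i.+1%:R / N.+1%:R.
Proof. by move=> z0 /truncn_def; rewrite /grid => ->. Qed.

Lemma grid_ge0 N z : 0 <= grid N z.
Proof. by rewrite divr_ge0. Qed.

End grid.

Section random_time.
Context (R : realType) (d : measure_display) (T : measurableType d).
Context (P : probability T R) (M : R -> T -> nat).
Hypothesis cM : counting_process M.
Context (v : R) (v0 : 0 <= v) (n : nat).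
Local Notation q u := (ngcp_pmf P M n u v).
Context (Z : T -> R).
Hypothesis mZ : measurable_fun [set: T] Z.
Hypothesis Z0 : forall w, 0 <= Z w.
Hypothesis indZ : forall (a : R) (B : set R), 0 <= a -> measurable B ->
  P ([set w | (M (a + v)%R w - M v w)%N = n] `&` Z @^-1` B) =
  (P [set w | (M (a + v)%R w - M v w)%N = n] * P (Z @^-1` B))%E.

(** On the event [Z \in cell N i], the discretized time [grid N Z] is constant, so
    that independence applies. *)
Let cell N (i : nat) : set R := (fun z => N.+1%:R * z) @^-1` `[i%:R, i.+1%:R[%classic.

Let measurable_cell N i : measurable (cell N i).
Proof.
have mf : measurable_fun [set: R] (fun z => N.+1%:R * z).
  by apply: measurable_funM.
have := mf measurableT `[i%:R, i.+1%:R[%classic (measurable_itv _).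
by rewrite setTI.
Qed.

Let cellE N i z : cell N i z = (i%:R <= N.+1%:R * z < i.+1%:R) :> Prop.
Proof. by rewrite /cell/= in_itv. Qed.

Let trivIset_cell N : trivIset [set: nat] (fun i => Z @^-1` cell N i).
Proof.
apply/trivIsetP => i j _ _ ij; apply/seteqP; split => // w [/=].
rewrite !cellE => /truncn_def wi /truncn_def wj.
by move: ij; rewrite -wi -wj eqxx.
Qed.

Let cover_cell N : \bigcup_i (Z @^-1` cell N i) = [set: T].
Proof.
apply/seteqP; split => // w _; exists (Num.truncn (N.+1%:R * Z w)) => //=.
by rewrite cellE truncn_le ?mulr_ge0//= truncnS_gt.
Qed.

Let approx N := [set w | (M (grid N (Z w) + v) w - M v w)%N = n].

Let approx_cell N i :
  approx N `&` Z @^-1` cell N i =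
  [set w | (M (i.+1%:R / N.+1%:R + v)%R w - M v w)%N = n] `&` Z @^-1` cell N i.
Proof.
by apply/seteqP; split => w [/= ww]; rewrite cellE => wi; split => //=; move: ww;
  rewrite /approx/= (gridE (Z0 w) wi).
Qed.

Let measurable_Zcell N i : measurable (Z @^-1` cell N i).
Proof. by rewrite -[X in measurable X]setTI; exact: mZ. Qed.

Let approx_cover N : approx N = \bigcup_i (approx N `&` Z @^-1` cell N i).
Proof. by rewrite -setI_bigcupr cover_cell setIT. Qed.

Let measurable_approx N : measurable (approx N).
Proof.
rewrite approx_cover; apply: bigcupT_measurable => i; rewrite approx_cell.
apply: measurableI => //; apply: measurable_increment_eq => //.
by rewrite lerDr divr_ge0.
Qed.

Let measurable_grid N : measurable_fun [set: T] (fun w => q (grid N (Z w))).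
Proof.
rewrite -(cover_cell N); apply/measurable_fun_bigcup => // i.
apply: (@eq_measurable_fun _ _ _ _ _ (cst (q (i.+1%:R / N.+1%:R)))).
  by move=> w; rewrite inE/= cellE => wi; rewrite (gridE (Z0 w) wi).
exact: measurable_cst.
Qed.

Let probability_approx N : P (approx N) = (\int[P]_w (q (grid N (Z w)))%:E)%E.
Proof.
rewrite approx_cover measure_bigcup//; last 2 first.
- by move=> i _; apply: measurableI.
- exact: trivIset_setIl.
rewrite -[X in (\int[P]_(w in X) _)%E](cover_cell N).
rewrite ge0_integral_bigcup//; last 2 first.
- by rewrite cover_cell; exact/measurable_EFinP.
- by move=> w _; rewrite lee_fin ngcp_pmf_ge0.
rewrite [LHS](_ : _ = (\sum_(0 <= i <oo) P (approx N `&` Z @^-1` cell N i))%E); last first.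
  by apply: eq_eseriesl => i; rewrite in_setT.
apply: eq_eseriesr => i _.
have iN : 0 <= (i.+1%:R / N.+1%:R : R) by rewrite divr_ge0.
rewrite approx_cell indZ// -(EFin_ngcp_pmf P cM n iN v0).
rewrite (eq_integral (cst (q (i.+1%:R / N.+1%:R))%:E)).
  by rewrite integral_cst.
by move=> w; rewrite inE/= cellE => wi; rewrite (gridE (Z0 w) wi).
Qed.

Let A := [set w | (M (Z w + v) w - M v w)%N = n].

Let approx_near w : \forall N \near \oo, M (grid N (Z w) + v) w = M (Z w + v) w.
Proof.
apply: (@grid_near_right _ _ [set s | M (s + v) w = M (Z w + v) w]) => //.
have [|r /= r0 rM] := counting_right_continuous cM w (t := Z w + v).
  by rewrite addr_ge0.
exists r => //= s; rewrite /ball/= => sr Zs; apply: rM; last by rewrite ltrD2r.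
by rewrite /= opprD addrACA subrr addr0.
Qed.

(** Right-continuous paths are eventually constant along [grid N (Z w)]. *)
Lemma measurable_time_change : measurable [set w | (M (Z w + v) w - M v w)%N = n].
Proof.
rewrite [X in measurable X](_ : _ = \bigcup_N0 \bigcap_(N in [set N | (N0 <= N)%N]) approx N).
  by apply: bigcupT_measurable => N0; apply: bigcap_measurable => //; exists N0 => /=.
apply/seteqP; split => w.
- move=> Aw; have [N0 _ NM] := approx_near w.
  by exists N0 => // N N0N; rewrite /approx/= NM.
- move=> [N0 _ Nw]; have [N1 _ NM] := approx_near w.
  have := Nw (maxn N0 N1) (leq_maxl _ _); rewrite /approx/=.
  by rewrite NM//= leq_maxr.
Qed.

(** A random time independent of the process may be substituted for a deterministic
    one. For the discretized times [grid N Z] this is a countable sum of product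
    rules; both sides pass to the limit by right continuity. *)
Lemma probability_time_change :
  (forall u : R, 0 <= u -> q s @[s --> u^'+] --> q u) ->
  measurable_fun (`[0, +oo[ : set R) (fun u => q u) ->
  P [set w | (M (Z w + v) w - M v w)%N = n] = (\int[P]_w (q (Z w))%:E)%E.
Proof.
move=> qr mq.
have mqZ : measurable_fun [set: T] (fun w => q (Z w)).
  apply: (@measurable_comp _ _ _ _ _ _ (`[0, +oo[ : set R) (fun u => q u)) => //.
  by move=> _ [w _ <-]; rewrite /= in_itv/= andbT.
have mA := measurable_time_change.
have cst1 : P.-integrable [set: T] (cst 1%E) by exact: finite_measure_integrable_cst.
have cq : ((\int[P]_w (q (grid N (Z w)))%:E) @[N --> \oo] --> \int[P]_w (q (Z w))%:E)%E.
  apply: (@dominated_cvg _ _ _ P _ _ _ _ (cst 1%E)) => //.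
  - by move=> N; exact/measurable_EFinP.
  - move=> w _; apply: cvg_EFin; first by near=> N.
    by apply: (grid_right_cvg (f := fun u => q u)) => //; exact: qr.
  - move=> N w _; rewrite lee_fin ger0_norm ?ngcp_pmf_ge0//.
    by apply: ngcp_pmf_le1 => //; exact: grid_ge0.
have cA : (P (approx N) @[N --> \oo] --> P A)%E.
  have IE (S : set T) : measurable S -> P S = (\int[P]_w (\1_S w)%:E)%E.
    by move=> mS; rewrite integral_indic// setIT.
  rewrite (IE _ mA) (_ : (fun N => _) = (fun N => (\int[P]_w (\1_(approx N) w)%:E)%E)); last first.
    by apply/funext => N; exact: IE.
  apply: (@dominated_cvg _ _ _ P _ measurableT (fun N w => (\1_(approx N) w)%:E)
    (fun w => (\1_A w)%:E) (cst 1%E)) => //.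
  - by move=> N; apply/measurable_EFinP; exact: measurable_indic.
  - move=> w _; apply: cvg_near_cst; have := approx_near w; apply: filterS => N NM.
    by rewrite !indicE /approx /A; congr ((nat_of_bool _)%:R%:E); apply/idP/idP;
      rewrite !inE/= NM.
  - by move=> N w _; rewrite lee_fin indicE ger0_norm// lern1 leq_b1.
apply: (cvg_unique _ cA) => //.
by apply: cvg_trans cq; apply: near_eq_cvg; near=> N; rewrite probability_approx.
Unshelve. all: by end_near.
Qed.

End random_time.

Section time_changed_ngcp.
Context (R : realType) (d : measure_display) (T : measurableType d).
Context (P : probability T R) (k : nat) (lambda : nat -> R -> R) (M : R -> T -> nat).
Hypothesis hM : is_ngcp P k lambda M.
Let cM := ngcp_counting hM.
Context (v : R) (v0 : 0 <= v) (n : nat).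
Local Notation q n u := (ngcp_pmf P M n u v).
Local Notation leb := (@lebesgue_measure R).
Context (Z : T -> R).
Hypothesis mZ : measurable_fun [set: T] Z.
Hypothesis Z0 : forall w, 0 <= Z w.
Hypothesis indZ : forall (a : R) (B : set R), 0 <= a -> measurable B ->
  P ([set w | (M (a + v)%R w - M v w)%N = n] `&` Z @^-1` B) =
  (P [set w | (M (a + v)%R w - M v w)%N = n] * P (Z @^-1` B))%E.
Local Notation g := (forward_rhs P k lambda M v n).

Let pos := (`]0, +oo[ : set (measurableTypeR R))%classic.

Let mpos : measurable pos := measurable_itv _.

Let ig : leb.-integrable pos (EFin \o g) := integrable_forward_rhs hM v0 n.

Let mg : measurable_fun pos g.
Proof. by apply/measurable_EFinP; exact: measurable_int ig. Qed.

Let tail w : set R := [set u | u <= Z w].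

Let pmf_tail w :
  (q n (Z w))%:E = ((n == 0)%N%:R%:E + \int[leb]_(u in pos) (g u * \1_(tail w) u)%:E)%E.
Proof.
have <- : (\int[leb]_(u in `[0%R, Z w]) (g u)%:E =
    \int[leb]_(u in pos) (g u * \1_(tail w) u)%:E)%E; last first.
  by rewrite (integral_forward_rhs_itv hM v0 n (Z0 w)) -EFinD addrC subrK.
rewrite -integral_itv_obnd_cbnd; last first.
  apply/measurable_EFinP; apply: measurable_funS mg; first exact: mpos.
  by move=> u; rewrite /pos/= !in_itv/= andbT => /andP[].
have -> : (`]0, Z w] : set R)%classic = pos `&` tail w.
  apply/seteqP; split => u; rewrite /pos /tail/= !in_itv/= andbT.
    by move=> /andP[].
  by move=> [-> ->].
rewrite integral_mkcondr; congr (integral _ _ _); apply/funext => u.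
by rewrite patchE indicE; case: ifP => _; rewrite ?mulr1 ?mulr0.
Qed.

Let measurable_tail u : measurable [set w | u <= Z w].
Proof. by rewrite -[X in measurable X]setTI; exact: measurable_fun_le. Qed.

Let integral_tail u : (\int[P]_w (\1_(tail w) u)%:E)%E = P [set w | u <= Z w].
Proof.
rewrite (_ : (fun w => _) = (fun w => (\1_[set w | u <= Z w] w)%:E)).
  by rewrite integral_indic// setIT.
by apply/funext => w; rewrite !indicE.
Qed.

Let probability_fin (S : set T) : measurable S -> (fine (P S))%:E = P S.
Proof. by move=> mS; rewrite fineK// fin_num_measure. Qed.

(** Write [q n (Z w)] as the integral of [forward_rhs] over the points below [Z w],
    and exchange this integral with the expectation. *)
Lemma time_changed_pmfE :
  fine (P [set w | (M (Z w + v) w - M v w)%N = n]) =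
  (n == 0)%N%:R + \int[leb]_(u in `]0, +oo[)
    (g u * fine (P [set w | u <= Z w])).
Proof.
have It u : (\int[P]_w (\1_(tail w) u)%:E)%E = P [set w | u <= Z w] by exact: integral_tail.
have m1u u : measurable_fun [set: T] (fun w => (\1_(tail w) u : R)%:E).
  rewrite (_ : (fun w => _) = (fun w => (\1_[set w | u <= Z w] w)%:E)).
    by apply/measurable_EFinP; exact: measurable_indic.
  by apply/funext => w; rewrite !indicE.
have mf : measurable_fun ([set: T] `*` pos) (fun z => g z.2 * \1_(tail z.1) z.2).
  apply: measurable_funM.
    apply: (@measurable_comp _ _ _ _ _ _ pos g) => //.
    - by move=> _ [[w u] [_ /= u0] <-].
    - by apply: measurable_funTS; exact: measurable_snd.
  apply: measurable_funTS.
  exact: (measurable_indle (measurableT_comp mZ measurable_fst) measurable_snd).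
have mtail : measurable_fun [set: R] (fun u => fine (P [set w | u <= Z w])).
  apply: nonincreasing_measurable => // s t st.
  rewrite fine_le ?fin_num_measure//; apply: le_measure; rewrite ?inE// => w /=.
  exact: le_trans.
have absE u : (\int[P]_w `|g u * \1_(tail w) u|%:E)%E =
    (`|g u| * fine (P [set w | (u <= Z w)%R]))%:E.
  rewrite EFinM probability_fin// -It -ge0_integralZl//.
  apply: eq_integral => w _.
  by rewrite -EFinM normrM [`|\1_(tail w) u|]ger0_norm.
have fin : (\int[leb]_(u in pos) \int[P]_w `|g u * \1_(tail w) u|%:E < +oo)%E.
  have /integrableP[_] := ig; apply: le_lt_trans.
  apply: ge0_le_integral => //.
  - by move=> u _; apply: integral_ge0 => w _; rewrite lee_fin.
  - rewrite (_ : (fun u => _) = (fun u => (`|g u| * fine (P [set w | (u <= Z w)%R]))%:E)).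
      apply/measurable_EFinP; apply: measurable_funM; first exact: measurableT_comp.
      exact: measurable_funTS.
    by apply/funext => u; exact: absE.
  - by apply: measurableT_comp => //; exact/measurable_EFinP.
  - move=> u _; rewrite absE lee_fin ler_piMr// -lee_fin probability_fin//.
    exact: probability_le1.
have [iG EG] := fubini_on (m1 := P) (m2 := leb)
  (f := fun w u => g u * \1_(tail w) u) measurableT mpos mf fin.
have I2 : (\int[leb]_(u in pos) \int[P]_w (g u * \1_(tail w) u)%:E =
    \int[leb]_(u in pos) (g u * fine (P [set w | (u <= Z w)%R]))%:E)%E.
  apply: eq_integral => u _; rewrite EFinM probability_fin// -It.
  rewrite -integralZl//.
  apply: (le_integrable measurableT _ _ (finite_measure_integrable_cst P 1 measurableT)) => //.
  by move=> w _; rewrite lee_fin indicE !ger0_norm// lern1 leq_b1.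
apply/EFin_inj; rewrite probability_fin; last exact: measurable_time_change.
rewrite (probability_time_change cM v0 mZ Z0 indZ); last 2 first.
- by move=> u u0; exact: (ngcp_pmf_right_cvg hM v0 u0).
- exact: (measurable_ngcp_pmf hM v0).
rewrite EFinD /Rintegral -I2 -EG fineK; last exact: integrable_fin_num iG.
rewrite (_ : (fun w => _) = (fun w => ((n == 0)%N%:R%:E + \int[leb]_(u in pos) (g u * \1_(tail w) u)%:E)%E)); last first.
  by apply/funext => w; exact: pmf_tail.
rewrite integralD//; last exact: finite_measure_integrable_cst.
by rewrite integral_cst//= probability_setT mule1.
Qed.
End time_changed_ngcp.

(** * The fractional equations *)

Lemma ae_eq_integrable (R : realType) d (T : measurableType d)
    (mu : {measure set T -> \bar R}) (D : set T) (f g : T -> R) :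
  measurable D -> measurable_fun D g -> mu.-integrable D (EFin \o f) ->
  {ae mu, forall x, D x -> f x = g x} ->
  mu.-integrable D (EFin \o g) /\ \int[mu]_(x in D) g x = \int[mu]_(x in D) f x.
Proof.
move=> mD mg intf fg.
have mf := measurable_int _ intf.
have mg' : measurable_fun D (EFin \o g) by exact/measurable_EFinP.
have aeE : ae_eq mu D (EFin \o f) (EFin \o g).
  by apply: filterS fg => x /[apply] fgx; congr EFin.
split; last by congr fine; apply/esym; exact: ae_eq_integral.
apply/integrableP; split => //.
have /integrableP[_] := intf; apply: le_lt_trans; rewrite le_eqVlt; apply/orP; left; apply/eqP.
apply: ae_eq_integral => //; try exact: measurableT_comp.
by apply: filterS aeE => x /[apply] ->.
Qed.

Section independence.
Context (R : realType) (d : measure_display) (T : measurableType d).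

(** The generators are events at a single time, hence the countable decomposition
    according to the value at time [s]. *)
Lemma process_sigma_increment (M : R -> T -> nat) (s t : R) n :
  (forall w s t, 0 <= s -> s <= t -> (M s w <= M t w)%N) -> 0 <= s -> s <= t ->
  process_sigma M [set w | (M t w - M s w)%N = n].
Proof.
move=> Mnd s0 st; rewrite /process_sigma; set G := (X in <<s X >>).
have sG u m : 0 <= u -> @measurable _ (g_sigma_algebraType G) [set w | M u w = m].
  by move=> u0; apply: sub_sigma_algebra; exists u, [set m].
suff : @measurable _ (g_sigma_algebraType G) [set w | (M t w - M s w)%N = n] by [].
have -> : [set w | (M t w - M s w)%N = n] =
    \bigcup_m ([set w | M s w = m] `&` [set w | M t w = (m + n)%N]).
  apply/seteqP; split => w /=.
    by move=> <-; exists (M s w) => //; split => //=; rewrite subnKC// Mnd.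
  by move=> [m _ [/= -> ->]]; rewrite addKn.
apply: bigcupT_measurable => m; apply: measurableI; apply: sG => //.
exact: le_trans st.
Qed.

Lemma process_sigma_preimage (Y : R -> T -> R) (t : R) (B : set R) :
  0 <= t -> measurable B -> process_sigma Y (Y t @^-1` B).
Proof. by move=> t0 mB; apply: sub_sigma_algebra; exists t, B. Qed.

End independence.

Unset Implicit Arguments.

Theorem theorem3p1 (R : realType) (d : measure_display) (T : measurableType d)
    (P : probability T R) (beta v : R) (k : nat) (lambda : nat -> R -> R)
    (M : R -> T -> nat) (D : R -> T -> R) (h : R -> R -> R)
    (hbeta0 : 0 < beta) (hbeta1 : beta < 1) (hv : 0 <= v)
    (hM : is_ngcp P k lambda M)
    (hD : is_stable_subordinator P beta D)
    (hind : independent_processes P M (inverse_subordinator D))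
    (hh : forall t, 0 < t -> is_density P (inverse_subordinator D t) (h t)) :
  let q n u := ngcp_pmf P M n u v in
  let qbeta n t := time_changed_pmf P M (inverse_subordinator D) n t v in
  let rhs_integrand n t u :=
    (- (\sum_(1 <= j < k.+1) lambda j (u + v) * q n u)
     + \sum_(1 <= j < (minn n k).+1) lambda j (u + v) * q (n - j)%N u)
    * h t u in
  (forall n t, 0 < t ->
    [/\ caputo_derivable beta (qbeta n) t,
        (@lebesgue_measure R).-integrable `]0, +oo[
          (EFin \o rhs_integrand n t)
      & caputo beta (qbeta n) t =
        \int[@lebesgue_measure R]_(u in `]0, +oo[) rhs_integrand n t u]) /\
  (forall n, qbeta n 0 = (n == 0%N)%:R).
Proof.
move=> q qbeta rhs.
have mX : measurable_fun setT (D 1) := stable_measurable hD ler01.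
have X0 w : 0 <= D 1 w by exact: (stable_ge0 hD w ler01).
have HX := stable_unit_laplace hD.
have [p [cp p0 pneg [C C0 pC] dF]] := stable_density mX X0 hbeta0 hbeta1 HX.
have qE n t : 0 <= t -> qbeta n t = (n == 0)%N%:R +
    \int[@lebesgue_measure R]_(u in `]0, +oo[)
      (forward_rhs P k lambda M v n u * fine (P [set w | u <= inverse_subordinator D t w])).
  move=> t0; apply: (time_changed_pmfE hM hv).
  - exact: measurable_inverse_subordinator hD t.
  - exact: inverse_subordinator_ge0.
  - move=> a B a0 mB; apply: hind.
    + apply: process_sigma_increment => //; last by rewrite lerDr.
      exact: counting_nondecreasing (ngcp_counting hM).
    + exact: process_sigma_preimage.
split=> [n t t0|n].
- pose F := rvcdf P (D 1).
  have mF : measurable_fun [set: R] F.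
    by apply: nondecreasing_measurable => // x y; exact: rvcdf_nd.
  have F1 x : F x <= 1 by exact: rvcdf_le1.
  have ig := integrable_forward_rhs hM hv n.
  have qmix s : 0 < s -> qbeta n s = mixture beta F (forward_rhs P k lambda M v n) (n == 0)%N%:R s.
    move=> s0; rewrite (qE n s (ltW s0)) /mixture; congr (_ + _).
    apply: eq_Rintegral => u; rewrite inE/= in_itv/= andbT => u0.
    by rewrite (inverse_subordinator_tail hbeta0 hD dF s0 u0).
  have [dq intq capq] := caputo_mixture hbeta0 hbeta1 cp p0 pneg C0 pC dF
    (rvcdf_ge0 P (D 1)) F1 mF (frac_conv_density mX X0 hbeta0 hbeta1 HX cp p0 pneg C0
      (fun x x0 => (pC x x0).1) dF) ig t0 qmix.
  have mrhs : measurable_fun (`]0, +oo[ : set R) (rhs n t).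
    apply: measurable_funM.
      by apply/measurable_EFinP; exact: measurable_int ig.
    apply: measurable_funS (density_measurable (hh t t0)) => //.
    by move=> x; rewrite /= !in_itv/= !andbT => /ltW.
  have [|irhs erhs] := @ae_eq_integrable _ _ _ (@lebesgue_measure R) _ _ _
    (measurable_itv _) mrhs intq.
    have := inverse_density_ae hbeta0 hD dF t0 (hh t t0).
    apply: filterS; first exact: (ae_filter_ringOfSetsType (@lebesgue_measure R)).
    by move=> u hu /=; rewrite in_itv/= andbT => u0; rewrite /rhs hu.
  by rewrite erhs.
- rewrite qE//; set I := (X in _ + X); suff -> : I = 0 by rewrite addr0.
  rewrite /I (_ : Rintegral _ _ _ = \int[@lebesgue_measure R]_(u in `]0, +oo[) (cst 0 u)).
    by rewrite /Rintegral integral0.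
  apply: eq_Rintegral => u; rewrite inE/= in_itv/= andbT => u0.
  have u20 : 0 < u / 2 by rewrite divr_gt0.
  have u2u : u / 2 < u by rewrite ltr_pdivrMr// ltr_pMr// ltr1n.
  (* The subordinator is positive at every positive time, almost surely. *)
  suff -> : P [set w | u <= inverse_subordinator D 0 w] = 0%E by rewrite mulr0.
  apply/eqP; rewrite eq_le measure_ge0 andbT.
  apply: le_trans (inverse_subordinator_tail_le hD 0 (ltW u20) u2u) _.
  by rewrite (stable_scaling hbeta0 hD 0 u20) mul0r (rvcdf_0 mX X0 hbeta0 HX).
Qed.
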